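(* Let $d\ge2$, let $F(x_1,\ldots,x_d)$ be a real analytic function on an open subset of $\mathbb R^d$, let $V=Z(F)$, and let $U$ be a neighbourhood of a point $p\in V$ (contained in the domain of $F$). Assume that $$\nabla F(q)\neq0\qquad\text{for every } q\in U\cap V.$$ Let $$V^\circ=\{q\in U\cap V: F_{x_j}(q)\neq0\text{ for every } j=1,\ldots,d\}$$ be the coordinate-regular locus in $U\cap V$. Suppose that $V^\circ$ is dense in $U\cap V$ and that $F$ is locally degenerate at every point of $V^\circ$. Then, for every $i\in\{1,\ldots,d\}$, every local irreducible component of $$\Sigma_i(V)\cap U=\{q\in U\cap V: F_{x_i}(q)=0\}$$ is contained in a coordinate slice $$V_j(c)=V\cap\{x_j=c\}$$ for some $j\in\{1,\ldots,d\}$ and some constant $c\in\mathbb R$.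
   Context: Notation: $F_{x_i}=\partial F/\partial x_i$, and $Z(F)$ is the zero set of $F$ in its domain $\Omega$. Locally degenerate: $F$ is locally degenerate at a point $p=(a_1,\ldots,a_d)\in Z(F)$ with all $F_{x_i}(p)\neq0$ if there exist open intervals $I_i\subset\mathbb R$ containing $a_i$, with $I_1\times\cdots\times I_d\subset\Omega$, and analytic isomorphisms (real analytic bijections with real analytic inverse) $f_i\colon I_i\to J$ onto a common open interval $J$ containing $0$ such that, on $I_1\times\cdots\times I_d$, $F(x_1,\ldots,x_d)=0\iff f_1(x_1)+\cdots+f_d(x_d)=0$. A local irreducible component of a real analytic set $\Sigma$ means an irreducible component of the real analytic germ of $\Sigma$ at a point of $\Sigma$; containment in a slice is a local statement (containment of germs, i.e. in a sufficiently small neighbourhood of the point). The indices $j$ and the constants $c$ may differ for different local components, and $j$ need not equal $i$. *)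

(* Defs.v *)
From mathcomp Require Export all_boot all_order all_algebra.
From mathcomp Require Export all_classical all_reals all_analysis.
Export Order.TTheory GRing.Theory Num.Theory.
Export numFieldNormedType.Exports.

Set Implicit Arguments.
Unset Strict Implicit.
Unset Printing Implicit Defensive.

Local Open Scope classical_set_scope.
Local Open Scope ring_scope.

Section RealAnalytic.
Context {R : realType}.

(* Sum of an absolutely convergent power series on a neighbourhood of [a].
   Since the series is absolutely summable, its sum is the limit of the partial
   sums over the boxes {0, ..., n-1}^d of multi-indices. *)
Definition analytic_at (d : nat) (F : 'rV[R]_d -> R) (a : 'rV[R]_d) : Prop :=
  exists c : {ffun 'I_d -> nat} -> R,
    let term (x : 'rV[R]_d) (al : {ffun 'I_d -> nat}) : R :=
      c al * \prod_(i < d) (x 0 i - a 0 i) ^+ al i in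
    \forall x \near a,
      summable [set: {ffun 'I_d -> nat}] (fun al => (term x al)%:E) /\
      (\sum_(al : {ffun 'I_d -> 'I_n})
         term x [ffun i => nat_of_ord (al i)]) @[n --> \oo] --> F x.

Definition analytic_on (d : nat) (W : set 'rV[R]_d) (F : 'rV[R]_d -> R) : Prop :=
  forall a, W a -> analytic_at F a.

(* One variable: convergence on a neighbourhood of the center is automatically
   absolute. *)
Definition analytic1_at (f : R -> R) (a : R) : Prop :=
  exists c : R^nat, \forall x \near a, pseries c (x - a) @ \oo --> f x.

Definition analytic1_on (I : set R) (f : R -> R) : Prop :=
  forall a, I a -> analytic1_at f a.

Definition analytic_iso (I J : set R) (f : R -> R) : Prop :=
  analytic1_on I f /\
  exists g : R -> R,
    [/\ analytic1_on J g,
        forall x, I x -> J (f x) /\ g (f x) = x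
      & forall y, J y -> I (g y) /\ f (g y) = y].

(* Bounded or unbounded; in particular the empty set qualifies. *)
Definition open_interval (I : set R) : Prop := open I /\ is_interval I.

End RealAnalytic.

Section Hypersurface.
Context {R : realType} {d : nat}.
Implicit Types (F : 'rV[R]_d -> R) (Omega U V : set 'rV[R]_d).

Definition partial F (i : 'I_d) (q : 'rV[R]_d) : R :=
  'D_(delta_mx 0 i : 'rV[R]_d) F q.

Definition grad F (q : 'rV[R]_d) : 'rV[R]_d := \row_(i < d) partial F i q.

Definition zero_set Omega F : set 'rV[R]_d := [set q | Omega q /\ F q = 0].

Definition locally_degenerate Omega F (p : 'rV[R]_d) : Prop :=
  [/\ zero_set Omega F p,
      forall i, partial F i p != 0
    & exists (I : 'I_d -> set R) (J : set R) (f : 'I_d -> R -> R),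
      [/\ forall i, open_interval (I i) /\ I i (p 0 i),
          [set x : 'rV[R]_d | forall i, I i (x 0 i)] `<=` Omega,
          open_interval J /\ J 0,
          forall i, analytic_iso (I i) J (f i)
        & forall x : 'rV[R]_d, (forall i, I i (x 0 i)) ->
            (F x = 0 <-> \sum_(i < d) f i (x 0 i) = 0)]].

Definition regular_locus F U V : set 'rV[R]_d :=
  [set q | [/\ U q, V q & forall j, partial F j q != 0]].

(* The set Sigma_i(V). *)
Definition critical_locus F V (i : 'I_d) : set 'rV[R]_d :=
  [set q | V q /\ partial F i q = 0].

Definition slice V (j : 'I_d) (c : R) : set 'rV[R]_d :=
  V `&` [set x | x 0 j = c].

End Hypersurface.

(* Germs at a point [q] are represented by sets, compared near [q]. *)
Section Germs.
Context {R : realType} {d : nat} (q : 'rV[R]_d).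
Implicit Types A B C X : set 'rV[R]_d.

Definition germ_sub A B : Prop := \forall x \near q, A x -> B x.

Definition germ_eq A B : Prop := \forall x \near q, A x <-> B x.

Definition analytic_germ A : Prop :=
  exists (k : nat) (g : 'I_k -> 'rV[R]_d -> R),
    (forall s, analytic_at (g s) q) /\
    germ_eq A [set x | forall s, g s x = 0].

Definition irreducible_germ A : Prop :=
  [/\ analytic_germ A,
      ~ germ_eq A set0
    & forall B C, analytic_germ B -> analytic_germ C ->
        germ_eq A (B `|` C) -> germ_eq A B \/ germ_eq A C].

Definition irreducible_component A X : Prop :=
  [/\ irreducible_germ A,
      germ_sub A X
    & forall B, irreducible_germ B -> germ_sub A B -> germ_sub B X ->
        germ_eq A B].

End Germs.

(* Main.v *)
Require Import Defs.
From mathcomp Require Import lra ring zify.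

Set Implicit Arguments.
Unset Strict Implicit.
Unset Printing Implicit Defensive.

Local Open Scope classical_set_scope.
Local Open Scope ring_scope.

(** Let q be a point of V where F_i = 0. Some derivative F_k is nonzero at q, so
    near q the set V is a graph x_k = g over the other coordinates, and the j-th
    derivative of g is - F_j / F_k, taken on V. Where V is also given by
    sum_j f_j(x_j) = 0, comparing normals shows that F_j = kappa f_j'(x_j) on V,
    with kappa the same for all j. Hence F_i / F_j is there a quotient
    a_i(x_i) / a_j(x_j). The a_j can be written through values of the F_l on lines
    through a base point, and the relation, multiplied out, becomes a polynomial
    identity between analytic functions. It therefore extends from a neighbourhood
    of the base point to a whole chart around q (web_identity). Density of the
    coordinate-regular points supplies a base point in the chart.

    The functions a_j may have a zero or a pole at q_j but, being quotients of
    analytic functions of one variable, are finite and nonzero elsewhere near q_j.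
    So at a point x near q outside all slices x_j = q_j with j <> k, the vanishing
    of F_i forces all F_j with j <> k to vanish: x lies over a critical point of g.
    On an open orthant with corner q, let alpha be the sum over j of antiderivatives
    of a_j(x_j). As dg is proportional to d alpha, both g and the condition of being
    critical depend on alpha only. Follow the level set of alpha through x towards
    the boundary of the orthant: in the limit one obtains a critical point with the
    same value of g, either the corner or a point of a face on which all a_j have
    the same sign (orthant_critical). On such a face the level set of alpha meets
    the diagonal. The derivative of g along the diagonal is analytic and has a zero
    close to the corner, so it is identically zero and g(x) = g(q), which says that
    x_k = q_k (face_critical).

    Consequently, near q, the set where F = F_i = 0 is contained in the union of the
    slices x_j = q_j, j = 1, ..., d (critical_subset_slices), and an irreducible
    germ inside a finite union of analytic germs lies in one of them
    (irreducible_in_slice).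

    Analyticity enters only through the isolation of zeros of functions of one
    variable, of the form: s to the value of G at the point of V over x + s v. They
    are handled by factorial bounds on derivatives (analytic_jets). Power series
    satisfy such bounds (analytic_at_jets). The derivatives of a function along V
    arise by iterating a first order operator with analytic coefficients, which
    preserves them (analytic_along_line). On an interval they imply that a flat
    function is zero (isolated_zeros). *)

(** * Bounds on iterated directional derivatives *)

Section JetBounds.
Context {R : realType} {V : normedModType R} (dirs N : set V).
Hypothesis N_open : open N.
Implicit Types (G H : V -> R) (b c : nat -> R).

(** Every derivative of order l <= n of G along directions in dirs exists on N
    and is bounded there by b l; stated by recursion on n, so that closure
    properties follow by induction with G and b generalized. *)
Fixpoint jet_bound (n : nat) G b : Prop :=
  (forall x, N x -> `|G x| <= b 0%N) /\
  if n is m.+1 then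
    forall v, dirs v -> (forall x, N x -> derivable G x v) /\
                        jet_bound m ('D_v G) (fun l => b l.+1)
  else True.

Lemma jet_bound0 n G b x : jet_bound n G b -> N x -> `|G x| <= b 0%N.
Proof. by case: n => [|n] [h _]; apply: h. Qed.

Lemma jet_bound_derivable n G b v x :
  jet_bound n.+1 G b -> dirs v -> N x -> derivable G x v.
Proof. by case=> _ h dv Nx; apply: (h _ dv).1. Qed.

Lemma jet_bound_derive n G b v :
  jet_bound n.+1 G b -> dirs v -> jet_bound n ('D_v G) (fun l => b l.+1).
Proof. by case=> _ h dv; exact: (h _ dv).2. Qed.

Lemma near_open_eq G H x : {in N, G =1 H} -> N x -> {near x, G =1 H}.
Proof.
move=> GH Nx; near=> y; apply: GH; rewrite inE; near: y.
exact: open_nbhs_nbhs.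
Unshelve. all: by end_near. Qed.

Lemma jet_bound_ext n G H b : {in N, G =1 H} -> jet_bound n G b -> jet_bound n H b.
Proof.
elim: n G H b => [|n IH] G H b GH [h0 h1].
  by split=> // x Nx; rewrite -GH ?inE //; apply: h0.
split=> [x Nx|v dv]; first by rewrite -GH ?inE //; apply: h0.
have [dG jG] := h1 _ dv; split.
  by move=> x Nx; apply: (near_eq_derivable (near_open_eq GH Nx)); apply: dG.
apply: IH jG => x /set_mem Nx.
by apply: near_eq_derive; exact: near_open_eq GH Nx.
Qed.

Lemma jet_bound_le n G b c : (forall l, b l <= c l) -> jet_bound n G b -> jet_bound n G c.
Proof.
elim: n G b c => [|n IH] G b c bc [h0 h1].
  by split=> // x Nx; apply: le_trans (bc _); apply: h0.
split=> [x Nx|v dv]; first by apply: le_trans (bc _); apply: h0.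
have [dG jG] := h1 _ dv; split=> //.
by apply: IH jG => l; apply: bc.
Qed.

Lemma jet_boundS n G b : jet_bound n.+1 G b -> jet_bound n G b.
Proof.
elim: n G b => [|n IH] G b [h0 h1]; first by [].
split=> // v dv; have [dG jG] := h1 _ dv; split=> //; exact: IH.
Qed.

Lemma jet_boundD n G H b c : jet_bound n G b -> jet_bound n H c ->
  jet_bound n (fun x => G x + H x) (fun l => b l + c l).
Proof.
elim: n G H b c => [|n IH] G H b c [g0 g1] [h0 h1].
  by split=> // x Nx; apply: le_trans (ler_normD _ _) _; apply: lerD; auto.
split=> [x Nx|v dv].
  by apply: le_trans (ler_normD _ _) _; apply: lerD; auto.
have [dG jG] := g1 _ dv; have [dH jH] := h1 _ dv; split.
  by move=> x Nx; apply: derivableD; auto.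
apply: jet_bound_ext (IH _ _ _ _ jG jH) => x /set_mem Nx.
by rewrite -deriveD; auto.
Qed.

Lemma jet_bound_cst n (k : R) b : `|k| <= b 0%N -> (forall l, 0 <= b l) ->
  jet_bound n (fun=> k) b.
Proof.
elim: n k b => [|n IH] k b kb b0; first by [].
split=> // v dv; split; first by move=> x _; apply: derivable_cst.
apply: (@jet_bound_ext _ (fun=> 0)); last by apply: IH => //; rewrite normr0.
by move=> x _; rewrite derive_cst.
Qed.

(** The Leibniz rule on bounding sequences: the product of their exponential
    generating functions. *)
Definition leibniz b c (m : nat) : R :=
  \sum_(l < m.+1) 'C(m, l)%:R * b l * c (m - l)%N.

Lemma leibniz0 b c : leibniz b c 0 = b 0%N * c 0%N.
Proof. by rewrite /leibniz big_ord1 bin0 mul1r. Qed.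

Lemma leibnizS b c m :
  leibniz b (fun l => c l.+1) m + leibniz (fun l => b l.+1) c m = leibniz b c m.+1.
Proof.
rewrite /leibniz [RHS]big_ord_recl /= bin0 subn0 mul1r.
under [in RHS]eq_bigr => l _ do
  rewrite /bump leq0n add1n binS natrD 2!mulrDl subSS.
rewrite big_split /= addrA addrC [in RHS]addrC; congr (_ + _).
rewrite [in RHS]big_ord_recr /= bin_small // !mul0r addr0.
rewrite [LHS]big_ord_recl /= bin0 subn0 mul1r; congr (_ + _).
apply: eq_bigr => i _; rewrite /bump leq0n add1n.
by congr (_ * c _); have := ltn_ord i; lia.
Qed.

Lemma jet_boundM n G H b c : jet_bound n G b -> jet_bound n H c ->
  jet_bound n (fun x => G x * H x) (leibniz b c).
Proof.
have M0 G' H' b' c' : (forall x, N x -> `|G' x| <= b' 0%N) ->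
    (forall x, N x -> `|H' x| <= c' 0%N) ->
    forall x, N x -> `|G' x * H' x| <= leibniz b' c' 0.
  by move=> g h x Nx; rewrite leibniz0 normrM; apply: ler_pM; auto.
elim: n G H b c => [|n IH] G H b c jG jH.
  by split=> //; apply: M0; [case: jG|case: jH].
split; first by apply: M0; [case: jG|case: jH].
move=> v dv; split.
  by move=> x Nx; apply: derivableM; [case: jG|case: jH] => _ /(_ _ dv) []; auto.
have j1 := IH _ _ _ _ (jet_boundS jG) (jet_bound_derive jH dv).
have j2 := IH _ _ _ _ (jet_bound_derive jG dv) (jet_boundS jH).
apply: jet_bound_le (jet_bound_ext _ (jet_boundD j1 j2)).
  by move=> l; rewrite leibnizS.
move=> x /set_mem Nx.
have -> : (fun x => G x * H x) = G * H by [].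
rewrite deriveM; last 2 first.
- exact: jet_bound_derivable jG dv Nx.
- exact: jet_bound_derivable jH dv Nx.
by rewrite /GRing.scale /= [H x * _]mulrC.
Qed.

End JetBounds.

(** * Factorial bounds *)

Section FactorialBounds.
Context {R : realType}.
Implicit Types (M C L K : R).

(** The shift s in the factorial counts the differential operators that have
    already been applied. *)
Definition fact_bound M L (s l : nat) : R := M * (l + s)`!%:R * L ^+ l.

Lemma fact_bound_ge0 M L s l : 0 <= M -> 0 <= L -> 0 <= fact_bound M L s l.
Proof. by move=> M0 L0; rewrite !mulr_ge0 ?exprn_ge0. Qed.

Lemma fact_bound_le M C L K s l : 0 <= M -> M <= C -> 0 <= L -> L <= K ->
  fact_bound M L s l <= fact_bound C K s l.
Proof.
move=> M0 MC L0 LK; apply: ler_pM; rewrite ?mulr_ge0 ?exprn_ge0 //.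
  by apply: ler_wpM2r.
by apply: lerXn2r; rewrite ?nnegrE //; apply: le_trans LK.
Qed.

Lemma fact_boundS M L s l : fact_bound M L s l.+1 = fact_bound (M * L) L s.+1 l.
Proof. by rewrite /fact_bound addSnnS exprS; ring. Qed.

Lemma geom_half_le2 n : \sum_(l < n) (2^-1 : R) ^+ l <= 2.
Proof.
suff -> : \sum_(l < n) (2^-1 : R) ^+ l = 2 - 2 * 2^-1 ^+ n.
  by rewrite gerBl mulr_ge0 ?exprn_ge0 // invr_ge0.
elim: n => [|n IH]; first by rewrite big_ord0 expr0; lra.
rewrite big_ord_recr /= IH exprS; set t := _ ^+ n; lra.
Qed.

(** In the convolution the l-th term carries the factor 2 ^- l, because the
    second ratio is twice the first; summing costs only a factor 2. *)
Lemma leibniz_fact_bound M C L s m : 0 <= M -> 0 <= C -> 0 <= L ->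
  leibniz (fact_bound M L 0) (fact_bound C (2 * L) s) m <=
  fact_bound (2 * M * C) (2 * L) s m.
Proof.
move=> M0 C0 L0; rewrite /leibniz.
have -> : fact_bound (2 * M * C) (2 * L) s m = 2 * (M * C * (m + s)`!%:R * (2 * L) ^+ m).
  by rewrite /fact_bound; ring.
have B0 : 0 <= M * C * (m + s)`!%:R * (2 * L) ^+ m.
  by rewrite !mulr_ge0 ?exprn_ge0 ?mulr_ge0.
apply: le_trans (ler_wpM2r B0 (geom_half_le2 m.+1)).
rewrite mulr_suml; apply: ler_sum => -[l /= lm] _.
rewrite /fact_bound addn0.
have -> : 'C(m, l)%:R * (M * l`!%:R * L ^+ l) *
   (C * (m - l + s)`!%:R * (2 * L) ^+ (m - l)) =
   (M * C) * (('C(m, l) * l`! * (m - l + s)`!)%:R * (L ^+ l * (2 * L) ^+ (m - l))).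
  by rewrite !natrM; ring.
have -> : 2^-1 ^+ l * (M * C * (m + s)`!%:R * (2 * L) ^+ m) =
   (M * C) * ((m + s)`!%:R * (L ^+ l * (2 * L) ^+ (m - l))).
  rewrite -[in LHS](subnKC (lm : (l <= m)%N)) exprD !exprMn.
  have -> : 2^-1 ^+ l = (2 ^+ l)^-1 :> R by rewrite exprVn.
  rewrite subnKC //; field.
  by rewrite expf_neq0.
apply: ler_wpM2l; first exact: mulr_ge0.
apply: ler_wpM2r; first by rewrite mulr_ge0 ?exprn_ge0 ?mulr_ge0.
rewrite ler_nat.
have lms : (l <= m + s)%N by lia.
rewrite -(bin_fact lms) -mulnA.
have -> : (m - l + s = m + s - l)%N by lia.
by rewrite leq_mul2r leq_bin2l ?orbT //; lia.
Qed.

End FactorialBounds.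

Section AnalyticJets.
Context {R : realType} {V : normedModType R} (dirs N : set V).
Hypothesis N_open : open N.
Implicit Types (G H : V -> R).

(** Cauchy estimates, uniform on N: analyticity in a form that is stable under
    the operations needed below without manipulating power series. *)
Definition analytic_jets G := exists M L, [/\ 0 <= M, 1 <= L &
  forall n, jet_bound dirs N n G (fact_bound M L 0)].

Lemma analytic_jets_derivable G v x : analytic_jets G -> dirs v -> N x -> derivable G x v.
Proof. by move=> [M [L [_ _ /(_ 1%N) j]]] dv Nx; apply: jet_bound_derivable j dv Nx. Qed.

Lemma analytic_jets_ext G H : {in N, G =1 H} -> analytic_jets G -> analytic_jets H.
Proof.
move=> GH [M [L [M0 L1 j]]]; exists M, L; split=> // n.
exact: jet_bound_ext GH (j n).
Qed.

Lemma analytic_jets_common (I : finType) (G : I -> V -> R) :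
  (forall i, analytic_jets (G i)) -> exists M L, [/\ 0 <= M, 1 <= L &
  forall i n, jet_bound dirs N n (G i) (fact_bound M L 0)].
Proof.
move=> aG.
have /choice [ML hML] : forall i, exists ML : R * R, [/\ 0 <= ML.1, 1 <= ML.2 &
  forall n, jet_bound dirs N n (G i) (fact_bound ML.1 ML.2 0)].
  by move=> i; have [M [L h]] := aG i; exists (M, L).
exists (\sum_i (ML i).1), (1 + \sum_i (ML i).2).
have h1 i : 0 <= (ML i).1 by have [] := hML i.
have h2 i : 0 <= (ML i).2 by have [_ /(le_trans ler01)] := hML i.
split; [by rewrite sumr_ge0 | by rewrite lerDl sumr_ge0 |].
move=> i n; have [_ _ /(_ n)] := hML i; apply: jet_bound_le => l.
apply: fact_bound_le => //; first by rewrite (bigD1 i) //= lerDl sumr_ge0.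
by rewrite (bigD1 i) //= addrCA lerDl addr_ge0 ?sumr_ge0.
Qed.

Lemma analytic_jets_common2 G H : analytic_jets G -> analytic_jets H ->
  exists M L, [/\ 0 <= M, 1 <= L, forall n, jet_bound dirs N n G (fact_bound M L 0) &
    forall n, jet_bound dirs N n H (fact_bound M L 0)].
Proof.
move=> aG aH.
have [|M [L [M0 L1 j]]] := @analytic_jets_common bool (fun b => if b then G else H).
  by case.
by exists M, L; split=> //; [apply: (j true)|apply: (j false)].
Qed.

Lemma analytic_jets_cst k : analytic_jets (fun=> k).
Proof.
exists `|k|, 1; split=> // n; apply: jet_bound_cst => //.
  by rewrite /fact_bound expr0 !mulr1.
by move=> l; apply: fact_bound_ge0.
Qed.

Lemma analytic_jetsD G H : analytic_jets G -> analytic_jets H ->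
  analytic_jets (fun x => G x + H x).
Proof.
move=> aG aH; have [M [L [M0 L1 jG jH]]] := analytic_jets_common2 aG aH.
exists (M + M), L; split=> //; first exact: addr_ge0.
move=> n; apply: jet_bound_le (jet_boundD N_open (jG n) (jH n)) => l.
by rewrite /fact_bound !mulrDl.
Qed.

Lemma analytic_jetsM G H : analytic_jets G -> analytic_jets H ->
  analytic_jets (fun x => G x * H x).
Proof.
move=> aG aH; have [M [L [M0 L1 jG jH]]] := analytic_jets_common2 aG aH.
exists (2 * M * M), (2 * L); split; first by rewrite !mulr_ge0.
  by rewrite -[leLHS]mulr1 ler_pM // ler1n.
have L0 : 0 <= L by lra.
move=> n; apply: jet_bound_le (jet_boundM N_open (jG n) (jet_bound_le _ (jH n))) => l.
  by apply: (@leibniz_fact_bound _ M M L 0).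
by apply: fact_bound_le => //; lra.
Qed.

Lemma analytic_jets_sum (I : Type) (s : seq I) (P : pred I) (G : I -> V -> R) :
  (forall i, analytic_jets (G i)) -> analytic_jets (fun x => \sum_(i <- s | P i) G i x).
Proof.
move=> aG; elim: s => [|i s IH].
  by apply: analytic_jets_ext (analytic_jets_cst 0) => x _; rewrite big_nil.
case Pi : (P i).
  by apply: analytic_jets_ext (analytic_jetsD (aG i) IH) => x _; rewrite big_cons Pi.
by apply: analytic_jets_ext IH => x _; rewrite big_cons Pi.
Qed.

Lemma analytic_jets_derive G v : analytic_jets G -> dirs v -> analytic_jets ('D_v G).
Proof.
move=> [M [L [M0 L1 j]]] dv; exists (M * L), (2 * L).
have L0 : 0 <= L by lra.
split; [exact: mulr_ge0| by lra|].
move=> n; have := jet_bound_derive (j n.+1) dv; apply: jet_bound_le => l.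
rewrite fact_boundS /fact_bound addn1 addn0 factS exprMn natrM.
have -> : M * L * (l.+1%:R * l`!%:R) * L ^+ l = l.+1%:R * (M * L * l`!%:R * L ^+ l) by ring.
have -> : M * L * l`!%:R * (2 ^+ l * L ^+ l) = 2 ^+ l * (M * L * l`!%:R * L ^+ l) by ring.
apply: ler_wpM2r; first by rewrite !mulr_ge0 // exprn_ge0.
by rewrite -natrX ler_nat ltn_expl.
Qed.


Lemma jet_boundZ n (k : R) G b : jet_bound dirs N n G b ->
  jet_bound dirs N n (fun x => k * G x) (fun l => `|k| * b l).
Proof.
elim: n G b => [|n IH] G b [h0 h1].
  by split=> // x Nx; rewrite normrM ler_wpM2l // h0.
split=> [x Nx|v dv]; first by rewrite normrM ler_wpM2l // h0.
have [dG jG] := h1 _ dv; split.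
  by move=> x Nx; apply: derivableZ; apply: dG.
apply: jet_bound_ext (IH _ _ jG) => // x /set_mem Nx.
by rewrite -[fun x => k * G x]/(k \*: G) deriveZ //; apply: dG.
Qed.

Lemma jet_bound_sum n e (G : 'I_e -> V -> R) (b : 'I_e -> nat -> R) :
  (forall i, jet_bound dirs N n (G i) (b i)) ->
  jet_bound dirs N n (fun x => \sum_(i < e) G i x) (fun l => \sum_(i < e) b i l).
Proof.
move=> j.
elim: (index_enum _) => [|i s IH].
  apply: (@jet_bound_ext _ _ _ _ N_open _ (fun=> 0)) => [x _|]; first by rewrite big_nil.
  by apply: jet_bound_cst => // *; rewrite ?normr0 big_nil.
apply: (@jet_bound_ext _ _ _ _ N_open _ (fun x => G i x + \sum_(i <- s) G i x)).
  by move=> x _; rewrite big_cons.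
apply: jet_bound_le (jet_boundD N_open (j i) IH) => l.
by rewrite big_cons.
Qed.

(** Iterates of a first order operator with an n-dependent zeroth order term.
    Such a recursion appears when a quotient is differentiated repeatedly: the
    term in theta comes from the power of the denominator. *)
Fixpoint iter_operator e (w : 'I_e -> V) (p : 'I_e -> V -> R) (theta G : V -> R)
    (n : nat) : V -> R :=
  if n is m.+1 then fun x =>
    \sum_(i < e) p i x * 'D_(w i) (iter_operator w p theta G m) x +
    m%:R * (theta x * iter_operator w p theta G m x)
  else G.

(** Each application of the operator uses one derivative, hence one more step in
    the factorial, and multiplies the constant by A. This is the estimate behind
    the Cauchy-Kovalevskaya theorem. *)
Lemma jet_bound_iter_operator e (w : 'I_e -> V) (p : 'I_e -> V -> R) theta G :
  (forall i, dirs (w i)) -> (forall i, analytic_jets (p i)) -> analytic_jets theta ->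
  analytic_jets G ->
  exists C A K, [/\ 0 <= C, 0 <= A, 0 <= K & forall n m,
    jet_bound dirs N m (iter_operator w p theta G n) (fact_bound (C * A ^+ n) K n)].
Proof.
move=> dw ap ath aG.
have [|M [L [M0 L1 j]]] := @analytic_jets_common (option (option 'I_e))
    (fun o => match o with None => G | Some None => theta | Some (Some i) => p i end).
  by case=> [[i|]|].
have L0 : 0 <= L by lra.
pose K := 2 * L; have K0 : 0 <= K by rewrite mulr_ge0.
pose A := e%:R * (2 * M * K) + 2 * M.
have A0 : 0 <= A by rewrite addr_ge0 ?mulr_ge0.
exists M, A, K; split=> //.
elim=> [|n IH] m.
  apply: jet_bound_le (j None m) => l /=.
  by rewrite expr0 mulr1; apply: fact_bound_le => //; rewrite /K; lra.
have MA0 : 0 <= M * A ^+ n by rewrite mulr_ge0 ?exprn_ge0.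
have j1 i : jet_bound dirs N m
    (fun x => p i x * 'D_(w i) (iter_operator w p theta G n) x)
    (fact_bound (2 * M * (M * A ^+ n * K)) K n.+1).
  have /= j0 := jet_boundM N_open (j (Some (Some i)) m) (jet_bound_derive (IH m.+1) (dw i)).
  apply: jet_bound_le j0 => l.
  rewrite (_ : (fun l => _) = fact_bound (M * A ^+ n * K) K n.+1); last first.
    by apply/funext => l'; rewrite fact_boundS.
  by apply: leibniz_fact_bound => //; rewrite mulr_ge0.
have j2 : jet_bound dirs N m
    (fun x => n%:R * (theta x * iter_operator w p theta G n x))
    (fact_bound (2 * M * (M * A ^+ n)) K n.+1).
  have /= j0 := jet_boundZ (n%:R) (jet_boundM N_open (j (Some None) m) (IH m)).
  apply: jet_bound_le j0 => l.
  have := @leibniz_fact_bound _ M (M * A ^+ n) L n l M0 MA0 L0.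
  move=> /(ler_wpM2l (normr_ge0 (n%:R : R))) /le_trans; apply.
  rewrite normr_nat /fact_bound addnS factS natrM.
  have -> : n%:R * (2 * M * (M * A ^+ n) * (l + n)`!%:R * (2 * L) ^+ l) =
      n%:R * (2 * M * (M * A ^+ n) * (l + n)`!%:R * K ^+ l) :> R by [].
  rewrite (_ : 2 * M * (M * A ^+ n) * ((l + n).+1%:R * (l + n)`!%:R) * K ^+ l =
    (l + n).+1%:R * (2 * M * (M * A ^+ n) * (l + n)`!%:R * K ^+ l)); last by ring.
  apply: ler_wpM2r; first by rewrite !mulr_ge0 ?exprn_ge0.
  by rewrite ler_nat; lia.
have jS := jet_boundD N_open (jet_bound_sum j1) j2.
apply: jet_bound_le jS => l /=.
rewrite sumr_const card_ord -mulr_natl /fact_bound exprS /A.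
set t := (l + n.+1)`!%:R; set u := A ^+ n; set v := K ^+ l; lra.
Qed.

End AnalyticJets.

Lemma jet_bound_sub {R : realType} {V : normedModType R} (dirs N N' : set V) n G b :
  N' `<=` N -> jet_bound dirs N n G b -> jet_bound dirs N' n G b.
Proof.
move=> NN; elim: n G b => [|n IH] G b [h0 h1]; first by split=> // x /NN; exact: h0.
split=> [x /NN|v dv]; first exact: h0.
have [dG jG] := h1 v dv; split; [by move=> x /NN; exact: dG|exact: IH].
Qed.

Lemma analytic_jets_sub {R : realType} {V : normedModType R} (dirs N N' : set V) G :
  N' `<=` N -> analytic_jets dirs N G -> analytic_jets dirs N' G.
Proof.
move=> NN [M [L [M0 L1 jG]]]; exists M, L; split=> // n.
exact: jet_bound_sub NN (jG n).
Qed.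

(** * Isolated zeros in one variable *)

Section OneVariable.
Context {R : realType}.
Implicit Types (I : set R) (f df : R -> R) (h : nat -> R -> R).

Lemma is_derive_continuous f (x l : R) : is_derive x 1 f l -> {for x, continuous f}.
Proof. by case=> /derivable1_diffP /differentiable_continuous. Qed.

Lemma is_derive_scaled_pow (Q : R) n (t : R) :
  is_derive t 1 (fun t => Q * t ^+ n.+1) (Q * (n.+1%:R * t ^+ n)).
Proof.
have := is_deriveZ Q (is_deriveX n.+1 (is_derive_id t (1 : R))).
have -> : Q \*: (id ^+ n.+1) = fun t : R => Q * t ^+ n.+1.
  by apply/funext => u; rewrite exprfctE.
by rewrite /GRing.scale /= mulr1.
Qed.

Lemma is_derive_affine (a b t : R) : is_derive t 1 (fun t => a + t * b) b.
Proof.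
have := is_deriveD (is_derive_cst a t 1) (is_deriveZ b (is_derive_id t (1 : R))).
have -> : cst a + b \*: id = fun t : R => a + t * b.
  by apply/funext => u; rewrite /GRing.add /= /GRing.scale /= mulrC.
by rewrite add0r /GRing.scale /= mulr1.
Qed.

(** The mean value theorem with unordered endpoints; the intermediate point stays
    away from x, which is what the descent in nonflat_isolated needs. *)
Lemma mvt_between I f df x y : is_interval I -> I x -> I y ->
  (forall z, I z -> is_derive z 1 f (df z)) ->
  exists c, [/\ I c, `|c - x| <= `|y - x|, y != x -> c != x &
    f y - f x = df c * (y - x)].
Proof.
move=> itvI Ix Iy dI.
have main a b : I a -> I b -> a < b ->
    exists2 c, a < c < b & f b - f a = df c * (b - a).
  move=> Ia Ib ab; have [z /[!in_itv]/= /andP[az zb]||c] := @MVT _ f df a b ab.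
  - by apply: dI; apply: (itvI a b) => //; rewrite !ltW.
  - apply: continuous_in_subspaceT => z /set_mem /=; rewrite in_itv /= => azb.
    by apply: is_derive_continuous (dI z _); apply: (itvI a b).
  - by rewrite in_itv /= => acb E; exists c.
have [xy|yx|->] := ltgtP x y; last 1 first.
- by exists y; rewrite !subrr mulr0 eqxx.
- have [c /andP[xc cy] E] := main _ _ Ix Iy xy; exists c; split=> //.
  + by apply: (itvI x y) => //; rewrite !ltW.
  + by rewrite !ger0_norm; lra.
  + by rewrite gt_eqF.
- have [c /andP[yc cx] E] := main _ _ Iy Ix yx; exists c; split=> //.
  + by apply: (itvI y x) => //; rewrite !ltW.
  + by rewrite !ler0_norm; lra.
  + by rewrite lt_eqF.
  + by rewrite -opprB E -mulrN opprB.
Qed.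

Lemma derive0_cst I f x y : is_interval I -> I x -> I y ->
  (forall z, I z -> is_derive z 1 f 0) -> f x = f y.
Proof.
move=> iI Ix Iy dI.
have [c [_ _ _]] := mvt_between (df := fun=> 0) iI Iy Ix dI.
by rewrite mul0r => /subr0_eq.
Qed.

Lemma is_interval01 : is_interval [set s : R | 0 <= s <= 1].
Proof.
move=> x y /= /andP[x0 _] /andP[_ y1] z /andP[xz zy].
by rewrite (le_trans x0 xz) (le_trans zy y1).
Qed.

(** Taylor's formula at a flat point: integrate the bound B on the n-th derivative
    n times from 0. *)
Lemma flat_bound h (B : nat -> R) :
  (forall n (s : R), 0 <= s <= 1 -> is_derive s 1 (h n) (h n.+1 s)) ->
  (forall n, h n 0 = 0) -> (forall n (s : R), 0 <= s <= 1 -> `|h n s| <= B n) ->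
  forall n, `|h 0%N 1| <= B n / n`!%:R.
Proof.
move=> dh h0 hB.
suff main n j (s : R) : 0 <= s <= 1 -> `|h j s| <= B (j + n)%N / n`!%:R * s ^+ n.
  move=> n; apply: le_trans (main n 0%N 1 _) _; first by rewrite lexx ler01.
  by rewrite expr1n mulr1.
elim: n j s => [|n IH] j s s01.
  by rewrite addn0 fact0 divr1 expr0 mulr1 hB.
pose Q := B (j + n.+1)%N / (n.+1)`!%:R.
pose pw (t : R) := Q * t ^+ n.+1.
have dpw (t : R) : is_derive t 1 pw (B (j.+1 + n)%N / n`!%:R * t ^+ n).
  apply: is_derive_eq (is_derive_scaled_pow Q n t) _.
  rewrite /Q factS natrM addnS -addSn.
  have : (n`!%:R : R) != 0 by rewrite pnatr_eq0 -lt0n fact_gt0.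
  by move: (B _) => b F0; field; rewrite F0 /= addrC natr1 pnatr_eq0.
have I0 : [set t : R | 0 <= t <= 1] 0 by rewrite /= lexx ler01.
have s0 : 0 <= s by case/andP: s01.
have main (e : R) : `|e| = 1 -> e * h j s <= Q * s ^+ n.+1.
  move=> e1.
  have [c [c01 _ _]] := @mvt_between _ (fun t => pw t - e * h j t)
     (fun t => B (j.+1 + n)%N / n`!%:R * t ^+ n - e * h j.+1 t) 0 s is_interval01 I0 s01
     (fun t t01 => is_deriveB (dpw t) (is_deriveZ e (dh j t t01))).
  rewrite h0 subr0 mulr0 subr0 {2}/pw expr0n mulr0 subr0 /pw -subr_ge0 => ->.
  apply: mulr_ge0 => //; rewrite subr_ge0; apply: le_trans (IH j.+1 c c01).
  by rewrite -[X in _ <= X]mul1r -e1 -normrM ler_norm.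
rewrite -/Q ler_norml lerNl.
by rewrite -[X in X <= _ _]mulN1r main ?normrN1 //= -[X in X <= _]mul1r main ?normr1.
Qed.

Lemma geom_half_lt (e : R) : 0 < e -> exists n, (2^-1 : R) ^+ n < e.
Proof.
move=> e0.
have := @cvg_expr R 2^-1 _; rewrite normrV ?unitfE // normr_nat => /(_ _)/cvgrPdist_lt.
move=> /(_ _ e e0) [|N _ hN]; first by rewrite invf_lt1 // ltr1n.
exists N; have := hN N (leqnn N).
by rewrite /= sub0r normrN ger0_norm // exprn_ge0 // invr_ge0.
Qed.

Variable I : set R.
Hypotheses (I_open : open I) (I_itv : is_interval I).

Lemma analytic_jets_seq f : analytic_jets [set (1 : R)] I f ->
  exists h M L, [/\ 0 <= M, 1 <= L, h 0%N = f,
   forall n (x : R), I x -> is_derive x 1 (h n) (h n.+1 x) &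
   forall n x, I x -> `|h n x| <= M * n`!%:R * L ^+ n].
Proof.
move=> [M [L [M0 L1 j]]]; exists (fun n => iter n (fun g => 'D_1 g : R -> R) f), M, L.
have jn n m : jet_bound [set (1 : R)] I m (iter n (fun g => 'D_1 g : R -> R) f)
    (fun l => fact_bound M L 0 (l + n)).
  elim: n m => [|n IH] m.
    by apply: jet_bound_le (j m) => l; rewrite addn0.
  have := jet_bound_derive (IH m.+1) (erefl : [set (1 : R)] 1).
  by apply: jet_bound_le => l; rewrite addnS addSn.
split=> // [n x Ix|n x Ix].
  rewrite iterS; apply: derivableP.
  exact: jet_bound_derivable (jn n 1%N) (erefl : [set (1 : R)] 1) Ix.
apply: le_trans (jet_bound0 (jn n 0%N) Ix) _.
by rewrite /fact_bound add0n addn0.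
Qed.

Lemma seq_analytic_jets f h (M L : R) : 0 <= M -> 0 <= L -> h 0%N = f ->
  (forall n (x : R), I x -> is_derive x 1 (h n) (h n.+1 x)) ->
  (forall n x, I x -> `|h n x| <= M * n`!%:R * L ^+ n) ->
  analytic_jets [set (1 : R)] I f.
Proof.
move=> M0 L0 <- dh hB; exists M, (1 + L); split=> //; first by rewrite lerDl.
have jn m n : jet_bound [set (1 : R)] I m (h n) (fun l => fact_bound M L 0 (l + n)).
  elim: m n => [|m IH] n.
    by split=> // x Ix; rewrite add0n /fact_bound addn0 hB.
  split=> [x Ix|v ->]; first by rewrite add0n /fact_bound addn0 hB.
  split=> [x Ix|]; first by have := dh n x Ix; case.
  apply: (@jet_bound_ext _ _ _ _ I_open _ (h n.+1)).
    by move=> x /set_mem Ix; have [_ ->] := dh n x Ix.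
  by apply: jet_bound_le (IH n.+1) => l; rewrite addnS addSn.
move=> n; apply: jet_bound_le (jn n 0%N) => l; rewrite addn0.
by apply: fact_bound_le => //; rewrite lerDr.
Qed.

(** Rescaled to [0,1], the n-th derivative is at most M n! 2^-n, and Taylor's
    formula divides by n!. *)
Lemma flat_zero_near h (M L : R) x y : 0 <= M -> 0 <= L ->
  (forall n (x : R), I x -> is_derive x 1 (h n) (h n.+1 x)) ->
  (forall n x, I x -> `|h n x| <= M * n`!%:R * L ^+ n) ->
  I x -> I y -> L * `|y - x| <= 2^-1 -> (forall n, h n x = 0) -> h 0%N y = 0.
Proof.
move=> M0 L0 dh hB Ix Iy Lxy hx.
have inI (s : R) : 0 <= s <= 1 -> I (x + s * (y - x)).
  move=> /andP[s0 s1]; have [xy|yx] := leP x y.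
    by apply: (I_itv Ix Iy); nra.
  by apply: (I_itv Iy Ix); nra.
pose k n (s : R) := (y - x) ^+ n * h n (x + s * (y - x)).
have dk n (s : R) : 0 <= s <= 1 -> is_derive s 1 (k n) (k n.+1 s).
  move=> s01; rewrite /k.
  have dl : is_derive s 1 (fun s => x + s * (y - x)) (y - x).
    exact: is_derive_affine.
  have := is_deriveZ ((y - x) ^+ n) (@is_derive1_comp _ (h n) (fun s => x + s * (y - x)) s _ _ (dh n _ (inI s s01)) dl).
  move=> h1; apply: is_derive_eq h1 _.
  by rewrite /GRing.scale /= exprSr; ring.
have key n : `|h 0%N y| <= M * 2^-1 ^+ n.
  have := @flat_bound k (fun n => M * n`!%:R * 2^-1 ^+ n) dk _ _ n.
  rewrite {3}/k expr0 mul1r mul1r addrC subrK => /(_ _ _)/le_trans; apply.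
  - by move=> m; rewrite /k mul0r addr0 hx mulr0.
  - move=> m s s01; rewrite /k normrM normrX.
    apply: le_trans (ler_wpM2l (exprn_ge0 m (normr_ge0 _)) (hB m _ (inI s s01))) _.
    rewrite mulrCA -exprMn [`|_| * L]mulrC; apply: ler_wpM2l; first by rewrite mulr_ge0.
    by apply: lerXn2r => //; rewrite ?nnegrE ?mulr_ge0 ?invr_ge0.
  - have F0 : (n`!%:R : R) != 0 by rewrite pnatr_eq0 -lt0n fact_gt0.
    by rewrite mulrAC mulfK.
apply/eqP/negP => /negP h0.
have := normr_gt0 (h 0%N y); rewrite h0 => H0.
have M1 : 0 < M + 1 by lra.
have [n hn] := geom_half_lt (divr_gt0 H0 M1).
have := key n; rewrite leNgt => /negP; apply.
move: hn; rewrite ltr_pdivlMr // => /(le_lt_trans _); apply.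
by rewrite mulrC ler_wpM2l ?exprn_ge0 ?invr_ge0 // lerDl.
Qed.

Lemma fact_add_le n j : ((n + j)`! <= 2 ^ (n + j) * (n`! * j`!))%N.
Proof.
have jn : (j <= n + j)%N by rewrite leq_addl.
have E := bin_fact jn; rewrite addnK in E.
rewrite -E [(n`! * _)%N]mulnC leq_mul2r; apply/orP; right.
have := @Pascal 1 1 (n + j); rewrite addn1 => ->.
rewrite (bigD1 (inord j : 'I_(n + j).+1)) //= inordK ?ltnS //.
by rewrite !exp1n !muln1 leq_addr.
Qed.

(** Flatness propagates by steps of a fixed length: every shifted sequence
    h (n + j) obeys bounds with the same ratio 2 L. *)
Lemma flat_zero h (M L : R) x y : 0 <= M -> 1 <= L ->
  (forall n (x : R), I x -> is_derive x 1 (h n) (h n.+1 x)) ->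
  (forall n x, I x -> `|h n x| <= M * n`!%:R * L ^+ n) ->
  I x -> I y -> (forall n, h n x = 0) -> forall n, h n y = 0.
Proof.
move=> M0 L1 dh hB Ix Iy hx; have L0 : 0 <= L by lra.
have step u v : I u -> I v -> 2 * L * `|v - u| <= 2^-1 ->
    (forall n, h n u = 0) -> forall n, h n v = 0.
  move=> Iu Iv uv hu j.
  apply: (@flat_zero_near (fun n => h (n + j)%N) (M * (j`!%:R * (2 * L) ^+ j)) (2 * L) u v) => //.
  - by rewrite !mulr_ge0 ?exprn_ge0 ?mulr_ge0.
  - by rewrite mulr_ge0.
  - move=> n z Iz; apply: le_trans (hB _ _ Iz) _.
    rewrite -!mulrA; apply: ler_wpM2l => //.
    have -> : j`!%:R * ((2 * L) ^+ j * (n`!%:R * (2 * L) ^+ n)) =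
       (2 ^ (n + j) * (n`! * j`!))%:R * L ^+ (n + j) :> R.
      by rewrite !natrM natrX !exprMn !exprD; ring.
    by apply: ler_wpM2r; rewrite ?exprn_ge0 // ler_nat fact_add_le.
have chain N : forall v, I v -> 4 * L * `|v - x| <= N%:R -> forall n, h n v = 0.
  elim: N => [|N IH] v Iv hv.
    have : `|v - x| <= 0.
      by rewrite -(pmulr_rle0 _ (_ : 0 < 4 * L)) //; lra.
    by rewrite normr_le0 subr_eq0 => /eqP ->.
  pose w := x + (N%:R / N.+1%:R) * (v - x).
  have N1 : (0 : R) < N.+1%:R by rewrite ltr0n.
  have c0 : 0 <= N%:R / N.+1%:R :> R by rewrite divr_ge0.
  have c1 : N%:R / N.+1%:R <= 1 :> R by rewrite ler_pdivrMr // mul1r ler_nat.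
  have Iw : I w.
    rewrite /w; move: (N%:R / _) c0 c1 => c c0 c1.
    by have [xv|vx] := leP x v; [apply: (I_itv Ix Iv); nra|apply: (I_itv Iv Ix); nra].
  apply: (step w) => //.
    have -> : v - w = (v - x) / N.+1%:R.
      by rewrite /w; field; rewrite addrC natr1 pnatr_eq0.
    rewrite normrM normfV (ger0_norm (ltW N1)) mulrA ler_pdivrMr //.
    by rewrite -(ler_pM2l (_ : 0 < 2)) // mulrA; lra.
  apply: IH => //.
  have -> : w - x = (v - x) * (N%:R / N.+1%:R) by rewrite /w; ring.
  rewrite normrM (ger0_norm c0) mulrA.
  apply: le_trans (ler_wpM2r c0 hv) _.
  by rewrite mulrC divfK // gt_eqF.
have [N hN] : exists N, 4 * L * `|y - x| <= N%:R.
  exists (Num.truncn (4 * L * `|y - x|)).+1.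
  by apply: ltW; apply: truncnS_gt.
exact: chain hN.
Qed.

(** By the mean value theorem, a function vanishing at x whose derivative does not
    vanish near x, except perhaps at x, does not vanish near x either; descend
    from the nonzero derivative h n x. *)
Lemma nonflat_isolated h n x :
  (forall n (x : R), I x -> is_derive x 1 (h n) (h n.+1 x)) -> I x ->
  h n x != 0 -> \forall y \near x, y != x -> h 0%N y != 0.
Proof.
move=> dh Ix; elim: n h dh => [|n IH] h dh hn.
  have := is_derive_continuous (dh 0%N x Ix).
  move=> /cvgr_neq0 - /(_ hn) hc.
  by near=> y => _; near: y; exact: hc.
have IH' := IH (fun n => h n.+1) (fun n => dh n.+1) hn.
have [h0|h0] := eqVneq (h 0%N x) 0; last first.
  have := is_derive_continuous (dh 0%N x Ix).
  move=> /cvgr_neq0 - /(_ h0) hc.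
  by near=> y => _; near: y; exact: hc.
have [e /= e0 He] := (nbhs_ballP _ _).1 (filterI (open_nbhs_nbhs (conj I_open Ix)) IH').
apply/nbhs_ballP; exists e => //= y xy yx.
have [Iy _] := He y xy.
pose J := [set z | I z /\ `|z - x| < e].
have J_itv : is_interval J.
  move=> a b [Ia ha] [Ib hb] z zab; split; first exact: (I_itv Ia Ib).
  move: ha hb zab; rewrite !ltr_norml => /andP[? ?] /andP[? ?] /andP[? ?].
  by apply/andP; split; lra.
have Jx : J x by split=> //; rewrite subrr normr0.
have Jy : J y by split=> //; rewrite distrC.
have [c [[Ic hc] _ /(_ yx) cx E]] :=
  mvt_between J_itv Jx Jy (fun z (Jz : J z) => dh 0%N z Jz.1).
have /He : ball x e c by rewrite /ball /= distrC.
move=> [_ /(_ cx) h1c]; move: E; rewrite h0 subr0 => ->.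
by rewrite mulf_neq0 // subr_eq0.
Unshelve. all: by end_near. Qed.

(** Either some point is flat, and then the function is zero, or at every point
    some derivative is nonzero. *)
Theorem isolated_zeros f : analytic_jets [set (1 : R)] I f ->
  (forall x, I x -> f x = 0) \/
  (forall x, I x -> \forall y \near x, y != x -> f y != 0).
Proof.
move=> /analytic_jets_seq [h [M [L [M0 L1 h0f dh hB]]]].
have [[x [Ix hx]]|H] := pselect (exists x, I x /\ forall n, h n x = 0).
  left=> y Iy; rewrite -h0f.
  exact: (flat_zero M0 L1 dh hB Ix Iy hx).
right=> x Ix; have /existsNP [n /eqP hn] : ~ forall n, h n x = 0.
  by move=> hx; apply: H; exists x.
by rewrite -h0f; exact: nonflat_isolated dh Ix hn.
Qed.

End OneVariable.

(** * Cubes and sums over boxes of multi-indices *)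

Section Cubes.
Context {R : realType} {d : nat}.
Implicit Types (a x y : 'rV[R]_d) (r : R).

Definition cube a r : set 'rV[R]_d := [set x | forall i, `|x 0 i - a 0 i| < r].

Lemma cube_ball a r : 0 < r -> cube a r = ball a r.
Proof.
move=> r0; apply/seteqP; split=> x.
  by move=> h; split=> // i j; rewrite ord1 /ball /= distrC; apply: h.
by move=> [_ h] i; have := h 0 i; rewrite /ball /= distrC.
Qed.

Lemma cube_nbhs a r : 0 < r -> nbhs a (cube a r).
Proof. by move=> r0; rewrite cube_ball //; apply: nbhsx_ballx. Qed.

Lemma nbhs_cube a (A : set 'rV[R]_d) : nbhs a A -> exists2 r, 0 < r & cube a r `<=` A.
Proof.
by move=> /nbhs_ballP [r /= r0 hA]; exists r => //; rewrite cube_ball.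
Qed.

Lemma cube_open a r : open (cube a r).
Proof.
rewrite openE => x hx.
have [e e0 he] : exists2 e, 0 < e & forall i, `|x 0 i - a 0 i| + e <= r.
  have : \forall e \near (0 : R)^'+, forall i, `|x 0 i - a 0 i| + e <= r.
    apply: filter_forall => i; near=> e.
    rewrite -lerBrDl; apply: ltW; near: e; apply: nbhs_right_lt.
    by rewrite subr_gt0.
  move=> h.
  have : \forall e \near (0 : R)^'+, 0 < e by exact: nbhs_right_gt.
  by move=> /(filterI h) /filter_ex [e [h1 h2]]; exists e.
apply: filterS (cube_nbhs x e0) => y hy i.
have -> : y 0 i - a 0 i = (y 0 i - x 0 i) + (x 0 i - a 0 i) by ring.
apply: le_lt_trans (ler_normD _ _) _; apply: lt_le_trans (he i).
by rewrite addrC ltrD2l; apply: hy.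
Unshelve. all: by end_near. Qed.

Definition axis (j : 'I_d) : 'rV[R]_d := delta_mx 0 j.

Lemma axisE j i : axis j 0 i = (i == j)%:R.
Proof. by rewrite mxE eqxx. Qed.

Definition axes : set 'rV[R]_d := range axis.

Lemma axes_axis j : axes (axis j). Proof. by exists j. Qed.

End Cubes.

Section BoxSums.
Context {R : realType} {d : nat}.
Implicit Types (f : {ffun 'I_d -> nat} -> R).

Definition idx_nat n (al : {ffun 'I_d -> 'I_n}) : {ffun 'I_d -> nat} :=
  [ffun i => nat_of_ord (al i)].

Lemma idx_nat_inj n : injective (@idx_nat n).
Proof.
move=> al be /ffunP h; apply/ffunP => i; apply/val_inj.
by have := h i; rewrite !ffunE.
Qed.

Definition box_sum f n : R := \sum_(al : {ffun 'I_d -> 'I_n}) f (idx_nat al).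

Lemma box_sum_split f n m : (n <= m)%N -> box_sum f m =
  box_sum f n + \sum_(al : {ffun 'I_d -> 'I_m} | ~~ [forall i, (al i < n)%N]) f (idx_nat al).
Proof.
move=> nm; rewrite {1}/box_sum (bigID (fun al : {ffun 'I_d -> 'I_m} => [forall i, (al i < n)%N])) /=.
congr (_ + _); rewrite /box_sum.
pose w (al : {ffun 'I_d -> 'I_n}) : {ffun 'I_d -> 'I_m} := [ffun i => widen_ord nm (al i)].
have winj : injective w.
  move=> al be /ffunP h; apply/ffunP => i; apply/val_inj.
  by have := congr1 val (h i); rewrite !ffunE.
rewrite (eq_bigl (fun al => al \in [set w be | be in [set: {ffun 'I_d -> 'I_n}]]%SET)); last first.
  move=> al; apply/forallP/imsetP => [h|[be _ ->] i]; last by rewrite ffunE /=.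
  exists [ffun i => Ordinal (h i)] => //; apply/ffunP => i.
  by apply/val_inj; rewrite !ffunE.
rewrite big_imset /=; last by move=> ? ? _ _; apply: winj.
rewrite big_mkcond /=; apply: eq_bigr => al _; rewrite inE.
by congr f; apply/ffunP => i; rewrite !ffunE.
Qed.

(** Adding the majorant e makes all terms nonnegative, so that the box sums
    increase and stay bounded. *)
Lemma box_sum_cvg f (e : {ffun 'I_d -> nat} -> R) (M : R) :
  (forall al, `|f al| <= e al) -> (forall n, box_sum e n <= M) ->
  cvgn (box_sum f).
Proof.
move=> fe eM.
have e0 al : 0 <= e al by apply: le_trans (fe al).
have ub (g : {ffun 'I_d -> nat} -> R) : (forall al, 0 <= g al <= 2 * e al) -> cvgn (box_sum g).
  move=> g0; apply: nondecreasing_is_cvgn.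
    move=> n m nm; rewrite (box_sum_split _ nm) lerDl sumr_ge0 // => al _.
    by case/andP: (g0 (idx_nat al)).
  exists (2 * M) => _ [n _ <-].
  apply: le_trans (_ : 2 * box_sum e n <= _); last by rewrite ler_wpM2l.
  by rewrite mulr_sumr; apply: ler_sum => al _; case/andP: (g0 (idx_nat al)).
have -> : box_sum f = box_sum (fun al => f al + e al) - box_sum e.
  apply/funext => n; rewrite /box_sum /= -[RHS]/(_ - _) -sumrB.
  by apply: eq_bigr => al _; rewrite addrK.
apply: is_cvgB; apply: ub => al.
  have := fe al; rewrite ler_norml => /andP[h1 h2]; apply/andP; split; lra.
by have := e0 al; move=> h; apply/andP; split; lra.
Qed.

Lemma box_sum_le_summable f : summable [set: {ffun 'I_d -> nat}] (fun al => (f al)%:E) ->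
  exists M, 0 <= M /\ forall n, box_sum (fun al => `|f al|) n <= M.
Proof.
rewrite summableE => hf.
have [M hM] : exists M, \esum_(al in [set: {ffun 'I_d -> nat}]) `|(f al)%:E|%E = M%:E.
  by exists (fine (\esum_(al in [set: {ffun 'I_d -> nat}]) `|(f al)%:E|%E)); rewrite fineK.
exists M; split.
  by rewrite -lee_fin -hM; apply: esum_ge0 => al _.
move=> n; rewrite -lee_fin -hM.
pose s := [seq idx_nat al | al : {ffun 'I_d -> 'I_n}].
have us : uniq s by rewrite map_inj_uniq ?enum_uniq //; apply: idx_nat_inj.
apply: ereal_sup_ubound; exists [set` s] => /=.
  by split=> //; apply: finite_seq.
rewrite -fsbig_seq // /box_sum big_map big_enum /= sumEFin.
by [].
Qed.

End BoxSums.

(** * Derivatives of monomials *)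

(** A quadratic error term survives pointwise limits, which is how derivatives of
    a limit of partial sums are identified. *)
Lemma quadratic_is_derive {R : realType} {V : normedModType R} (G : V -> R) x v (l C e : R) :
  0 < e -> (forall h : R, `|h| < e -> `|G (h *: v + x) - G x - h * l| <= C * h ^+ 2) ->
  is_derive x v G l.
Proof.
move=> e0 hG.
suff H : (fun h : R => h^-1 *: ((G \o shift x) (h *: v) - G x)) @ 0^' --> l.
  by apply: DeriveDef; [apply/cvg_ex; exists l|apply: cvg_lim H].
apply/cvgrPdist_le => eps eps0.
have C1 : 0 < 1 + `|C| by have := normr_ge0 C; lra.
have D : 0 < Num.min e (eps / (1 + `|C|)) by rewrite lt_min e0 divr_gt0.
apply/nbhs_ballP; exists (Num.min e (eps / (1 + `|C|))) => //= h.
rewrite /ball /= sub0r normrN lt_min => /andP[he hC] h0.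
have h1 : 0 < `|h| by rewrite normr_gt0.
have -> : l - h^-1 *: (G (h *: v + x) - G x) = - (h^-1 * (G (h *: v + x) - G x - h * l)).
  by rewrite /GRing.scale /=; field.
rewrite normrN normrM normfV mulrC ler_pdivrMr //.
apply: le_trans (hG h he) _.
rewrite -real_normK ?num_real // expr2 mulrA; apply: ler_wpM2r => //.
apply: le_trans (_ : (1 + `|C|) * `|h| <= _).
  by apply: ler_wpM2r => //; apply: le_trans (ler_norm C) _; lra.
by rewrite mulrC -ler_pdivlMr // ltW.
Qed.

Section MonomialDerivatives.
Context {R : realType} {d : nat} (a : 'rV[R]_d).
Implicit Types (al be : {ffun 'I_d -> nat}) (x : 'rV[R]_d).

(** The be-th partial derivative of the monomial (x - a) ^ al. Where the natural
    subtraction truncates, the falling factorial is zero. *)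
Definition mono_deriv be al x : R :=
  \prod_(i < d) ((al i ^_ be i)%:R * (x 0 i - a 0 i) ^+ (al i - be i)%N).

Definition raise be (j : 'I_d) : {ffun 'I_d -> nat} := [ffun i => (be i + (i == j))%N].

Definition total_degree be : nat := \sum_(i < d) be i.

Lemma total_degree_raise be j : total_degree (raise be j) = (total_degree be).+1.
Proof.
rewrite /total_degree (eq_bigr (fun i => (be i + (i == j))%N)); last by move=> i _; rewrite ffunE.
rewrite big_split /= -[RHS]addn1; congr (_ + _)%N.
by rewrite (bigD1 j) //= eqxx big1 ?addn0 // => i /negPf ->.
Qed.

Lemma axis_shiftE (t : R) j x i : (t *: axis j + x) 0 i = t * (i == j)%:R + x 0 i.
Proof. by rewrite 2!mxE axisE. Qed.

Lemma is_derive_mono be al j x (t : R) :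
  is_derive t 1 (fun t : R => mono_deriv be al (t *: axis j + x))
    (mono_deriv (raise be j) al (t *: axis j + x)).
Proof.
pose A := \prod_(i < d | i != j) ((al i ^_ be i)%:R * (x 0 i - a 0 i) ^+ (al i - be i)%N).
have E s : mono_deriv be al (s *: axis j + x) =
    (al j ^_ be j)%:R * A * ((x 0 j - a 0 j) + s * 1) ^+ (al j - be j)%N.
  rewrite /mono_deriv (bigD1 j) //= axis_shiftE eqxx mulr1.
  rewrite (eq_bigr (fun i => (al i ^_ be i)%:R * (x 0 i - a 0 i) ^+ (al i - be i)%N)).
    by rewrite -/A mulrAC; congr (_ * _ * (_ ^+ _)); ring.
  by move=> i /negPf ij; rewrite axis_shiftE ij mulr0 add0r.
have E' : mono_deriv (raise be j) al (t *: axis j + x) =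
    (al j ^_ (be j).+1)%:R * A * ((x 0 j - a 0 j) + t * 1) ^+ (al j - (be j).+1)%N.
  rewrite /mono_deriv (bigD1 j) //= axis_shiftE eqxx mulr1 ffunE eqxx addn1.
  rewrite (eq_bigr (fun i => (al i ^_ be i)%:R * (x 0 i - a 0 i) ^+ (al i - be i)%N)).
    by rewrite -/A mulrAC; congr (_ * _ * (_ ^+ _)); ring.
  by move=> i /negPf ij; rewrite axis_shiftE ij mulr0 add0r ffunE ij addn0.
rewrite (_ : (fun s => mono_deriv be al (s *: axis j + x)) =
   fun s => (al j ^_ be j)%:R * A * ((x 0 j - a 0 j) + s * 1) ^+ (al j - be j)%N); last first.
  by apply/funext => s; rewrite E.
rewrite E'; case Em : (al j - be j)%N => [|m].
  have -> : al j ^_ (be j).+1 = 0%N by rewrite ffact_small //; lia.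
  rewrite !mul0r (_ : (fun s => _) = cst ((al j ^_ be j)%:R * A)); last first.
    by apply/funext => s; rewrite expr0 mulr1.
  exact: is_derive_cst.
have dp := @is_derive1_comp _ _ (fun s : R => (x 0 j - a 0 j) + s * 1) t _ _
  (is_derive_scaled_pow ((al j ^_ be j)%:R * A) m _) (is_derive_affine (x 0 j - a 0 j) 1 t).
apply: is_derive_eq dp _.
have -> : (al j - (be j).+1 = m)%N by lia.
by rewrite ffactnSr natrM Em; ring.
Qed.

Variable r : R.
Hypothesis r_gt0 : 0 < r.

(** n ^_ m is m! times a binomial coefficient, and the latter is at most 2 ^ n:
    halving the radius pays for it. *)
Lemma ffact_pow_le (n m : nat) (y : R) : 0 <= y -> y <= r / 2 ->
  (n ^_ m)%:R * y ^+ (n - m)%N <= m`!%:R * (2 / r) ^+ m * r ^+ n.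
Proof.
move=> y0 yr; have r0 := ltW r_gt0.
have R0 : 0 <= m`!%:R * (2 / r) ^+ m * r ^+ n.
  by rewrite !mulr_ge0 ?exprn_ge0 // divr_ge0.
have [nm|mn] := ltnP n m; first by rewrite ffact_small // mul0r.
apply: le_trans (_ : (2 ^ n * m`!)%:R * (r / 2) ^+ (n - m) <= _).
  apply: ler_pM; rewrite ?exprn_ge0 //; last first.
    by apply: lerXn2r => //; rewrite nnegrE divr_ge0.
  rewrite ler_nat -bin_ffact leq_mul2r; apply/orP; right.
  have := @Pascal 1 1 n; rewrite addn1 => ->.
  rewrite (bigD1 (inord m : 'I_n.+1)) //= inordK ?ltnS //.
  by rewrite !exp1n !muln1 leq_addr.
have [k ->] : exists k, n = (k + m)%N by exists (n - m)%N; rewrite subnK.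
rewrite addnK natrM natrX !exprD !exprMn !exprVn le_eqVlt; apply/orP; left.
apply/eqP; field.
by rewrite !expf_neq0 // gt_eqF.
Qed.

Definition deriv_const be : R := \prod_(i < d) ((be i)`!%:R * (2 / r) ^+ be i).

Lemma fact_prod_le be : (\prod_(i < d) (be i)`! <= (total_degree be)`!)%N.
Proof.
rewrite /total_degree; elim/big_ind2 : _ => // m1 n1 m2 n2 h1 h2.
apply: leq_trans (leq_mul h1 h2) _.
have le : (m1 <= m1 + m2)%N := leq_addr _ _.
have := bin_fact le; rewrite addKn => <-.
by rewrite -[leqLHS]mul1n leq_mul2r bin_gt0 le orbT.
Qed.

Lemma deriv_const_le be : deriv_const be <= (total_degree be)`!%:R * (2 / r) ^+ total_degree be.
Proof.
rewrite /deriv_const big_split /= prodrXr -natr_prod; apply: ler_wpM2r.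
  by rewrite exprn_ge0 // divr_ge0 // ltW.
by rewrite ler_nat fact_prod_le.
Qed.

Lemma mono_deriv_le be al x : cube a (r / 2) x ->
  `|mono_deriv be al x| <= deriv_const be * \prod_(i < d) r ^+ al i.
Proof.
move=> hx; rewrite /mono_deriv /deriv_const -big_split normr_prod /=.
apply: ler_prod => i _; rewrite normr_ge0 /= normrM normrX normr_nat.
by apply: ffact_pow_le => //; apply: ltW; apply: hx.
Qed.

End MonomialDerivatives.

(** * Power series satisfy Cauchy estimates *)

Lemma is_derive_bigsum {R : realType} {V : normedModType R} (I : Type) (s : seq I)
    (P : pred I) (f : I -> V -> R) (l : I -> R) x v :
  (forall i, P i -> is_derive x v (f i) (l i)) ->
  is_derive x v (fun y => \sum_(i <- s | P i) f i y) (\sum_(i <- s | P i) l i).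
Proof.
move=> df; elim: s => [|i s IH].
  rewrite big_nil (_ : (fun y => _) = cst 0); first exact: is_derive_cst.
  by apply/funext => y; rewrite big_nil.
rewrite big_cons (_ : (fun y => _) = (fun y => (if P i then f i y else 0) + \sum_(i <- s | P i) f i y)).
  case: (boolP (P i)) => Pi; first by apply: is_deriveD => //; apply: df.
  by under eq_fun do rewrite add0r.
by apply/funext => y; rewrite big_cons; case: (P i) => //; rewrite add0r.
Qed.

Lemma cvg_norm_le {R : realType} (u : R^nat) (l b : R) :
  u n @[n --> \oo] --> l -> (forall n, `|u n| <= b) -> `|l| <= b.
Proof.
by move=> ul ub; apply: (cvgr_to_le (cvg_norm ul)); apply: nearW.
Qed.

Section PowerSeriesJets.
Context {R : realType} {d : nat} (a : 'rV[R]_d) (c : {ffun 'I_d -> nat} -> R).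
Variables (r M : R).
Hypothesis r_gt0 : 0 < r.
Hypothesis cM : forall n, box_sum (fun al => `|c al| * \prod_(i < d) r ^+ al i) n <= M.

Implicit Types (al be : {ffun 'I_d -> nat}) (x : 'rV[R]_d).

Let weight al := `|c al| * \prod_(i < d) r ^+ al i.
Let term be x al := c al * mono_deriv a be al x.
Let psum be n x := box_sum (term be x) n.
Let tsum be x := limn (fun n => psum be n x).

Let M_ge0 : 0 <= M.
Proof.
apply: le_trans (cM 0); apply: sumr_ge0 => al _; rewrite mulr_ge0 // prodr_ge0 // => i _.
by rewrite exprn_ge0 // ltW.
Qed.

Let dc_ge0 be : 0 <= deriv_const r be.
Proof.
by apply: prodr_ge0 => i _; rewrite mulr_ge0 // exprn_ge0 // divr_ge0 // ltW.
Qed.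

Let term_le be x al : cube a (r / 2) x -> `|term be x al| <= deriv_const r be * weight al.
Proof.
move=> hx; rewrite /term normrM mulrCA; apply: ler_wpM2l => //.
exact: mono_deriv_le.
Qed.

Let sum_weight_le be n : box_sum (fun al => deriv_const r be * weight al) n <= M * deriv_const r be.
Proof.
rewrite /box_sum -mulr_sumr mulrC; apply: ler_wpM2r => //; exact: cM.
Qed.

Let psum_le be n x : cube a (r / 2) x -> `|psum be n x| <= M * deriv_const r be.
Proof.
move=> hx; apply: le_trans (sum_weight_le be n).
apply: le_trans (ler_norm_sum _ _ _) _; apply: ler_sum => al _.
exact: term_le.
Qed.

Let psum_cvg be x : cube a (r / 2) x -> psum be n x @[n --> \oo] --> tsum be x.
Proof.
move=> hx; apply: (@box_sum_cvg _ _ (term be x) (fun al => deriv_const r be * weight al)).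
  by move=> al; apply: term_le.
by move=> n; apply: sum_weight_le.
Qed.

Let psum_derive be n j x (t : R) :
  is_derive t 1 (fun t : R => psum be n (t *: axis j + x)) (psum (raise be j) n (t *: axis j + x)).
Proof.
apply: is_derive_bigsum => al _.
exact: (is_deriveZ (c (idx_nat al)) (is_derive_mono a be (idx_nat al) j x t)).
Qed.

Let psum_taylor be n j x (h : R) :
  cube a (r / 2) x -> cube a (r / 2) (h *: axis j + x) ->
  `|psum be n (h *: axis j + x) - psum be n x - h * psum (raise be j) n x| <=
  M * deriv_const r (raise (raise be j) j) * h ^+ 2.
Proof.
move=> hx hh.
pose I := [set t : R | cube a (r / 2) (t *: axis j + x)].
have I_itv : is_interval I.
  move=> t u It Iu z /andP[tz zu] i; have := It i; have := Iu i.
  rewrite !axis_shiftE; case: (i == j); rewrite ?mulr1 ?mulr0 //.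
  rewrite !ltr_norml => /andP[? ?] /andP[? ?]; apply/andP; split; lra.
have I0 : I 0 by rewrite /I /= scale0r add0r.
have [b [Ib b0 _]] := mvt_between I_itv I0 hh (fun t _ => psum_derive be n j x t).
rewrite scale0r add0r => ->; rewrite subr0.
have [b' [Ib' _ _]] := mvt_between I_itv I0 Ib (fun t _ => psum_derive (raise be j) n j x t).
rewrite scale0r add0r subr0 => E.
have -> : psum (raise be j) n (b *: axis j + x) * h - h * psum (raise be j) n x =
  psum (raise (raise be j) j) n (b' *: axis j + x) * (b * h).
  by rewrite mulrA -E; ring.
rewrite normrM; apply: ler_pM => //; first exact: psum_le.
rewrite normrM -real_normK ?num_real // expr2; apply: ler_wpM2r => //.
by move: b0; rewrite !subr0.
Qed.

Let tsum_derive be j x : cube a (r / 2) x -> is_derive x (axis j) (tsum be) (tsum (raise be j) x).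
Proof.
move=> hx.
have [e e0 he] : exists2 e, 0 < e & forall h : R, `|h| < e -> cube a (r / 2) (h *: axis j + x).
  have [e e0 he] := nbhs_cube (open_nbhs_nbhs (conj (@cube_open _ _ a (r / 2)) hx)).
  exists e => // h hh; apply: he => i; rewrite axis_shiftE addrK.
  by case: (i == j); rewrite ?mulr1 ?mulr0 ?normr0.
apply: (@quadratic_is_derive _ _ _ _ _ _ (M * deriv_const r (raise (raise be j) j)) e e0).
move=> h /he hh.
apply: (@cvg_norm_le _ (fun n => psum be n (h *: axis j + x) - psum be n x - h * psum (raise be j) n x)).
  apply: cvgB; first by apply: cvgB; exact: psum_cvg.
  by apply: cvgMl_tmp; exact: psum_cvg.
by move=> n; apply: psum_taylor.
Qed.

Let tsum_le be x : cube a (r / 2) x -> `|tsum be x| <= M * deriv_const r be.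
Proof.
move=> hx; apply: (@cvg_norm_le _ (fun n => psum be n x)); first exact: psum_cvg.
by move=> n; apply: psum_le.
Qed.

Let tsum_jet n be : jet_bound axes (cube a (r / 2)) n (tsum be)
  (fun l => fact_bound M (2 / r) 0 (l + total_degree be)).
Proof.
have bd be' x : cube a (r / 2) x -> `|tsum be' x| <= fact_bound M (2 / r) 0 (0 + total_degree be').
  move=> hx; apply: le_trans (tsum_le be' hx) _.
  rewrite /fact_bound add0n addn0 -mulrA; apply: ler_wpM2l => //.
  exact: deriv_const_le.
elim: n be => [|n IH] be; first by split=> //; apply: bd.
split=> [|_ [j _ <-]]; first exact: bd.
split=> [x hx|]; first by have [] := tsum_derive be j hx.
apply: (@jet_bound_ext _ _ _ _ (@cube_open _ _ _ _) _ (tsum (raise be j))).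
  by move=> x /set_mem hx; have [_ ->] := tsum_derive be j hx.
by apply: jet_bound_le (IH (raise be j)) => l; rewrite total_degree_raise addnS addSn.
Qed.

(** The derivatives of the partial sums are bounded uniformly, by cM, and converge;
    their second order Taylor estimate passes to the limit and shows that the
    limits are derivatives of one another. *)
Lemma power_series_jets (F : 'rV[R]_d -> R) :
  (forall x, cube a (r / 2) x ->
    box_sum (fun al => c al * \prod_(i < d) (x 0 i - a 0 i) ^+ al i) n @[n --> \oo] --> F x) ->
  analytic_jets axes (cube a (r / 2)) F.
Proof.
move=> hF; exists M, (1 + 2 / r); split=> //.
  by rewrite lerDl divr_ge0 // ltW.
pose be0 : {ffun 'I_d -> nat} := [ffun=> 0%N].
move=> n; apply: (@jet_bound_ext _ _ _ _ (@cube_open _ _ _ _) _ (tsum be0)).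
  move=> x /set_mem hx; apply: cvg_lim => //.
  rewrite (_ : (fun n => psum be0 n x) =
    box_sum (fun al => c al * \prod_(i < d) (x 0 i - a 0 i) ^+ al i)); first exact: hF.
  apply/funext => m; rewrite /psum /box_sum; apply: eq_bigr => al _.
  congr (_ * _); apply: eq_bigr => i _.
  by rewrite [be0 i]ffunE ffactn0 subn0 mul1r.
apply: jet_bound_le (tsum_jet n be0) => l.
have -> : total_degree be0 = 0%N by rewrite /total_degree big1 // => i _; rewrite ffunE.
rewrite addn0; apply: fact_bound_le => //; last by rewrite lerDr.
by rewrite divr_ge0 // ltW.
Qed.

End PowerSeriesJets.

Lemma analytic_at_jets {R : realType} {d : nat} (F : 'rV[R]_d -> R) a :
  analytic_at F a -> exists2 r, 0 < r & analytic_jets axes (cube a r) F.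
Proof.
move=> [c /= /nbhs_cube [r r0 hr]].
have r20 : 0 < r / 2 by rewrite divr_gt0.
have [M [M0 hM]] : exists M, 0 <= M /\
   forall n, box_sum (fun al => `|c al| * \prod_(i < d) (r / 2) ^+ al i) n <= M.
  pose x := \row_i (a 0 i + r / 2) : 'rV[R]_d.
  have [|sx _] := hr x.
    move=> i; rewrite mxE addrAC subrr add0r ger0_norm ?ltW //; lra.
  have [M [M0 hM]] := box_sum_le_summable sx; exists M; split=> // n.
  move: (hM n); congr (_ <= _); apply: eq_bigr => al _.
  rewrite normrM normr_prod; congr (_ * _); apply: eq_bigr => i _.
  by rewrite mxE addrAC subrr add0r ger0_norm // exprn_ge0 // ltW.
exists (r / 2 / 2); first by rewrite divr_gt0.
apply: (power_series_jets r20 hM) => x hx.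
have [|_ hF] := hr x.
  by move=> i; apply: lt_trans (hx i) _; lra.
exact: hF.
Qed.

(** * Calculus along curves in a cube *)

(** Caratheodory's form of the derivative, required only near t. *)
Lemma near_caratheodory {R : realType} (f Q : R -> R) (t l : R) :
  (\forall s \near t, f s - f t = Q s * (s - t)) -> Q s @[s --> t] --> l ->
  is_derive t 1 f l.
Proof.
move=> hf hQ; apply/is_derive1_caratheodory.
pose g s := if s == t then l else (f s - f t) / (s - t).
exists g; split.
- move=> s; rewrite /g; case: eqP => [->|/eqP st]; first by rewrite !subrr mulr0.
  by rewrite divfK // subr_eq0.
- apply/cvgrPdist_le => e e0; move/cvgrPdist_le : hQ => /(_ e e0) hQ.
  near=> s; rewrite /g eqxx; case: eqP => [_|/eqP st]; first by rewrite subrr normr0 ltW.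
  have -> : f s - f t = Q s * (s - t) by near: s.
  by rewrite mulfK ?subr_eq0 //; near: s.
- by rewrite /g eqxx.
Unshelve. all: by end_near. Qed.

Lemma is_derive_line {R : realType} {V : normedModType R} (F : V -> R) x v (t l : R) :
  is_derive (t *: v + x) v F l -> is_derive t 1 (fun s : R => F (s *: v + x)) l.
Proof.
have E : (fun h : R => h^-1 *: ((F \o shift (t *: v + x)) (h *: v) - F (t *: v + x))) =
  (fun h : R => h^-1 *: (((fun s : R => F (s *: v + x)) \o shift t) (h *: 1) - F (t *: v + x))).
  by apply/funext => h; rewrite /= [h%:A]mulr1 scalerDl addrA.
by case; rewrite /derivable /derive E => h1 h2; apply: DeriveDef.
Qed.

Lemma cvg_bigsum {R : realType} (T : Type) (F : set_system T) {FF : Filter F} (I : Type)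
    (s : seq I) (P : pred I) (f : I -> T -> R) (l : I -> R) :
  (forall i, P i -> f i x @[x --> F] --> l i) ->
  \sum_(i <- s | P i) f i x @[x --> F] --> \sum_(i <- s | P i) l i.
Proof.
move=> fl; elim: s => [|i s IH].
  rewrite big_nil; under eq_fun do rewrite big_nil.
  exact: cvg_cst.
rewrite big_cons; under eq_fun do rewrite big_cons.
by case: (boolP (P i)) => Pi //; apply: cvgD => //; apply: fl.
Qed.

Section CubeCalculus.
Context {R : realType} {d : nat} (a : 'rV[R]_d) (r : R).
Notation N := (cube a r).
Implicit Types (G : 'rV[R]_d -> R) (x y z : 'rV[R]_d).

Lemma cube_between x y z : N x -> N y ->
  (forall i, z 0 i = x 0 i \/ z 0 i = y 0 i) -> N z.
Proof. by move=> Nx Ny h i; case: (h i) => ->. Qed.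

(** Change x into y one coordinate at a time and telescope. *)
Lemma mvt_cube G x y : (forall j z, N z -> derivable G z (axis j)) -> N x -> N y ->
  exists xi : 'I_d -> 'rV[R]_d,
    (forall j, N (xi j) /\ forall i, `|xi j 0 i - x 0 i| <= `|y 0 i - x 0 i|) /\
    G y - G x = \sum_j (y 0 j - x 0 j) * 'D_(axis j) G (xi j).
Proof.
move=> dG Nx Ny.
pose mix (s : seq 'I_d) : 'rV[R]_d := \row_i (if i \in s then y 0 i else x 0 i).
have main s : uniq s -> exists xi : 'I_d -> 'rV[R]_d,
    (forall j, N (xi j) /\ forall i, `|xi j 0 i - x 0 i| <= `|y 0 i - x 0 i|) /\
    G (mix s) - G x = \sum_(j <- s) (y 0 j - x 0 j) * 'D_(axis j) G (xi j).
  elim: s => [_|j s IH /= /andP[js us]].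
    exists (fun=> x); split; first by move=> j; split=> // i; rewrite subrr normr0.
    rewrite big_nil; apply/eqP; rewrite subr_eq0; apply/eqP; congr G.
    by apply/rowP => i; rewrite mxE in_nil.
  have [xi [hxi E]] := IH us.
  pose I := [set t : R | N (t *: axis j + mix s)].
  have Nm s' : N (mix s').
    by apply: (cube_between Nx Ny) => i; rewrite mxE; case: ifP => _; [right|left].
  have I_itv : is_interval I.
    move=> t u It Iu z /andP[tz zu] i; have := It i; have := Iu i.
    rewrite !axis_shiftE; case: (i == j); rewrite ?mulr1 ?mulr0 //.
    rewrite !ltr_norml => /andP[? ?] /andP[? ?]; apply/andP; split; lra.
  have mixE : mix (j :: s) = (y 0 j - x 0 j) *: axis j + mix s.
    apply/rowP => i; rewrite axis_shiftE !mxE inE.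
    case: eqP => [->|_] /=; first by rewrite (negPf js) mulr1 subrK.
    by rewrite mulr0 add0r.
  have I0 : I 0 by rewrite /I /= scale0r add0r.
  have I1 : I (y 0 j - x 0 j) by rewrite /I /= -mixE.
  have [c [Ic c0 _]] := mvt_between I_itv I0 I1
    (fun t (It : I t) => is_derive_line (derivableP (dG j _ It))).
  rewrite -mixE scale0r add0r subr0 => Ec.
  exists (fun i => if i == j then c *: axis j + mix s else xi i); split.
    move=> i; case: eqP => _; last exact: hxi.
    split=> // i'; rewrite axis_shiftE mxE.
    case: (eqVneq i' j) => [->|_]; first by rewrite (negPf js) mulr1 addrK; move: c0; rewrite !subr0.
    by rewrite mulr0 add0r; case: ifP => _ //; rewrite subrr normr0.
  rewrite big_cons eqxx.
  rewrite (eq_big_seq (fun j => (y 0 j - x 0 j) * 'D_(axis j) G (xi j))); last first.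
    by move=> i si /=; case: eqP => // ij; rewrite -ij si in js.
  by rewrite -E (mulrC (y 0 j - x 0 j)) -Ec; ring.
have [xi [h1 h2]] := main (index_enum 'I_d) (index_enum_uniq _).
exists xi; split=> //; rewrite -h2; congr (G _ - _).
by apply/rowP => i; rewrite mxE mem_index_enum.
Qed.

Lemma rV_cvg (T : Type) (F : set_system T) {FF : Filter F} (f : T -> 'rV[R]_d) x :
  (forall i, f s 0 i @[s --> F] --> x 0 i) -> f s @[s --> F] --> x.
Proof.
move=> h; apply/cvg_ballP => e e0; rewrite -cube_ball //.
suff : \forall s \near F, forall i, `|f s 0 i - x 0 i| < e by [].
apply: (@filter_forall T _ (fun i => [set s | `|f s 0 i - x 0 i| < e]) F FF) => i.
move/cvgrPdist_lt : (h i) => /(_ e e0); apply: filterS => s.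
by rewrite distrC.
Qed.

Lemma coord_cvg (T : Type) (F : set_system T) {FF : Filter F} (f : T -> 'rV[R]_d) x i :
  f s @[s --> F] --> x -> f s 0 i @[s --> F] --> x 0 i.
Proof.
move=> h.
exact: (@continuous_cvg _ _ _ F FF f (fun y : 'rV[R]_d => y 0 i) x (@coord_continuous R 1 d 0 i x) h).
Qed.

Lemma lipschitz_continuous G x (C : R) :
  (\forall y \near x, `|G y - G x| <= \sum_j `|y 0 j - x 0 j| * C) ->
  {for x, continuous G}.
Proof.
move=> hG.
have hb : (\sum_j `|y 0 j - x 0 j| * C) @[y --> x] --> \sum_(j < d) 0 * C.
  apply: (@cvg_bigsum R _ (nbhs x) (nbhs_filter x)) => j _; apply: cvgMr_tmp.
  rewrite -(normr0 R) -(subrr (x 0 j)); apply: cvg_norm.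
  by apply: cvgB; [exact: coord_continuous|exact: cvg_cst].
rewrite big1 in hb; last by move=> j _; rewrite mul0r.
suff H : G y @[y --> x] --> G x by exact: H.
apply/(@cvgrPdist_le _ _ _ (nbhs x) (nbhs_filter x)) => e e0.
move/cvgr_le : hb => /(_ e e0) hb; near=> y.
rewrite distrC; apply: le_trans (_ : \sum_j `|y 0 j - x 0 j| * C <= _); by near: y.
Unshelve. all: by end_near. Qed.

Lemma analytic_jets_lipschitz G : analytic_jets axes N G ->
  exists2 C, 0 <= C & forall j x, N x -> `|'D_(axis j) G x| <= C.
Proof.
move=> [M [L [M0 L1 jG]]]; exists (M * L); first by rewrite mulr_ge0 //; lra.
move=> j x Nx; have := jet_bound0 (jet_bound_derive (jG 1%N) (axes_axis j)) Nx.
by rewrite /fact_bound addn0 !mulr1 expr1.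
Qed.

Lemma analytic_jets_continuous G x : analytic_jets axes N G -> N x ->
  {for x, continuous G}.
Proof.
move=> aG Nx; have [C C0 hC] := analytic_jets_lipschitz aG.
have dG j z (Nz : N z) := analytic_jets_derivable aG (axes_axis j) Nz.
apply: (@lipschitz_continuous _ _ C).
have : \forall y \near x, N y by apply: open_nbhs_nbhs; split=> //; exact: cube_open.
apply: filterS => y Ny; have [xi [hxi ->]] := mvt_cube dG Nx Ny.
apply: le_trans (ler_norm_sum _ _ _) _; apply: ler_sum => j _.
by rewrite normrM; apply: ler_wpM2l => //; apply: hC; exact: (hxi j).1.
Qed.

Section Curves.
Variables (G : 'rV[R]_d -> R) (ga : R -> 'rV[R]_d) (t : R).
Hypotheses (aG : analytic_jets axes N G) (Nt : N (ga t)).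

Let dG j z (Nz : N z) := analytic_jets_derivable aG (axes_axis j) Nz.

Lemma curve_increment : ga s @[s --> t] --> ga t ->
  exists xi : R -> 'I_d -> 'rV[R]_d,
    (\forall s \near t, G (ga s) - G (ga t) =
      \sum_j (ga s 0 j - ga t 0 j) * 'D_(axis j) G (xi s j)) /\
    (forall j, 'D_(axis j) G (xi s j) @[s --> t] --> 'D_(axis j) G (ga t)).
Proof.
move=> gac.
have near_N : \forall s \near t, N (ga s).
  by apply: gac; apply: open_nbhs_nbhs; split=> //; exact: cube_open.
have /choice [xi hxi] : forall s, exists xi : 'I_d -> 'rV[R]_d, N (ga s) ->
    (forall j, N (xi j) /\ forall i, `|xi j 0 i - ga t 0 i| <= `|ga s 0 i - ga t 0 i|) /\
    G (ga s) - G (ga t) = \sum_j (ga s 0 j - ga t 0 j) * 'D_(axis j) G (xi j).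
  move=> s; have [Ns|Ns] := pselect (N (ga s)).
    by have [xi hxi] := mvt_cube dG Nt Ns; exists xi.
  by exists (fun=> 0).
exists xi; split.
  by near=> s; apply: (hxi s _).2; near: s.
move=> j; have cD := analytic_jets_continuous (analytic_jets_derive aG (axes_axis j)) Nt.
suff H : xi s j @[s --> t] --> ga t.
  exact: (@continuous_cvg _ _ _ _ _ (fun s => xi s j) ('D_(axis j) G) (ga t) cD H).
apply: rV_cvg => i.
apply/cvgrPdist_le => e e0.
have hc0 : ga s 0 i @[s --> t] --> ga t 0 i by exact: coord_cvg gac.
move/cvgrPdist_le : hc0 => /(_ e e0) hc; near=> s.
have Ns : N (ga s) by near: s.
rewrite distrC; apply: le_trans (((hxi s Ns).1 j).2 i) _; rewrite distrC.
by near: s.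
Unshelve. all: by end_near. Qed.

Lemma derive_quotient_cvg (f : R -> R) (l : R) : is_derive t 1 f l ->
  exists Q : R -> R, (forall s, f s - f t = Q s * (s - t)) /\ Q s @[s --> t] --> l.
Proof.
by move=> /is_derive1_caratheodory [Q [h1 h2 <-]]; exists Q.
Qed.

Lemma chain_rule (l : 'I_d -> R) :
  (forall j, is_derive t 1 (fun s => ga s 0 j) (l j)) ->
  is_derive t 1 (fun s => G (ga s)) (\sum_j l j * 'D_(axis j) G (ga t)).
Proof.
move=> dga.
have gac : ga s @[s --> t] --> ga t.
  by apply: rV_cvg => i; exact: is_derive_continuous (dga i).
have [xi [h1 h2]] := curve_increment gac.
have /choice [Q hQ] := fun j => derive_quotient_cvg (dga j).
apply: (@near_caratheodory _ _ (fun s => \sum_j Q j s * 'D_(axis j) G (xi s j))).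
  near=> s; rewrite mulr_suml (_ : _ - _ = \sum_j (ga s 0 j - ga t 0 j) * 'D_(axis j) G (xi s j)).
    by apply: eq_bigr => j _; rewrite (hQ j).1 mulrAC.
  by near: s.
by apply: cvg_bigsum => j _; apply: cvgM; [exact: (hQ j).2|exact: h2].
Unshelve. all: by end_near. Qed.

(** Solve the increment identity for the increment of the k-th coordinate. Only
    the continuity of that coordinate is used, so that this lemma also proves its
    differentiability. *)
Lemma implicit_derivative (k : 'I_d) (l : 'I_d -> R) :
  (forall j, j != k -> is_derive t 1 (fun s => ga s 0 j) (l j)) ->
  ga s 0 k @[s --> t] --> ga t 0 k -> (\forall s \near t, G (ga s) = 0) ->
  'D_(axis k) G (ga t) != 0 ->
  is_derive t 1 (fun s => ga s 0 k)
    (- (\sum_(j | j != k) l j * 'D_(axis j) G (ga t)) / 'D_(axis k) G (ga t)).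
Proof.
move=> dga gak G0 Dk.
have gac : ga s @[s --> t] --> ga t.
  apply: rV_cvg => i; have [->//|ik] := eqVneq i k.
  exact: is_derive_continuous (dga i ik).
have [xi [h1 h2]] := curve_increment gac.
have /choice [Q hQ] : forall j, exists Q : R -> R, j != k ->
    (forall s, ga s 0 j - ga t 0 j = Q s * (s - t)) /\ Q s @[s --> t] --> l j.
  move=> j; have [->|jk] := eqVneq j k; first by exists (fun=> 0).
  by have [Q hQ] := derive_quotient_cvg (dga j jk); exists Q.
have G0t : G (ga t) = 0 by exact: nbhs_singleton G0.
have near_D : \forall s \near t, 'D_(axis k) G (xi s k) != 0.
  by apply: (cvgr_neq0 _ (h2 k)).
apply: (@near_caratheodory _ _ (fun s =>
   - (\sum_(j | j != k) Q j s * 'D_(axis j) G (xi s j)) / 'D_(axis k) G (xi s k))).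
  near=> s.
  have Ds : 'D_(axis k) G (xi s k) != 0 by near: s.
  have : 0 = \sum_j (ga s 0 j - ga t 0 j) * 'D_(axis j) G (xi s j).
    rewrite -[LHS](subrr 0) -{1}G0t; near: s.
    apply: filterS2 h1 G0 => s E Gs; rewrite -E Gs G0t //.
  rewrite (bigD1 k) //= => /esym/eqP; rewrite addr_eq0 => /eqP E.
  rewrite -[LHS](mulfK Ds) E mulrAC; congr (_ / _).
  rewrite mulNr mulr_suml; congr (- _); apply: eq_bigr => j jk.
  by rewrite (hQ j jk).1 mulrAC.
apply: cvgM; last by apply: cvgV => //; exact: h2.
apply: cvgN; apply: cvg_bigsum => j jk.
by apply: cvgM; [exact: (hQ j jk).2|exact: h2].
Unshelve. all: by end_near. Qed.

End Curves.
End CubeCalculus.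

(** * The implicit function *)

Section Update.
Context {R : realType} {d : nat}.
Implicit Types (x y : 'rV[R]_d) (k : 'I_d).

Definition upd x k (u : R) : 'rV[R]_d := \row_j (if j == k then u else x 0 j).

Lemma updk x k u : upd x k u 0 k = u. Proof. by rewrite mxE eqxx. Qed.

Lemma updN x k u j : j != k -> upd x k u 0 j = x 0 j.
Proof. by move=> /negPf jk; rewrite mxE jk. Qed.

Lemma upd_id x k : upd x k (x 0 k) = x.
Proof. by apply/rowP => j; rewrite mxE; case: eqP => // ->. Qed.

Lemma upd_line x k u : upd x k u = u *: axis k + upd x k 0.
Proof.
apply/rowP => j; rewrite axis_shiftE !mxE; case: (j == k); first by rewrite mulr1 addr0.
by rewrite mulr0 add0r.
Qed.

Lemma upd_eq x y k u : (forall j, j != k -> x 0 j = y 0 j) -> upd x k u = upd y k u.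
Proof. by move=> xy; apply/rowP => j; rewrite !mxE; case: eqP => // /eqP; exact: xy. Qed.

(** The k-th coordinate is left free: points of a slab stand for points of the
    base over which V is a graph. *)
Definition slab (q : 'rV[R]_d) k (rho : R) : set 'rV[R]_d :=
  [set x | forall j, j != k -> `|x 0 j - q 0 j| < rho].

Lemma slab_open q k rho : open (slab q k rho).
Proof.
rewrite openE => x hx.
have hx' : cube q rho (upd x k (q 0 k)) \/ rho <= 0.
  have [rho0|] := ltP 0 rho; last by right.
  left=> j; have [->|jk] := eqVneq j k; first by rewrite updk subrr normr0.
  by rewrite updN //; apply: hx.
case: hx' => [hx'|rho0].
  have [e e0 he] := nbhs_cube (open_nbhs_nbhs (conj (@cube_open _ _ _ _) hx')).
  apply: filterS (cube_nbhs x e0) => y hy j jk.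
  have := he (upd y k (q 0 k)) _ j; rewrite updN //; apply=> i.
  have [->|ik] := eqVneq i k; first by rewrite !updk subrr normr0.
  by rewrite !updN //; apply: hy.
have nk j : j != k -> False.
  by move=> jk; have := hx j jk; rewrite ltNge (le_trans rho0 (normr_ge0 _)).
by apply: filterS (@filterT _ (nbhs x) _) => y _ j /nk.
Qed.

End Update.

Section GraphExistence.
Context {R : realType} {d : nat} (q : 'rV[R]_d) (r m : R) (F : 'rV[R]_d -> R) (k : 'I_d).
Notation N := (cube q r).
Hypotheses (r_gt0 : 0 < r) (aF : analytic_jets axes N F) (m_gt0 : 0 < m).
Hypothesis Fk_ge : forall x, N x -> m <= 'D_(axis k) F x.
Hypothesis Fq0 : F q = 0.

Let dF j z (Nz : N z) := analytic_jets_derivable aF (axes_axis j) Nz.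

Let derive_upd x u : N (upd x k u) ->
  is_derive u 1 (fun u => F (upd x k u)) ('D_(axis k) F (upd x k u)).
Proof.
move=> h; under eq_fun do rewrite upd_line.
by apply: is_derive_line; rewrite -upd_line; apply: derivableP; apply: dF.
Qed.

Let itv_upd x : is_interval [set u | N (upd x k u)].
Proof.
move=> t u It Iu z /andP[tz zu] i; have := It i; have := Iu i.
rewrite !mxE; case: (i == k) => //.
rewrite !ltr_norml => /andP[? ?] /andP[? ?]; apply/andP; split; lra.
Qed.

Lemma graph_unique x u v : N (upd x k u) -> N (upd x k v) ->
  F (upd x k u) = F (upd x k v) -> u = v.
Proof.
move=> Nu Nv E.
have [c [Ic _ _]] := mvt_between (@itv_upd x) Nu Nv (fun u (Iu : [set u | N (upd x k u)] u) => derive_upd Iu).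
rewrite E subrr => /esym/eqP; rewrite mulf_eq0 subr_eq0 => /orP[|/eqP //].
by rewrite gt_eqF // (lt_le_trans m_gt0) // Fk_ge.
Qed.

Let F_increasing u : 0 < u -> u < r ->
  0 < F (upd q k (q 0 k + u)) /\ F (upd q k (q 0 k - u)) < 0.
Proof.
move=> u0 ur.
have inN w : `|w| <= u -> N (upd q k (q 0 k + w)).
  move=> wu j; have [->|jk] := eqVneq j k; first by rewrite updk addrAC subrr add0r (le_lt_trans wu).
  by rewrite updN // subrr normr0.
have Np := inN u; have Nm := inN (- u); have N0 := inN 0.
rewrite normrN (ger0_norm (ltW u0)) in Nm Np; rewrite normr0 in N0.
have {}N0 := N0 (ltW u0); have {}Np := Np (lexx _); have {}Nm := Nm (lexx _).
have F0 : F (upd q k (q 0 k + 0)) = 0 by rewrite addr0 upd_id.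
have [c [Ic _ _]] := mvt_between (@itv_upd q) N0 Np (fun u (Iu : [set u | N (upd q k u)] u) => derive_upd Iu).
have [b [Ib _ _]] := mvt_between (@itv_upd q) N0 Nm (fun u (Iu : [set u | N (upd q k u)] u) => derive_upd Iu).
rewrite F0 !subr0 => -> ->.
have -> : q 0 k + u - (q 0 k + 0) = u by ring.
have -> : q 0 k - u - (q 0 k + 0) = - u by ring.
rewrite mulrN oppr_lt0.
by split; apply: mulr_gt0 => //; apply: lt_le_trans (Fk_ge _).
Qed.

(** F increases along the k-th axis and changes sign between q_k - r/2 and
    q_k + r/2; by continuity it still does over points near q, and the
    intermediate value theorem gives the zero. *)
Lemma graph_exists : exists rho (g : 'rV[R]_d -> R), [/\ 0 < rho, rho <= r,
  forall x, slab q k rho x -> N (upd x k (g x)) /\ F (upd x k (g x)) = 0 &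
  forall x u, slab q k rho x -> N (upd x k u) -> F (upd x k u) = 0 -> u = g x].
Proof.
have r2 : 0 < r / 2 by rewrite divr_gt0.
have r2r : r / 2 < r by lra.
have [Fp Fm] := F_increasing r2 r2r.
have inN w : `|w| < r -> N (upd q k (q 0 k + w)).
  move=> wu j; have [->|jk] := eqVneq j k; first by rewrite updk addrAC subrr add0r.
  by rewrite updN // subrr normr0.
have Np : N (upd q k (q 0 k + r / 2)) by apply: inN; rewrite ger0_norm // ltW.
have Nm : N (upd q k (q 0 k - r / 2)) by apply: inN; rewrite normrN ger0_norm // ltW.
have [ep ep0 hp] : exists2 e, 0 < e & cube (upd q k (q 0 k + r / 2)) e `<=` [set z | 0 < F z].
  apply: nbhs_cube; exact: (cvgr_gt _ (analytic_jets_continuous aF Np) _ Fp).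
have [em em0 hm] : exists2 e, 0 < e & cube (upd q k (q 0 k - r / 2)) e `<=` [set z | F z < 0].
  apply: nbhs_cube; exact: (cvgr_lt _ (analytic_jets_continuous aF Nm) _ Fm).
pose rho := Num.min r (Num.min ep em).
have rho0 : 0 < rho by rewrite !lt_min r_gt0 ep0 em0.
have sol x : exists u, slab q k rho x -> N (upd x k u) /\ F (upd x k u) = 0.
  have [hx|hx] := pselect (slab q k rho x); last by exists 0.
  have inNx u : `|u - q 0 k| < r -> N (upd x k u).
    move=> hu j; have [->|jk] := eqVneq j k; first by rewrite updk.
    by rewrite updN //; have := hx j jk; rewrite /rho !lt_min => /andP[].
  have P0 : 0 < F (upd x k (q 0 k + r / 2)).
    apply: hp => j; have [->|jk] := eqVneq j k; first by rewrite !updk subrr normr0.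
    by rewrite !updN //; have := hx j jk; rewrite /rho !lt_min => /and3P[].
  have M0 : F (upd x k (q 0 k - r / 2)) < 0.
    apply: hm => j; have [->|jk] := eqVneq j k; first by rewrite !updk subrr normr0.
    by rewrite !updN //; have := hx j jk; rewrite /rho !lt_min => /and3P[].
  have [|||u hu Fu] := @IVT _ (fun u => F (upd x k u)) (q 0 k - r / 2) (q 0 k + r / 2) 0.
  - by lra.
  - apply: continuous_in_subspaceT => u /set_mem /=; rewrite in_itv /= => hu.
    apply: is_derive_continuous (derive_upd (inNx _ _)).
    by rewrite ltr_norml; move: hu => /andP[? ?]; apply/andP; split; lra.
  - by rewrite ge_min le_max (ltW P0) (ltW M0) orbT.
  - exists u => _; split=> //; apply: inNx.
    by move: hu; rewrite in_itv /= ltr_norml => /andP[? ?]; apply/andP; split; lra.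
have [g hg] := choice sol.
exists rho, g; split=> //; first by rewrite /rho ge_min lexx.
move=> x u hx Nu Fu; have [Ng Fg] := hg x hx.
by apply: (graph_unique Nu Ng); rewrite Fu Fg.
Qed.

End GraphExistence.

(** * Analyticity on the graph *)

Section GraphCalculus.
Context {R : realType} {d : nat} (q : 'rV[R]_d) (r m rho : R) (F g : 'rV[R]_d -> R) (k : 'I_d).
Notation N := (cube q r).
Notation B := (slab q k rho).
Implicit Types (x y : 'rV[R]_d).
Hypotheses (aF : analytic_jets axes N F) (m_gt0 : 0 < m).
Hypothesis Fk_ge : forall x, N x -> m <= 'D_(axis k) F x.
Hypothesis g_graph : forall x, B x -> N (upd x k (g x)) /\ F (upd x k (g x)) = 0.
Hypothesis g_unique : forall x u, B x -> N (upd x k u) -> F (upd x k u) = 0 -> u = g x.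

Definition graph_pt x := upd x k (g x).
(** Up to the factor - 1 / graph_partial k, this is the j-th partial derivative of
    the function g whose graph is the hypersurface. *)
Definition graph_partial j x := 'D_(axis j) F (graph_pt x).

Lemma g_eq x y : B x -> (forall j, j != k -> x 0 j = y 0 j) -> g x = g y.
Proof.
move=> Bx xy; have By : B y by move=> j jk; rewrite -xy //; apply: Bx.
by have [] := g_graph Bx; rewrite (upd_eq _ xy); apply: g_unique.
Qed.

Lemma graph_pt_eq x y : B x -> (forall j, j != k -> x 0 j = y 0 j) -> graph_pt x = graph_pt y.
Proof. by move=> Bx xy; rewrite /graph_pt (g_eq Bx xy); apply: upd_eq. Qed.

Lemma graph_partialk_ge x : B x -> m <= graph_partial k x.
Proof. by move=> Bx; apply: Fk_ge; case: (g_graph Bx). Qed.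

Lemma graph_partialk_neq0 x : B x -> graph_partial k x != 0.
Proof. by move=> /graph_partialk_ge h; rewrite gt_eqF // (lt_le_trans m_gt0). Qed.

Lemma g_continuous x : B x -> {for x, continuous g}.
Proof.
move=> Bx; have [C C0 hC] := analytic_jets_lipschitz aF.
have dF j z (Nz : N z) := analytic_jets_derivable aF (axes_axis j) Nz.
apply: (@lipschitz_continuous _ _ _ _ (C / m)).
have : \forall y \near x, B y by apply: open_nbhs_nbhs; split=> //; exact: slab_open.
apply: filterS => y By; have [Nx Fx] := g_graph Bx; have [Ny Fy] := g_graph By.
have [xi [hxi]] := mvt_cube dF Nx Ny.
rewrite Fx Fy subrr (bigD1 k) //= !updk => /esym/eqP; rewrite addr_eq0 => /eqP E.
have D0 : 0 < 'D_(axis k) F (xi k).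
  by apply: lt_le_trans m_gt0 _; apply: Fk_ge; exact: (hxi k).1.
rewrite -mulr_suml mulrA ler_pdivlMr //.
apply: le_trans (_ : `|(g y - g x) * 'D_(axis k) F (xi k)| <= _).
  rewrite normrM ler_wpM2l // (ger0_norm (ltW D0)).
  by apply: Fk_ge; exact: (hxi k).1.
rewrite E normrN mulr_suml [leRHS](bigD1 k) //=.
apply: ler_wpDl; first by rewrite mulr_ge0.
apply: le_trans (ler_norm_sum _ _ _) _; apply: ler_sum => j jk.
rewrite normrM !updN //; apply: ler_wpM2l => //; apply: hC; exact: (hxi j).1.
Qed.

Section AlongCurve.
Variables (c : R -> 'rV[R]_d) (t : R) (l : 'I_d -> R).
Hypotheses (Bt : B (c t)) (dc : forall j, is_derive t 1 (fun s => c s 0 j) (l j)).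

Let c_cvg : c s @[s --> t] --> c t.
Proof. by apply: rV_cvg => j; exact: is_derive_continuous (dc j). Qed.

Let near_B : \forall s \near t, B (c s).
Proof. by apply: c_cvg; apply: open_nbhs_nbhs; split=> //; exact: slab_open. Qed.

Lemma g_derive : is_derive t 1 (fun s => g (c s))
  (- (\sum_(j | j != k) l j * graph_partial j (c t)) / graph_partial k (c t)).
Proof.
have [Nt Ft] := g_graph Bt.
pose ga s := graph_pt (c s).
have -> : (fun s => g (c s)) = (fun s => ga s 0 k) by apply/funext => s; rewrite /ga updk.
apply: (@implicit_derivative _ _ q r F ga t aF Nt k l).
- move=> j jk; rewrite (_ : (fun s => _) = (fun s => c s 0 j)); first exact: dc.
  by apply/funext => s; rewrite /ga updN.
- rewrite (_ : (fun s => ga s 0 k) = (fun s => g (c s))); last first.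
    by apply/funext => s; rewrite /ga updk.
  rewrite /ga updk.
  exact: (@continuous_cvg _ _ _ _ _ c g (c t) (g_continuous Bt) c_cvg).
- by apply: filterS near_B => s Bs; case: (g_graph Bs).
- exact: graph_partialk_neq0.
Qed.

Definition graph_pt_speed j := if j == k then
  - (\sum_(j | j != k) l j * graph_partial j (c t)) / graph_partial k (c t) else l j.

Lemma graph_pt_derive G : analytic_jets axes N G ->
  is_derive t 1 (fun s => G (graph_pt (c s)))
    (\sum_j graph_pt_speed j * 'D_(axis j) G (graph_pt (c t))).
Proof.
move=> aG; have [Nt Ft] := g_graph Bt.
apply: (@chain_rule _ _ q r G (fun s => graph_pt (c s)) t aG Nt) => j.
rewrite /graph_pt_speed; have [->|jk] := eqVneq j k.
  rewrite (_ : (fun s => _) = (fun s => g (c s))); first exact: g_derive.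
  by apply/funext => s; rewrite updk.
rewrite (_ : (fun s => _) = (fun s => c s 0 j)); first exact: dc.
by apply/funext => s; rewrite updN.
Qed.

End AlongCurve.

Lemma graph_pt_continuous G x : analytic_jets axes N G -> B x ->
  {for x, continuous (fun y => G (graph_pt y))}.
Proof.
move=> aG Bx; have [Nx _] := g_graph Bx.
have lc : graph_pt y @[y --> x] --> graph_pt x.
  apply: (@rV_cvg _ _ _ (nbhs x) (nbhs_filter x)) => j; have [->|jk] := eqVneq j k.
    rewrite updk (_ : (fun y => _) = g); first exact: g_continuous.
    by apply/funext => y; rewrite updk.
  rewrite updN // (_ : (fun y => _) = (fun y : 'rV[R]_d => y 0 j)); last first.
    by apply/funext => y; rewrite updN.
  exact: coord_continuous.
exact: (@continuous_cvg _ _ _ _ _ graph_pt G (graph_pt x) (analytic_jets_continuous aG Nx) lc).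
Qed.

Lemma graph_partial_continuous j x : B x -> {for x, continuous (graph_partial j)}.
Proof.
by move=> Bx; apply: (graph_pt_continuous (analytic_jets_derive aF (axes_axis j)) Bx).
Qed.

Section Lines.
Variables (x v : 'rV[R]_d).
Let I := [set s : R | B (s *: v + x)].

Lemma line_open : open I.
Proof.
rewrite openE => s Is.
have lc : (s *: v + x) @[s --> s] --> s *: v + x.
  by apply: cvgD; [exact: scalel_continuous|exact: cvg_cst].
by apply: lc; apply: open_nbhs_nbhs; split=> //; exact: slab_open.
Qed.

Lemma line_itv : is_interval I.
Proof.
move=> t u It Iu z /andP[tz zu] i ik; have := It i ik; have := Iu i ik.
rewrite !mxE !ltr_norml => /andP[? ?] /andP[? ?].
have [v0|v0] := leP 0 (v 0 i).
  by apply/andP; split; nra.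
by apply/andP; split; nra.
Qed.

Let dline (s : R) j : is_derive s 1 (fun s : R => (s *: v + x) 0 j) (v 0 j).
Proof.
rewrite (_ : (fun s => _) = (fun s => x 0 j + s * v 0 j)); first exact: is_derive_affine.
by apply/funext => u; rewrite !mxE addrC.
Qed.

Let Fv y := \sum_(j | j != k) v 0 j * 'D_(axis j) F y.
Let Fk := 'D_(axis k) F.
Let spd j y := if j == k then - Fv y else Fk y * v 0 j.
Let theta y := -2 * (\sum_j (spd j y) * 'D_(axis j) Fk y).

Let graph_pt_speedE j (s : R) : I s ->
  graph_pt_speed (fun s => s *: v + x) s (fun j => v 0 j) j =
  spd j (graph_pt (s *: v + x)) / Fk (graph_pt (s *: v + x)).
Proof.
move=> Is; rewrite /graph_pt_speed /spd; case: (j == k) => //.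
by rewrite mulrAC divff ?mul1r //; exact: (graph_partialk_neq0 Is).
Qed.

(** Analyticity of G on the graph, without an analytic implicit function theorem.
    Let X = F_k v - (v F) e_k, a field tangent to the level sets of F. Along the
    line the n-th derivative is G_n / F_k ^ (2 n) with G_0 = G and
    G_(n+1) = F_k X G_n - 2 n (X F_k) G_n, an iteration to which
    jet_bound_iter_operator applies. *)
Theorem analytic_along_line G : analytic_jets axes N G ->
  analytic_jets [set (1 : R)] I (fun s : R => G (graph_pt (s *: v + x))).
Proof.
move=> aG.
have aFj j : analytic_jets axes N ('D_(axis j) F).
  by apply: analytic_jets_derive => //; exact: axes_axis.
have oN := @cube_open _ _ q r.
have aspd j : analytic_jets axes N (spd j).
  have aFv : analytic_jets axes N Fv.
    apply: (analytic_jets_sum oN) => i; apply: (analytic_jetsM oN) => //.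
    exact: (analytic_jets_cst _ oN).
  rewrite /spd; case: (j == k).
    apply: (analytic_jets_ext oN (G := fun y => (-1) * Fv y)).
      by move=> y _; rewrite mulN1r.
    by apply: (analytic_jetsM oN) => //; exact: (analytic_jets_cst _ oN).
  apply: (analytic_jetsM oN); [exact: (aFj k)|exact: (analytic_jets_cst _ oN)].
have ath : analytic_jets axes N theta.
  apply: (analytic_jetsM oN); first exact: (analytic_jets_cst _ oN).
  apply: (analytic_jets_sum oN) => j; apply: (analytic_jetsM oN) => //.
  exact: (analytic_jets_derive (aFj k) (axes_axis j)).
pose p j y := Fk y * spd j y.
have ap j : analytic_jets axes N (p j) by apply: (analytic_jetsM oN); [exact: (aFj k)|].
have [C [A [K [C0 A0 K0 jG]]]] :=
  jet_bound_iter_operator oN (@axes_axis R d) ap ath aG.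
pose Gn := iter_operator (@axis R d) p theta G.
pose ga s := graph_pt (s *: v + x).
pose h n (s : R) := Gn n (ga s) * (Fk (ga s))^-1 ^+ (2 * n).
have m0 : 0 <= m := ltW m_gt0.
apply: (@seq_analytic_jets _ _ line_open _ h C (A * m^-1 ^+ 2)) => //.
- by rewrite mulr_ge0 // exprn_ge0 // invr_ge0.
- by apply/funext => s; rewrite /h /= mulr1.
- move=> n s Is.
  have Fk0 : Fk (ga s) != 0 := graph_partialk_neq0 Is.
  (* The shift n in the factorial is absorbed by (l + n)! <= 2 ^ (l + n) l! n!. *)
  have aGn : analytic_jets axes N (Gn n).
    exists (C * A ^+ n * n`!%:R * 2 ^+ n), (1 + 2 * K); split.
    + by rewrite !mulr_ge0 ?exprn_ge0.
    + by rewrite lerDl mulr_ge0.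
    + move=> e; apply: jet_bound_le (jG n e) => l.
      rewrite /fact_bound addn0.
      apply: le_trans (_ : C * A ^+ n * n`!%:R * 2 ^+ n * l`!%:R * (2 * K) ^+ l <= _).
        rewrite exprMn.
        have -> : C * A ^+ n * n`!%:R * 2 ^+ n * l`!%:R * (2 ^+ l * K ^+ l) =
           C * A ^+ n * (2 ^ (l + n) * (l`! * n`!))%:R * K ^+ l.
          by rewrite !natrM natrX exprD; ring.
        apply: ler_wpM2r; first exact: exprn_ge0.
        apply: ler_wpM2l; first by rewrite mulr_ge0 ?exprn_ge0.
        by rewrite ler_nat fact_add_le.
      apply: ler_wpM2l; first by rewrite !mulr_ge0 ?exprn_ge0.
      by apply: lerXn2r; rewrite ?nnegrE ?addr_ge0 ?mulr_ge0 // lerDr.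
  have d1 := graph_pt_derive Is (dline s) aGn.
  have d2 := graph_pt_derive Is (dline s) (aFj k).
  have d3 := is_deriveM d1 (is_deriveX (2 * n) (is_deriveV Fk0 d2)).
  have hE : h n = (fun s => Gn n (ga s)) * (fun s => (Fk (ga s))^-1) ^+ (2 * n).
    by apply/funext => u; rewrite exprfctE.
  rewrite hE; apply: (is_derive_eq d3).
  have E H : \sum_j graph_pt_speed (fun s => s *: v + x) s (fun j => v 0 j) j * 'D_(axis j) H (ga s)
      = (\sum_j spd j (ga s) * 'D_(axis j) H (ga s)) / Fk (ga s).
    rewrite mulr_suml; apply: eq_bigr => j _.
    by rewrite (graph_pt_speedE j Is) -/(ga s) mulrAC.
  pose a := \sum_j spd j (ga s) * 'D_(axis j) (Gn n) (ga s).
  pose b := \sum_j spd j (ga s) * 'D_(axis j) Fk (ga s).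
  transitivity (Gn n (ga s) * ((2 * n)%:R * (Fk (ga s))^-1 ^+ (2 * n).-1 *
      (- (Fk (ga s)) ^- 2 * (b / Fk (ga s)))) + (Fk (ga s))^-1 ^+ (2 * n) * (a / Fk (ga s))).
    by rewrite exprfctE !E.
  have -> : h n.+1 s = (Fk (ga s) * a + n%:R * (- 2 * b * Gn n (ga s))) * (Fk (ga s))^-1 ^+ (2 * n.+1).
    rewrite /h; congr (_ * _); rewrite /a mulr_sumr /Gn /=; congr (_ + _).
    by apply: eq_bigr => j _; rewrite /p mulrA.
  move: a b (Gn n (ga s)) => a b c.
  move: (Fk (ga s)) Fk0 => y y0.
  have -> : (2 * n.+1 = (2 * n).+2)%N by lia.
  case: n {h Gn jG aGn d1 d2 d3 hE E} => [|n]; first by rewrite !expr0; field.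
  have -> : (2 * n.+1 = (2 * n).+2)%N by lia.
  have -> : ((2 * n).+2)%:R = 2 * n.+1%:R :> R by rewrite -natrM; congr (_%:R); lia.
  rewrite /= !exprS; move: (n.+1%:R) (y^-1 ^+ (2 * n)) => w z.
  by field.
- move=> n s Is; have [Nx _] := g_graph Is.
  have Fkm : m <= Fk (ga s) := graph_partialk_ge Is.
  rewrite /h normrM normrX normfV.
  have -> : C * n`!%:R * (A * m^-1 ^+ 2) ^+ n = C * A ^+ n * n`!%:R * m^-1 ^+ (2 * n).
    by rewrite exprMn -exprM; ring.
  apply: ler_pM; rewrite ?exprn_ge0 ?invr_ge0 //.
    by apply: le_trans (jet_bound0 (jG n 0%N) Nx) _; rewrite /fact_bound expr0 mulr1 add0n.
  apply: lerXn2r; rewrite ?nnegrE ?invr_ge0 //.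
  by rewrite lef_pV2 ?posrE ?normr_gt0 // ?(graph_partialk_neq0 Is) // (le_trans Fkm) // ler_norm.
Qed.

End Lines.

End GraphCalculus.

(** * Antiderivatives and their inverses *)

Section Antiderivative.
Context {R : realType}.

Lemma itv_oo_interval (lo hi : R) : is_interval [set t : R | lo < t < hi].
Proof.
move=> x y /= /andP[lx _] /andP[_ yh] z /andP[xz zy].
by rewrite (lt_le_trans lx xz) (le_lt_trans zy yh).
Qed.

Lemma itv_oo_open (lo hi : R) : open [set t : R | lo < t < hi].
Proof.
rewrite (_ : [set t : R | lo < t < hi] = `]lo, hi[%classic); first exact: interval_open.
by apply/seteqP; split=> t /=; rewrite in_itv.
Qed.

Lemma antiderivative (f : R -> R) (l0 h0 lo hi : R) :
  (forall t, l0 < t < h0 -> {for t, continuous f}) ->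
  l0 < lo -> hi < h0 ->
  exists A : R -> R, forall t, lo < t < hi -> is_derive t 1 A (f t).
Proof.
move=> fc l0lo hih0.
exists (fun x => \int[lebesgue_measure]_(t in `[lo, x]) (f t))%R => t /andP[lt th].
have fi : lebesgue_measure.-integrable `[lo, hi] (EFin \o f).
  apply: continuous_compact_integrable; first exact: segment_compact.
  apply: continuous_in_subspaceT => s /set_mem /=; rewrite in_itv /= => /andP[ls sh].
  by apply: fc; rewrite (lt_le_trans l0lo ls) (le_lt_trans sh hih0).
have [] := @continuous_FTC1_closed _ f lo t hi th fi lt.
  by apply: fc; rewrite (lt_trans l0lo lt) (lt_trans th hih0).
by move=> d1; rewrite derive1E => d2; apply: DeriveDef.
Qed.

Lemma antiderivative_inverse (f : R -> R) (lo hi : R) (A : R -> R) :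
  (forall t, lo < t < hi -> f t != 0) ->
  (forall t, lo < t < hi -> is_derive t 1 A (f t)) ->
  exists B : R -> R, forall t, lo < t < hi ->
    [/\ B (A t) = t, is_derive (A t) 1 B (f t)^-1 & {near A t, cancel B A}].
Proof.
move=> f0 dA.
pose B v := xget 0 [set t | lo < t < hi /\ A t = v].
have BK t : lo < t < hi -> B (A t) = t.
  move=> ht; rewrite /B; case: xgetP => [s _ [hs E]|/(_ t)[]//].
  have [c [hc _ _]] := mvt_between (@itv_oo_interval lo hi) ht hs dA.
  rewrite E subrr => /esym/eqP; rewrite mulf_eq0 subr_eq0 (negPf (f0 _ hc)) /=.
  by move/eqP.
exists B => t ht.
have nt : \forall s \near t, lo < s < hi.
  by apply: open_nbhs_nbhs; split=> //; exact: itv_oo_open.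
have nc : {near t, continuous A}.
  by apply: filterS nt => s hs; exact: is_derive_continuous (dA s hs).
have nK : {near t, cancel A B} by apply: filterS nt.
split; [exact: BK| |exact: near_continuous_can_sym].
exact: (is_derive_inverse nK nc (dA t ht) (f0 t ht)).
Qed.

Lemma same_sign (f : R -> R) (lo hi : R) :
  (forall t, lo < t < hi -> f t != 0) ->
  (forall t, lo < t < hi -> {for t, continuous f}) ->
  (forall t, lo < t < hi -> 0 < f t) \/ (forall t, lo < t < hi -> f t < 0).
Proof.
move=> f0 fc.
have main x y : lo < x < hi -> lo < y < hi -> 0 < f x -> f y < 0 -> False.
  move=> hx hy fx fy.
  have inI z : Num.min x y <= z <= Num.max x y -> lo < z < hi.
    move: hx hy => /andP[? ?] /andP[? ?]; rewrite ge_min le_max => /andP[].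
    by move=> /orP[?|?] /orP[?|?]; apply/andP; split; lra.
  have [|||z] := @IVT _ f (Num.min x y) (Num.max x y) 0.
  - by rewrite ge_min !le_max lexx.
  - apply: continuous_in_subspaceT => z /set_mem /=; rewrite in_itv /= => hz.
    by apply: fc; exact: inI.
  - by case: (leP x y) => _; rewrite ge_min le_max (ltW fx) (ltW fy) ?orbT.
  - rewrite in_itv /= => hz fz; have := f0 z (inI z hz); rewrite fz eqxx //.
have [[x [hx fx]]|H] := pselect (exists x, lo < x < hi /\ 0 < f x).
  left=> y hy; have := f0 y hy; rewrite neq_lt => /orP[fy|//].
  by case: (main x y hx hy fx fy).
right=> y hy; have := f0 y hy; rewrite neq_lt => /orP[//|fy].
by case: H; exists y.
Qed.

End Antiderivative.

(** * Critical points in an orthant *)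

(** G is a function on the box [0, delta)^d seen from a corner, u j is its j-th
    partial derivative, and K is the set of active coordinates. By web, the
    differential of G is proportional to the sum of the forms a j (y_j) dy_j. *)
Section Orthant.
Context {R : realType} {d : nat}.
Variables (G : 'rV[R]_d -> R) (u : 'I_d -> 'rV[R]_d -> R) (a : 'I_d -> R -> R).
Variables (K : {set 'I_d}) (delta : R).
Implicit Types (y z : 'rV[R]_d) (S : {set 'I_d}) (t : R).

Definition orthant_box y := forall j, 0 <= y 0 j < delta.

Definition ray S t : 'rV[R]_d := \row_j (if j \in S then t else 0).

Hypothesis delta_gt0 : 0 < delta.
Hypothesis G_chain : forall (c : R -> 'rV[R]_d) t (l : 'I_d -> R), orthant_box (c t) ->
  (forall j, is_derive t 1 (fun s => c s 0 j) (l j)) ->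
  is_derive t 1 (fun s => G (c s)) (\sum_(j in K) l j * u j (c t)).
Hypothesis G_cont : forall y, orthant_box y -> {for y, continuous G}.
Hypothesis u_cont : forall j y, orthant_box y -> {for y, continuous (u j)}.
Hypothesis web : forall y i j, orthant_box y -> i \in K -> j \in K ->
  0 < y 0 i -> 0 < y 0 j -> u i y * a j (y 0 j) = u j y * a i (y 0 i).
Hypothesis a_neq0 : forall j t, j \in K -> 0 < t < delta -> a j t != 0.
Hypothesis a_cont : forall j t, j \in K -> 0 < t < delta -> {for t, continuous (a j)}.
Hypothesis diag : forall S, S \subset K ->
  (forall t, 0 < t < delta -> \sum_(j in S) u j (ray S t) != 0) \/
  (forall t, 0 <= t < delta -> \sum_(j in S) u j (ray S t) = 0).

Section Levels.
Variables (lo hi : R) (A B : 'I_d -> R -> R).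
Hypotheses (lo_gt0 : 0 < lo) (hi_lt : hi < delta).
Hypothesis dA : forall j t, j \in K -> lo < t < hi -> is_derive t 1 (A j) (a j t).
Hypothesis AB : forall j t, j \in K -> lo < t < hi ->
  [/\ B j (A j t) = t, is_derive (A j t) 1 (B j) (a j t)^-1 &
      {near A j t, cancel (B j) (A j)}].

(** Keeping coordinates between lo > 0 and hi < delta avoids the ends, where the
    antiderivatives A j may tend to infinity. *)
Definition inner_face S y := forall j, if j \in S then is_true (lo < y 0 j < hi) else y 0 j = 0.

Let inner_face_in S y j : inner_face S y -> j \in S -> lo < y 0 j < hi.
Proof. by move=> h jS; have := h j; rewrite jS. Qed.

Let inner_face_notin S y j : inner_face S y -> j \notin S -> y 0 j = 0.
Proof. by move=> h /negPf jS; have := h j; rewrite jS. Qed.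

Lemma inner_face_orthant_box S y : inner_face S y -> orthant_box y.
Proof.
move=> h j; have := h j; case: ifP => _.
  by move=> /andP[h1 h2]; rewrite (ltW (lt_trans lo_gt0 h1)) (lt_trans h2 hi_lt).
by move=> ->; rewrite lexx delta_gt0.
Qed.

Lemma level_between j t1 t2 (s : R) : j \in K -> lo < t1 < hi -> lo < t2 < hi ->
  0 <= s <= 1 -> exists2 t, lo < t < hi & A j t = A j t1 + s * (A j t2 - A j t1).
Proof.
move=> jK h1 h2 /andP[s0 s1].
have inI t : Num.min t1 t2 <= t <= Num.max t1 t2 -> lo < t < hi.
  move: h1 h2 => /andP[? ?] /andP[? ?]; rewrite ge_min le_max => /andP[].
  by move=> /orP[?|?] /orP[?|?]; apply/andP; split; lra.
have [|||t] := @IVT _ (A j) (Num.min t1 t2) (Num.max t1 t2) (A j t1 + s * (A j t2 - A j t1)).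
- by rewrite ge_min !le_max lexx.
- apply: continuous_in_subspaceT => t /set_mem /=; rewrite in_itv /= => ht.
  by apply: is_derive_continuous (dA jK _); exact: inI.
- have main (x y : R) : Num.min x y <= x + s * (y - x) <= Num.max x y.
    by case: (leP x y) => ?; apply/andP; split; nra.
  have := main (A j t1) (A j t2).
  by case: (leP t1 t2) => _ //; rewrite minC maxC.
- by rewrite in_itv /= => ht E; exists t => //; exact: inI.
Qed.

(** Join y to z by the path that is affine in the coordinates A j. Along it the
    derivative of G is (u i / a i) times the derivative of the level, by web,
    and the level is constant. *)
Lemma level_const S y z : S \subset K -> inner_face S y -> inner_face S z ->
  \sum_(j in S) A j (y 0 j) = \sum_(j in S) A j (z 0 j) -> G y = G z.
Proof.
move=> SK Sy Sz E.
pose D j := A j (z 0 j) - A j (y 0 j).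
pose c (s : R) : 'rV[R]_d := \row_j (if j \in S then B j (A j (y 0 j) + s * D j) else 0).
have cS s : 0 <= s <= 1 -> forall j, j \in S ->
    lo < c s 0 j < hi /\ A j (c s 0 j) = A j (y 0 j) + s * D j.
  move=> s01 j jS; rewrite mxE jS; have jK := fintype.subsetP SK j jS.
  have [t ht <-] := level_between jK (inner_face_in Sy jS) (inner_face_in Sz jS) s01.
  by have [-> _ _] := AB jK ht.
have cface s : 0 <= s <= 1 -> inner_face S (c s).
  move=> s01 j; case: ifP => jS; first by have [] := cS s s01 j jS.
  by rewrite mxE jS.
have c0 : c 0 = y.
  apply/rowP => j; rewrite mxE mul0r addr0; case: ifP => [jS|/negbT jS].
    by have [] := AB (fintype.subsetP SK j jS) (inner_face_in Sy jS).
  by rewrite (inner_face_notin Sy jS).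
have c1 : c 1 = z.
  apply/rowP => j; rewrite mxE mul1r /D addrC subrK; case: ifP => [jS|/negbT jS].
    by have [] := AB (fintype.subsetP SK j jS) (inner_face_in Sz jS).
  by rewrite (inner_face_notin Sz jS).
have dc (s : R) : 0 <= s <= 1 -> forall j, is_derive s 1 (fun s => c s 0 j)
    (if j \in S then (a j (c s 0 j))^-1 * D j else 0).
  move=> s01 j; case: ifP => jS; last first.
    rewrite (_ : (fun s => _) = cst 0); first exact: is_derive_cst.
    by apply/funext => w; rewrite mxE jS.
  have [h1 h2] := cS s s01 j jS; have jK := fintype.subsetP SK j jS.
  have [_ dB _] := AB jK h1; rewrite h2 in dB.
  rewrite (_ : (fun s => _) = (B j \o (fun s => A j (y 0 j) + s * D j))).
    apply: (@is_derive1_comp _ (B j) (fun s => A j (y 0 j) + s * D j) s _ _ dB).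
    exact: is_derive_affine.
  by apply/funext => w; rewrite mxE jS.
rewrite -c0 -c1.
apply: (@derive0_cst _ [set s : R | 0 <= s <= 1] (fun s => G (c s))).
- exact: is_interval01.
- by rewrite /= lexx ler01.
- by rewrite /= lexx ler01.
move=> s s01; have cb := inner_face_orthant_box (cface s s01).
apply: is_derive_eq (G_chain cb (dc s s01)) _.
have [->|/set0Pn [i iS]] := eqVneq S finset.set0.
  by apply: big1 => j _; rewrite inE mul0r.
have iK := fintype.subsetP SK i iS.
have pos j : j \in S -> 0 < c s 0 j < delta.
  move=> jS; have := inner_face_in (cface s s01) jS.
  by move=> /andP[h1 h2]; rewrite (lt_trans lo_gt0 h1) (lt_trans h2 hi_lt).
rewrite (bigID (mem S)) /= [X in _ + X]big1 ?addr0; last first.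
  by move=> j /andP[_ /negPf jS]; rewrite jS mul0r.
transitivity (\sum_(j in S) (u i (c s) / a i (c s 0 i)) * D j).
  apply: eq_big => [j|j /andP[jK jS]].
    by apply: andb_idl; exact: (fintype.subsetP SK).
  rewrite jS mulrAC; congr (_ * _).
  have p1 := pos i iS; have p2 := pos j jS.
  have W := web cb iK jK; have {W} := W _ _; case/andP: (p1) => -> _; case/andP: (p2) => -> _.
  move=> /(_ isT isT) W.
  have ai := a_neq0 iK p1; have aj := a_neq0 jK p2.
  by apply: (mulIf ai); apply: (mulIf aj); rewrite divfK // W; field.
by rewrite -mulr_sumr /D sumrB E subrr mulr0.
Qed.

(** Move z along the i-th axis and let y follow so that the levels stay equal; by
    level_const the values of G agree along both curves, hence so do the
    derivatives. *)
Lemma level_critical S y z i : S \subset K -> inner_face S y -> inner_face S z ->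
  \sum_(j in S) A j (y 0 j) = \sum_(j in S) A j (z 0 j) -> i \in S ->
  u i y = 0 -> u i z = 0.
Proof.
move=> SK Sy Sz E iS uy; have iK := fintype.subsetP SK i iS.
have hy := inner_face_in Sy iS; have hz := inner_face_in Sz iS.
(* ka w is the i-th coordinate that puts y on the level of z moved to w. *)
pose ka w := B i (A i (y 0 i) + (A i w - A i (z 0 i))).
have [By dB nB] := AB iK hy.
have dkey : is_derive (z 0 i) 1 (fun w => A i (y 0 i) + (A i w - A i (z 0 i))) (a i (z 0 i)).
  have := is_deriveD (is_derive_cst (A i (y 0 i)) (z 0 i) (1 : R))
    (is_deriveB (dA iK hz) (is_derive_cst (A i (z 0 i)) (z 0 i) (1 : R))).
  by rewrite add0r subr0.
have kz : A i (y 0 i) + (A i (z 0 i) - A i (z 0 i)) = A i (y 0 i) by rewrite subrr addr0.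
have dka : is_derive (z 0 i) 1 ka ((a i (y 0 i))^-1 * a i (z 0 i)).
  by apply: (@is_derive1_comp _ (B i) _ (z 0 i)) => //; rewrite kz.
have kaz : ka (z 0 i) = y 0 i by rewrite /ka kz.
have near_ka : \forall w \near z 0 i, lo < ka w < hi.
  have H : ka w @[w --> z 0 i] --> y 0 i.
    by rewrite -kaz; exact: is_derive_continuous dka.
  exact: (H _ (open_nbhs_nbhs (conj (@itv_oo_open _ lo hi) hy))).
have near_z : \forall w \near z 0 i, lo < w < hi.
  by apply: open_nbhs_nbhs; split=> //; exact: itv_oo_open.
have near_A : \forall w \near z 0 i, A i (ka w) = A i (y 0 i) + (A i w - A i (z 0 i)).
  have H : A i (y 0 i) + (A i w - A i (z 0 i)) @[w --> z 0 i] --> A i (y 0 i).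
    by rewrite -[X in _ --> X]kz; exact: is_derive_continuous dkey.
  exact: (H _ nB).
have eqG : \forall w \near z 0 i, G (upd y i (ka w)) = G (upd z i w).
  near=> w; apply: (@level_const S) => //.
  - move=> j; have [->|ji] := eqVneq j i; first by rewrite iS updk; near: w.
    by rewrite updN //; exact: Sy.
  - move=> j; have [->|ji] := eqVneq j i; first by rewrite iS updk; near: w.
    by rewrite updN //; exact: Sz.
  - move: E; rewrite !(bigD1 i iS) /= !updk => E.
    have -> : A i (ka w) = A i (y 0 i) + (A i w - A i (z 0 i)) by near: w.
    rewrite (eq_bigr (fun j => A j (y 0 j))); last by move=> j /andP[_ ji]; rewrite updN.
    rewrite [in RHS](eq_bigr (fun j => A j (z 0 j))); last by move=> j /andP[_ ji]; rewrite updN.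
    by move: (\sum_(_ | _) _) (\sum_(_ | _) _) E => s1 s2 E; lra.
have dupd x (f : R -> R) (w l : R) : is_derive w 1 f l -> forall j,
    is_derive w 1 (fun w : R => upd x i (f w) 0 j) (if j == i then l else 0).
  move=> df j; case: eqP => [->|/eqP ji].
    by rewrite (_ : (fun w => _) = f) //; apply/funext => v; rewrite updk.
  rewrite (_ : (fun w => _) = cst (x 0 j)); first exact: is_derive_cst.
  by apply/funext => v; rewrite updN.
have sumE l x : \sum_(j in K) (if j == i then l else 0) * u j x = l * u i x.
  rewrite (bigD1 i) //= eqxx big1 ?addr0 // => j /andP[_ /negPf ->].
  by rewrite mul0r.
have yE : upd y i (ka (z 0 i)) = y by rewrite kaz upd_id.
have zE : upd z i (z 0 i) = z by rewrite upd_id.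
have d1 := G_chain (c := fun w => upd y i (ka w)) (t := z 0 i) _ (dupd y ka _ _ dka).
have d2 := G_chain (c := fun w => upd z i w) (t := z 0 i) _ (dupd z id _ _ (is_derive_id _ _)).
rewrite yE in d1; rewrite zE in d2.
have [_ e1] := near_eq_is_derive eqG (d1 (inner_face_orthant_box Sy)).
have [_ e2] := d2 (inner_face_orthant_box Sz).
by move: e2; rewrite e1 !sumE uy mulr0 mul1r => <-.
Unshelve. all: by end_near. Qed.

End Levels.


Lemma levels_exist (lo hi : R) : 0 < lo -> hi < delta -> exists A B : 'I_d -> R -> R,
  (forall j t, j \in K -> lo < t < hi -> is_derive t 1 (A j) (a j t)) /\
  (forall j t, j \in K -> lo < t < hi ->
  [/\ B j (A j t) = t, is_derive (A j t) 1 (B j) (a j t)^-1 &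
      {near A j t, cancel (B j) (A j)}]).
Proof.
move=> lo0 hid.
have sub t : lo < t < hi -> 0 < t < delta.
  by move=> /andP[h1 h2]; rewrite (lt_trans lo0 h1) (lt_trans h2 hid).
have /choice [A hA] : forall j, exists A : R -> R, j \in K ->
    forall t, lo < t < hi -> is_derive t 1 A (a j t).
  move=> j; case: (boolP (j \in K)) => jK; last by exists id.
  have [A hA] := @antiderivative _ (a j) 0 delta lo hi (fun t => a_cont jK (t := t)) lo0 hid.
  by exists A.
have /choice [B hB] : forall j, exists B : R -> R, j \in K ->
    forall t, lo < t < hi -> [/\ B (A j t) = t, is_derive (A j t) 1 B (a j t)^-1 &
      {near A j t, cancel B (A j)}].
  move=> j; case: (boolP (j \in K)) => jK; last by exists id.
  have [B hB] := @antiderivative_inverse _ (a j) lo hi (A j)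
    (fun t ht => a_neq0 jK (sub t ht)) (hA j jK).
  by exists B.
exists A, B; split=> j t jK ht; [exact: hA|exact: hB].
Qed.

(** A face is open towards the axes and towards delta; this gives the room for lo
    and hi. *)
Lemma margin S y : (forall j, j \in S -> 0 < y 0 j < delta) ->
  exists t, [/\ 0 < t, t < delta / 2 & forall j, j \in S -> t <= y 0 j <= delta - t].
Proof.
move=> hy.
have h1 : \forall t \near (0 : R)^'+, forall j, j \in S -> t <= y 0 j <= delta - t.
  apply: filter_forall => j; case: (boolP (j \in S)) => jS; last exact: nearW.
  have /andP[y0 yd] := hy j jS; near=> t => _.
  have t1 : t < y 0 j by near: t; exact: nbhs_right_lt.
  have t2 : t < delta - y 0 j by near: t; apply: nbhs_right_lt; rewrite subr_gt0.
  by rewrite (ltW t1) lerBrDl -lerBrDr ltW.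
have h2 : \forall t \near (0 : R)^'+, t < delta / 2.
  by apply: nbhs_right_lt; rewrite divr_gt0.
have h3 : \forall t \near (0 : R)^'+, 0 < t by exact: nbhs_right_gt.
have [t [ht1 [ht2 ht3]]] := @filter_ex _ _ (at_right_proper_filter (0 : R)) _ (filterI h1 (filterI h2 h3)).
by exists t.
Unshelve. all: by end_near. Qed.

Lemma level_monotone (lo hi : R) (A : R -> R) (f : R -> R) t1 t2 :
  (forall t, lo < t < hi -> is_derive t 1 A (f t)) ->
  (forall t, lo < t < hi -> 0 <= f t) ->
  lo < t1 < hi -> lo < t2 < hi -> t1 <= t2 -> A t1 <= A t2.
Proof.
move=> dA f0 h1 h2 t12.
have [c [hc _ _ E]] := mvt_between (@itv_oo_interval _ lo hi) h1 h2 dA.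
by rewrite -subr_ge0 E mulr_ge0 ?subr_ge0 // f0.
Qed.

Lemma level_antitone (lo hi : R) (A : R -> R) (f : R -> R) t1 t2 :
  (forall t, lo < t < hi -> is_derive t 1 A (f t)) ->
  (forall t, lo < t < hi -> f t <= 0) ->
  lo < t1 < hi -> lo < t2 < hi -> t1 <= t2 -> A t2 <= A t1.
Proof.
move=> dA f0 h1 h2 t12.
have [c [hc _ _ E]] := mvt_between (@itv_oo_interval _ lo hi) h2 h1 dA.
by rewrite -subr_ge0 E mulr_le0 ?subr_le0 // f0.
Qed.

Definition face S y := forall j, if j \in S then is_true (0 < y 0 j < delta) else y 0 j = 0.

(** When all a j have the same sign, the level of y is attained on the diagonal of
    the face, at a point that is critical as well. There the derivative of G along
    the diagonal vanishes, so by diag it vanishes identically and G is constant on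
    the diagonal, down to the corner. *)
Lemma face_critical S y : S \subset K -> face S y -> (forall j, j \in S -> u j y = 0) ->
  ((forall j t, j \in S -> 0 < t < delta -> 0 < a j t) \/
   (forall j t, j \in S -> 0 < t < delta -> a j t < 0)) -> G y = G 0.
Proof.
move=> SK Sy uy sgn.
have pos j : j \in S -> 0 < y 0 j < delta by move=> jS; have := Sy j; rewrite jS.
have [e [e0 ed he]] := margin pos.
have lo0 : 0 < e / 2 by rewrite divr_gt0.
have hid : delta - e / 2 < delta by rewrite gtrBl.
have [A [B [dA AB]]] := levels_exist lo0 hid.
set lo := e / 2 in dA AB lo0; set hi := delta - e / 2 in dA AB hid.
have inI t : e <= t <= delta - e -> lo < t < hi.
  by move=> /andP[h1 h2]; rewrite /lo /hi; apply/andP; split; lra.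
have inI0 t : lo < t < hi -> 0 < t < delta.
  by move=> /andP[h1 h2]; rewrite (lt_trans lo0 h1) (lt_trans h2 hid).
have fy : inner_face lo hi S y.
  move=> j; have := Sy j; case: ifP => jS // _; apply: inI; exact: he.
have ee : e <= delta - e by lra.
have [|||t] := @IVT _ (fun t => \sum_(j in S) A j t) e (delta - e) (\sum_(j in S) A j (y 0 j)).
- exact: ee.
- apply: continuous_in_subspaceT => t /set_mem /=; rewrite in_itv /= => ht.
  apply: (@is_derive_continuous _ _ _ (\sum_(j in S) a j t)).
  by apply: is_derive_bigsum => j jS; apply: dA; [exact: (fintype.subsetP SK)|exact: inI].
- have he1 : lo < e < hi by apply: inI; rewrite lexx.
  have he2 : lo < delta - e < hi by apply: inI; rewrite ee lexx.
  have hj j : j \in S -> lo < y 0 j < hi by move=> jS; apply: inI; exact: he.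
  case: sgn => sgn.
    have mono j t1 t2 : j \in S -> lo < t1 < hi -> lo < t2 < hi -> t1 <= t2 -> A j t1 <= A j t2.
      move=> jS; apply: (@level_monotone _ _ _ (a j)).
        by move=> t; apply: dA; exact: (fintype.subsetP SK).
      by move=> t ht; apply/ltW/sgn => //; exact: inI0.
    rewrite ge_min le_max; apply/andP; split; apply/orP.
      by left; apply: ler_sum => j jS; apply: mono => //; [exact: hj|case/andP: (he j jS)].
    by right; apply: ler_sum => j jS; apply: mono => //; [exact: hj|case/andP: (he j jS)].
  have mono j t1 t2 : j \in S -> lo < t1 < hi -> lo < t2 < hi -> t1 <= t2 -> A j t2 <= A j t1.
    move=> jS; apply: (@level_antitone _ _ _ (a j)).
      by move=> t; apply: dA; exact: (fintype.subsetP SK).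
    by move=> t ht; apply/ltW/sgn => //; exact: inI0.
  rewrite ge_min le_max; apply/andP; split; apply/orP.
    by right; apply: ler_sum => j jS; apply: mono => //; [exact: hj|case/andP: (he j jS)].
  by left; apply: ler_sum => j jS; apply: mono => //; [exact: hj|case/andP: (he j jS)].
rewrite in_itv /= => ht Et.
have t0d : 0 < t < delta by apply/inI0/inI.
have /andP[t0 td] := t0d.
have fr : inner_face lo hi S (ray S t).
  move=> j; case: (boolP (j \in S)) => jS; rewrite mxE ?jS ?(negPf jS) //; exact: inI ht.
have EA : \sum_(j in S) A j (y 0 j) = \sum_(j in S) A j (ray S t 0 j).
  by rewrite -Et; apply: eq_bigr => j jS; rewrite mxE jS.
rewrite (level_const lo0 hid dA AB SK fy fr EA).
have sum0 : \sum_(j in S) u j (ray S t) = 0.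
  apply: big1 => j jS.
  exact: (level_critical lo0 hid dA AB SK fy fr EA jS (uy j jS)).
have [/(_ t t0d)|D0] := diag SK; first by rewrite sum0 eqxx.
have <- : ray S 0 = 0 by apply/rowP => j; rewrite !mxE if_same.
apply: (@derive0_cst _ [set s : R | 0 <= s <= t] (fun s => G (ray S s))).
- move=> x z /= /andP[x0 _] /andP[_ zt] w /andP[xw wz].
  by rewrite (le_trans x0 xw) (le_trans wz zt).
- by rewrite /= lexx ltW.
- by rewrite /= lexx ltW.
move=> s /= /andP[s0 st].
have sd : s < delta by apply: le_lt_trans st td.
have ob : orthant_box (ray S s) by move=> j; rewrite mxE; case: ifP => _; rewrite ?s0 ?sd ?lexx ?delta_gt0.
have dr j : is_derive s 1 (fun s => ray S s 0 j) (if j \in S then 1 else 0).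
  case: ifP => jS.
    by rewrite (_ : (fun s => _) = id); [exact: is_derive_id|apply/funext => w; rewrite mxE jS].
  by rewrite (_ : (fun s => _) = cst 0); [exact: is_derive_cst|apply/funext => w; rewrite mxE jS].
apply: is_derive_eq (G_chain ob dr) _.
rewrite (bigID (mem S)) /= [X in _ + X]big1 ?addr0; last first.
  by move=> j /andP[_ /negPf jS]; rewrite jS mul0r.
rewrite -[RHS](D0 s _); last by rewrite s0.
apply: eq_big => [j|j /andP[jK jS]]; last by rewrite jS mul1r.
by apply: andb_idl; exact: (fintype.subsetP SK).
Qed.


Section Descent.
Variables (x : 'rV[R]_d) (P : {set 'I_d}).
Hypotheses (PK : P \subset K) (Kx : face K x).

(** Two independent contractions towards the corner: of the coordinates in P and
    of the other active ones. *)
Definition shrink (r s : R) : 'rV[R]_d :=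
  \row_j (if j \in P then r * x 0 j else if j \in K then s * x 0 j else 0).

Let x_pos j : j \in K -> 0 < x 0 j < delta.
Proof. by move=> jK; have := Kx j; rewrite jK. Qed.

Lemma shrink_orthant_box r s : 0 <= r <= 1 -> 0 <= s <= 1 -> orthant_box (shrink r s).
Proof.
have main (t w : R) : 0 <= t <= 1 -> 0 < w < delta -> 0 <= t * w < delta.
  by move=> /andP[? ?] /andP[? ?]; apply/andP; split; nra.
move=> hr hs j; rewrite mxE; case: ifP => [jP|_].
  by apply: main => //; apply: x_pos; exact: (fintype.subsetP PK).
by case: ifP => jK; [apply: main => //; exact: x_pos|rewrite lexx delta_gt0].
Qed.

Lemma shrink1 : shrink 1 1 = x.
Proof.
apply/rowP => j; rewrite mxE !mul1r; case: ifP => // _.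
by have := Kx j; case: ifP.
Qed.

Lemma shrink_cvg (p : R * R) : shrink q.1 q.2 @[q --> p] --> shrink p.1 p.2.
Proof.
apply: (@rV_cvg _ _ _ (nbhs p) (nbhs_filter p)) => j; rewrite mxE.
under eq_fun do rewrite mxE.
case: ifP => _; first by apply: cvgMr_tmp; exact: cvg_fst.
by case: ifP => _; [apply: cvgMr_tmp; exact: cvg_snd|exact: cvg_cst].
Qed.

(** The level increases with r and decreases with s. Hence on the path from
    (eta, 1) to (1, eta) through (eta, eta) it takes the value it has at (1, 1),
    and on that path one of r, s is eta. *)
Lemma level_point (eta : R) : 0 < eta <= 1 ->
  (forall j t, j \in P -> 0 < t < delta -> 0 < a j t) ->
  (forall j t, j \in K :\: P -> 0 < t < delta -> a j t < 0) ->
  (forall j, j \in K -> u j x = 0) ->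
  exists r s, [/\ 0 <= r <= 1, 0 <= s <= 1, r * s <= eta, G (shrink r s) = G x &
    forall j, j \in K -> u j (shrink r s) = 0].
Proof.
move=> /andP[eta0 eta1] aP aN ux.
have [e [e0 ed he]] := margin x_pos.
(* All coordinates of shrink r s with r, s in [eta, 1] lie between eta * e and
   delta - e. *)
pose lo := eta * e / 2; pose hi := delta - e / 2.
have lo0 : 0 < lo by rewrite divr_gt0 // mulr_gt0.
have hid : hi < delta by rewrite gtrBl divr_gt0.
have [A [B [dA AB]]] := levels_exist lo0 hid.
have inI0 t : lo < t < hi -> 0 < t < delta.
  by move=> /andP[h1 h2]; rewrite (lt_trans lo0 h1) (lt_trans h2 hid).
have inI j (t : R) : j \in K -> eta <= t <= 1 -> lo < t * x 0 j < hi.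
  move=> jK /andP[h1 h2]; have /andP[h3 h4] := he j jK.
  have h5 : eta * e <= t * x 0 j by apply: ler_pM => //; apply: ltW.
  have h6 : t * x 0 j <= 1 * x 0 j by apply: ler_wpM2r => //; lra.
  have h7 : 0 < eta * e by rewrite mulr_gt0.
  by rewrite /lo /hi; apply/andP; split; lra.
have fs r s : eta <= r <= 1 -> eta <= s <= 1 -> inner_face lo hi K (shrink r s).
  move=> hr hs j; case: (boolP (j \in K)) => jK; rewrite mxE.
    by case: (j \in P); rewrite ?jK; exact: inI.
  by rewrite (negPf jK); case: ifP => // /(fintype.subsetP PK); rewrite (negPf jK).
pose lev r s := \sum_(j in K) A j (shrink r s 0 j).
have shP r s j : j \in P -> shrink r s 0 j = r * x 0 j by move=> jP; rewrite mxE jP.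
have shN r s j : j \in K -> j \notin P -> shrink r s 0 j = s * x 0 j.
  by move=> jK jP; rewrite mxE (negPf jP) jK.
have dmul (w t : R) : is_derive t 1 (fun t => t * w) w.
  have := is_derive_affine 0 w t.
  by rewrite (_ : (fun t => 0 + t * w) = (fun t => t * w)) //; apply/funext => v; rewrite add0r.
have x0 j : j \in K -> 0 <= x 0 j by move=> /x_pos /andP[/ltW].
have monoA j t1 t2 : j \in P -> eta <= t1 <= 1 -> eta <= t2 <= 1 -> t1 <= t2 ->
    A j (t1 * x 0 j) <= A j (t2 * x 0 j).
  move=> jP h1 h2 t12; have jK := fintype.subsetP PK j jP.
  apply: (@level_monotone lo hi (A j) (a j)); rewrite ?inI //.
  - by move=> t; exact: dA.
  - by move=> t ht; apply/ltW/aP => //; exact: inI0.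
  - by rewrite ler_wpM2r // x0.
have antiA j t1 t2 : j \in K -> j \notin P -> eta <= t1 <= 1 -> eta <= t2 <= 1 -> t1 <= t2 ->
    A j (t2 * x 0 j) <= A j (t1 * x 0 j).
  move=> jK jP h1 h2 t12; have jKP : j \in K :\: P by rewrite finset.in_setD jP.
  apply: (@level_antitone lo hi (A j) (a j)); rewrite ?inI //.
  - by move=> t; exact: dA.
  - by move=> t ht; apply/ltW/aN => //; exact: inI0.
  - by rewrite ler_wpM2r // x0.
have he1 : eta <= (1 : R) <= 1 by rewrite eta1 lexx.
have hee : eta <= eta <= 1 by rewrite eta1 lexx.
have le_r r1 r2 s : eta <= r1 <= 1 -> eta <= r2 <= 1 -> r1 <= r2 -> lev r1 s <= lev r2 s.
  move=> h1 h2 r12; apply: ler_sum => j jK; case: (boolP (j \in P)) => jP.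
    by rewrite !shP //; exact: monoA.
  by rewrite !shN.
have le_s r s1 s2 : eta <= s1 <= 1 -> eta <= s2 <= 1 -> s1 <= s2 -> lev r s2 <= lev r s1.
  move=> h1 h2 s12; apply: ler_sum => j jK; case: (boolP (j \in P)) => jP.
    by rewrite !shP.
  by rewrite !shN //; exact: antiA.
have cont_r s r : eta <= r <= 1 -> eta <= s <= 1 -> {for r, continuous (fun r => lev r s)}.
  move=> hr hs; apply: (@is_derive_continuous _ _ _
    (\sum_(j in K) (if j \in P then a j (r * x 0 j) * x 0 j else 0))).
  apply: is_derive_bigsum => j jK; case: ifP => jP.
    rewrite (_ : (fun r => _) = A j \o (fun r => r * x 0 j)); last first.
      by apply/funext => v; rewrite /= shP.
    by apply: is_derive1_comp; apply: dA => //; exact: inI.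
  rewrite (_ : (fun r => _) = cst (A j (s * x 0 j))); first exact: is_derive_cst.
  by apply/funext => v; rewrite shN // jP.
have cont_s r s : eta <= r <= 1 -> eta <= s <= 1 -> {for s, continuous (fun s => lev r s)}.
  move=> hr hs; apply: (@is_derive_continuous _ _ _
    (\sum_(j in K) (if j \in P then 0 else a j (s * x 0 j) * x 0 j))).
  apply: is_derive_bigsum => j jK; case: ifP => jP.
    rewrite (_ : (fun r => _) = cst (A j (r * x 0 j))); first exact: is_derive_cst.
    by apply/funext => v; rewrite shP.
  rewrite (_ : (fun r => _) = A j \o (fun s => s * x 0 j)); last first.
    by apply/funext => v; rewrite /= shN // jP.
  by apply: is_derive1_comp; apply: dA => //; exact: inI.
suff [r [s [hr hs rs E]]] : exists r s, [/\ eta <= r <= 1, eta <= s <= 1, r * s <= eta &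
    lev r s = lev 1 1].
  have EA : \sum_(j in K) A j (x 0 j) = \sum_(j in K) A j (shrink r s 0 j).
    by rewrite -{1}shrink1 -/(lev 1 1) -E.
  have fx : inner_face lo hi K x by rewrite -shrink1; exact: fs.
  exists r, s; split=> //.
  - by case/andP: hr => h1 ->; rewrite (le_trans (ltW eta0) h1).
  - by case/andP: hs => h1 ->; rewrite (le_trans (ltW eta0) h1).
  - by rewrite (level_const lo0 hid dA AB (fintype.subxx K) fx (fs r s hr hs) EA).
  - move=> j jK.
    exact: (level_critical lo0 hid dA AB (fintype.subxx K) fx (fs r s hr hs) EA jK (ux j jK)).
have l1 : lev eta 1 <= lev 1 1 by apply: le_r.
have l2 : lev 1 1 <= lev 1 eta by apply: le_s.
have [l3|l3] := leP (lev 1 1) (lev eta eta).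
  have [|||s] := @IVT _ (fun s => lev eta s) eta 1 (lev 1 1) => //.
  - apply: continuous_in_subspaceT => s /set_mem /=; rewrite in_itv /= => hs.
    exact: cont_s.
  - by rewrite ge_min l1 orbT le_max l3.
  - rewrite in_itv /= => hs E; exists eta, s; split=> //.
    by case/andP: hs => _ s1; rewrite -[leRHS]mulr1 ler_wpM2l // ltW.
have [|||r] := @IVT _ (fun r => lev r eta) eta 1 (lev 1 1) => //.
- apply: continuous_in_subspaceT => r /set_mem /=; rewrite in_itv /= => hr.
  exact: cont_r.
- by rewrite ge_min (ltW l3) le_max l2 orbT.
- rewrite in_itv /= => hr E; exists r, eta; split=> //.
  by case/andP: hr => _ r1; rewrite -[leRHS]mul1r ler_wpM2r // ltW.
Qed.

End Descent.

(** Let eta tend to 0 in level_point: by compactness there is a critical point with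
    the same value of G on which one of the two groups of coordinates is zero. On
    the remaining face all a j have the same sign, and face_critical applies. *)
Theorem orthant_critical x : face K x -> (forall j, j \in K -> u j x = 0) -> G x = G 0.
Proof.
move=> Kx ux.
pose P := [set j in K | 0 < a j (delta / 2)]%SET.
have PK : P \subset K by apply/fintype.subsetP => j; rewrite inE => /andP[].
have dd : 0 < delta / 2 < delta by have d0 : (0 : R) < delta := delta_gt0; apply/andP; split; lra.
have aP j t : j \in P -> 0 < t < delta -> 0 < a j t.
  rewrite inE => /andP[jK aj] ht.
  have [h|h] := same_sign (fun t => a_neq0 jK (t := t)) (fun t => a_cont jK (t := t)).
    exact: h.
  by have := h _ dd; rewrite ltNge (ltW aj).
have aN j t : j \in K :\: P -> 0 < t < delta -> a j t < 0.
  rewrite !inE => /andP[+ jK] ht; rewrite jK /= => aj.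
  have [h|h] := same_sign (fun t => a_neq0 jK (t := t)) (fun t => a_cont jK (t := t)).
    by rewrite (h _ dd) in aj.
  exact: h.
(* Minimize r * s over the compact set of contractions of x with the same value of
   G that are critical. *)
pose E : set (R * R) := [set p | [/\ 0 <= p.1 <= 1, 0 <= p.2 <= 1,
   G (shrink x P p.1 p.2) = G x & forall j, j \in K -> u j (shrink x P p.1 p.2) = 0]].
have E_closed : closed E.
  move=> p clE.
  have range (f : R * R -> R) : f q @[q --> p] --> f p ->
      (forall q, E q -> 0 <= f q <= 1) -> 0 <= f p <= 1.
    move=> fc hf; rewrite !leNgt -negb_or; apply/negP => /orP[fp|fp].
      have [q [Eq]] := clE _ (cvgr_lt _ fc _ fp).
      by have /andP[+ _] := hf q Eq; rewrite leNgt => /negP.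
    have [q [Eq]] := clE _ (cvgr_gt _ fc _ fp).
    by have /andP[_ +] := hf q Eq; rewrite leNgt => /negP.
  have hr : 0 <= p.1 <= 1 by apply: range; [exact: cvg_fst|move=> q []].
  have hs : 0 <= p.2 <= 1 by apply: range; [exact: cvg_snd|move=> q []].
  have ob := shrink_orthant_box PK Kx hr hs.
  have limit (f : 'rV[R]_d -> R) l : {for shrink x P p.1 p.2, continuous f} ->
      (forall q, E q -> f (shrink x P q.1 q.2) = l) -> f (shrink x P p.1 p.2) = l.
    move=> cf hf; apply/eqP/negP => /negP fl.
    have c : f (shrink x P q.1 q.2) @[q --> p] --> f (shrink x P p.1 p.2).
      exact: (@continuous_cvg _ _ _ (nbhs p) (nbhs_filter p) _ f _ cf (@shrink_cvg x P p)).
    have fnl : f (shrink x P p.1 p.2) - l != 0 by rewrite subr_eq0.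
    have c' : f (shrink x P q.1 q.2) - l @[q --> p] --> f (shrink x P p.1 p.2) - l.
      by apply: cvgB c _; exact: cvg_cst.
    have [q [Eq]] := clE _ (cvgr_neq0 _ c' fnl).
    by rewrite /= (hf q Eq) subrr eqxx.
  split=> //.
    by apply: limit; [exact: G_cont|move=> q []].
  by move=> j jK; apply: limit; [exact: u_cont|move=> q [_ _ _]; apply].
have E_compact : compact E.
  apply: (subclosed_compact E_closed (compact_setX (segment_compact (a := 0) (b := 1)) (segment_compact (a := 0) (b := 1)))).
  by move=> [r s] [/= hr hs _ _]; split; rewrite /= in_itv.
have E1 : E (1, 1).
  by split; rewrite /= ?lexx ?ler01 // shrink1.
have [||[r s] /set_mem [/= hr hs Gp up] hmin] :=
  @compact_EVT_min _ R (fun p : R * R => p.1 * p.2) E _ E_compact.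
- by exists (1, 1).
- apply: continuous_subspaceT => p; apply: cvgM; [exact: cvg_fst|exact: cvg_snd].
have rs0 : r * s = 0.
  apply/eqP; rewrite eq_le mulr_ge0; [|by case/andP: hr|by case/andP: hs].
  rewrite andbT leNgt; apply/negP => rs.
  have rs1 : 0 < r * s / 2 <= 1.
    by move: hr hs => /andP[? ?] /andP[? ?]; apply/andP; split; nra.
  have [r' [s' [hr' hs' rs' G' u']]] := level_point PK Kx rs1 aP aN ux.
  have := hmin (r', s') _; rewrite inE => /(_ _)/= /(_ _).
  have E' : E (r', s') by split.
  by move=> /(_ E') h; have := le_trans h rs'; lra.
rewrite -Gp.
have face_of (S : {set 'I_d}) (t : R) : 0 < t <= 1 -> S \subset K ->
    (forall j, shrink x P r s 0 j = if j \in S then t * x 0 j else 0) -> face S (shrink x P r s).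
  move=> ht SK h j; have := h j; case: ifP => jS // ->.
  have := Kx j; rewrite (fintype.subsetP SK j jS) => /andP[? ?].
  by move: ht => /andP[? ?]; apply/andP; split; nra.
have [r0 r1] := andP hr; have [s0 s1] := andP hs.
move/eqP: rs0; rewrite mulf_eq0 => /orP[/eqP rz|/eqP sz].
  have [sz|sn] := eqVneq s 0.
    congr G; apply/rowP => j; rewrite !mxE rz sz !mul0r.
    by case: ifP => // _; case: ifP.
  apply: (@face_critical (K :\: P)).
  - exact: finset.subsetDl.
  - apply: (face_of _ s); first by rewrite lt_def sn s0.
      exact: finset.subsetDl.
    move=> j; rewrite mxE rz mul0r finset.in_setD; case: (j \in P) => //=.
  - by move=> j; rewrite finset.in_setD => /andP[_ jK]; exact: up.
  - by right.
have [rz|rn] := eqVneq r 0.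
  congr G; apply/rowP => j; rewrite !mxE rz sz !mul0r.
  by case: ifP => // _; case: ifP.
apply: (@face_critical P) => //.
- apply: (face_of _ r) => //; first by rewrite lt_def rn r0.
  by move=> j; rewrite mxE sz mul0r; case: (j \in P) => //; rewrite if_same.
- by move=> j jP; apply: up; exact: (fintype.subsetP PK).
- by left.
Qed.

End Orthant.

(** * Analytic isomorphisms of intervals *)

Section Analytic1.
Context {R : realType}.

(** The coefficients grow at most geometrically, so the remainder after the linear
    term is quadratic. *)
Lemma analytic1_is_derive (f : R -> R) (a : R) : analytic1_at f a ->
  exists l : R, is_derive a 1 f l.
Proof.
move=> [c /nbhs_ballP [rho /= rho0 hc]].
have hc' x : `|x| < rho -> pseries c x @ \oo --> f (a + x).
  move=> hx; have := hc (a + x); rewrite /ball /= opprD addNKr normrN => /(_ hx).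
  by rewrite addrAC subrr add0r.
pose K := rho / 2.
have K0 : 0 < K by rewrite divr_gt0.
have Krho : `|K| < rho by rewrite gtr0_norm // /K; lra.
have [M M0 hM] : exists2 M, 0 < M & forall n, `|c n * K ^+ n| <= M.
  have h : cvgn (series (fun n => c n * K ^+ n)) by apply/cvg_ex; exists (f (a + K)); exact: hc'.
  have h0 := cvg_series_cvg_0 h.
  have hb : bounded_fun (fun n => c n * K ^+ n) by apply: cvg_seq_bounded; apply/cvg_ex; exists 0.
  have [M M0 hM] := pinfty_ex_gt0 hb.
  by exists M => // n; apply: hM.
have f0 : f a = c 0%N.
  have := hc' 0; rewrite normr0 addr0 => /(_ rho0) h.
  have : pseries c 0 @ \oo --> c 0%N.
    rewrite -(cvg_shiftS (pseries c 0)).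
    rewrite (_ : (fun n => _) = cst (c 0%N)); first exact: cvg_cst.
    apply/funext => n; rewrite /pseries /series /= big_nat_recl //= expr0 mulr1 big1 ?addr0 //.
    by move=> i _; rewrite exprS mul0r mulr0.
  by move=> h'; exact: (cvg_unique _ h h').
exists (c 1%N).
apply: (@quadratic_is_derive _ _ f a 1 (c 1%N) (2 * M * (K^-1) ^+ 2) (K / 2)); first by rewrite divr_gt0.
move=> h hh; rewrite [h%:A]mulr1.
have hrho : `|h| < rho by apply: lt_trans hh _; rewrite /K; lra.
have hl := hc' h hrho; rewrite addrC in hl.
have hl2 : (fun n => pseries c h (n + 2)%N - f a - h * c 1%N) @ \oo --> f (h + a) - f a - h * c 1%N.
  apply: cvgB; last exact: cvg_cst.
  by apply: cvgB; [rewrite (cvg_shiftn 2 (pseries c h))|exact: cvg_cst].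
apply: (cvg_norm_le hl2) => n.
have -> : pseries c h (n + 2)%N - f a - h * c 1%N =
    \sum_(i < n) c i.+2 * h ^+ i.+2.
  rewrite f0 /pseries /series /= addn2 big_mkord !big_ord_recl /= /bump /= expr0 mulr1 expr1.
  under eq_bigr => i _ do rewrite !add1n.
  by ring.
apply: le_trans (ler_norm_sum _ _ _) _.
have -> : 2 * M * K^-1 ^+ 2 * h ^+ 2 = M * K^-1 ^+ 2 * h ^+ 2 * 2 by ring.
have P0 : 0 <= M * K^-1 ^+ 2 * h ^+ 2.
  by rewrite mulr_ge0 ?sqr_ge0 // mulr_ge0 ?sqr_ge0 // ltW.
apply: le_trans (ler_wpM2l P0 (geom_half_le2 n)).
rewrite mulr_sumr; apply: ler_sum => i _.
rewrite normrM normrX.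
have -> : `|c i.+2| * `|h| ^+ i.+2 = `|c i.+2 * K ^+ i.+2| * (K^-1 * `|h|) ^+ i.+2.
  by rewrite normrM normrX (gtr0_norm K0) [(K^-1 * _) ^+ _]exprMn exprVn -mulrA mulVKf ?expf_neq0 ?gt_eqF //.
have -> : M * K^-1 ^+ 2 * h ^+ 2 * 2^-1 ^+ i = M * (K^-1 * `|h|) ^+ 2 * 2^-1 ^+ i.
  by rewrite exprMn -[h ^+ 2]real_normK ?num_real //; ring.
have y0 : 0 <= K^-1 * `|h| by rewrite mulr_ge0 // invr_ge0 ltW.
have y1 : K^-1 * `|h| <= 2^-1.
  by rewrite mulrC ler_pdivrMr // mulrC ltW.
move: (K^-1 * `|h|) y0 y1 (hM i.+2) => y y0 y1 hy.
have -> : y ^+ i.+2 = y ^+ 2 * y ^+ i by rewrite -exprD add2n.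
rewrite mulrA; apply: ler_pM; [|exact: exprn_ge0| |].
- by apply: mulr_ge0 => //; exact: exprn_ge0.
- by apply: ler_wpM2r => //; exact: exprn_ge0.
- by apply: lerXn2r; rewrite ?nnegrE ?invr_ge0.
Qed.

(** Differentiate the identity between f and its inverse. *)
Lemma analytic_iso_derive (I J : set R) (f : R -> R) : open I -> analytic_iso I J f ->
  forall x, I x -> exists2 l, l != 0 & is_derive x 1 f l.
Proof.
move=> oI [af [g [ag fI gJ]]] x Ix.
have [l dl] := analytic1_is_derive (af x Ix).
have [Jfx gfx] := fI x Ix.
have [l' dl'] := analytic1_is_derive (ag (f x) Jfx).
exists l => //; apply/eqP => l0.
have d := @is_derive1_comp _ g f x _ _ dl' dl.
have near_I : \forall y \near x, (g \o f) y = id y.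
  have : \forall y \near x, I y by exact: open_nbhs_nbhs.
  by apply: filterS => y Iy; have [_] := fI y Iy.
have [_ e1] := near_eq_is_derive near_I d.
have [_ e2] := is_derive_id x (1 : R).
by move: e1; rewrite e2 l0 mulr0 => /eqP; rewrite oner_eq0.
Qed.

End Analytic1.

(** * The separation of variables on the hypersurface *)

Section Web.
Context {R : realType} {d : nat} (q : 'rV[R]_d) (r m rho : R) (F g : 'rV[R]_d -> R) (k : 'I_d).
Notation N := (cube q r).
Notation B := (slab q k rho).
Implicit Types (x y : 'rV[R]_d).
Hypotheses (aF : analytic_jets axes N F) (m_gt0 : 0 < m).
Hypothesis Fk_ge : forall x, N x -> m <= 'D_(axis k) F x.
Hypothesis g_graph : forall x, B x -> N (upd x k (g x)) /\ F (upd x k (g x)) = 0.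
Hypothesis g_unique : forall x u, B x -> N (upd x k u) -> F (upd x k u) = 0 -> u = g x.

Notation graph_partial := (graph_partial F g k).
Notation graph_pt := (graph_pt g k).

Let aFj j : analytic_jets axes N ('D_(axis j) F).
Proof. exact: analytic_jets_derive aF (axes_axis j). Qed.

Let graph_partial_line j x v : analytic_jets [set (1 : R)] [set s : R | B (s *: v + x)]
  (fun s : R => graph_partial j (s *: v + x)).
Proof. exact: (analytic_along_line aF m_gt0 Fk_ge g_graph x v (aFj j)). Qed.


Section BasePoint.
Variable z : 'rV[R]_d.
Hypotheses (Bz : B z) (graph_partial_z : forall j, graph_partial j z != 0).
Variables (kappa : 'rV[R]_d -> R) (phi : 'I_d -> R -> R).
Hypothesis sep : \forall x \near z, forall j, j != k -> graph_partial j x = kappa x * phi j (x 0 j).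

(** Near z both sides are the product of the values of kappa at the points x, z,
    upd z i (x 0 i), upd z j (x 0 j) and of the same four values of phi. Along the segment from z to x each factor is analytic, so
    the identity persists. *)
Lemma web_identity x i j oi oj : B x -> i != k -> j != k -> i != j ->
  oi != k -> oj != k -> oi != i -> oj != j ->
  graph_partial i x * (graph_partial oj z * graph_partial j (upd z j (x 0 j)) *
    graph_partial oi (upd z i (x 0 i))) =
  graph_partial j x * (graph_partial oi z * graph_partial i (upd z i (x 0 i)) *
    graph_partial oj (upd z j (x 0 j))).
Proof.
move=> Bx ik jk ij oik ojk oii ojj.
pose v := x - z.
pose w l : 'rV[R]_d := v 0 l *: axis l.
pose I := [set s : R | B (s *: v + z)].
have wE l s : s *: w l + z = upd z l ((s *: v + z) 0 l).
  apply/rowP => e; rewrite !mxE eqxx /=; case: eqVneq => [->|_]; first by rewrite mulr1.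
  by rewrite !mulr0 add0r.
have subI l : I `<=` [set s : R | B (s *: w l + z)].
  move=> s Is e ek; rewrite wE; have [E|el] := eqVneq e l.
    by rewrite -E updk; exact: Is.
  by rewrite updN //; exact: Bz.
have oI : open I := @line_open R d q rho k z v.
have iI : is_interval I := @line_itv R d q rho k z v.
have aS l e : analytic_jets [set (1 : R)] I (fun s : R => graph_partial e (upd z l ((s *: v + z) 0 l))).
  under eq_fun do rewrite -wE.
  by apply: (analytic_jets_sub (subI l)); exact: graph_partial_line.
have aX e : analytic_jets [set (1 : R)] I (fun s : R => graph_partial e (s *: v + z)) := graph_partial_line e z v.
(* The difference of the two sides at z + s (x - z); it vanishes near s = 0. *)
pose D (s : R) := graph_partial i (s *: v + z) *
     (graph_partial oj z * graph_partial j (upd z j ((s *: v + z) 0 j)) *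
       graph_partial oi (upd z i ((s *: v + z) 0 i))) +
   (-1) * (graph_partial j (s *: v + z) *
     (graph_partial oi z * graph_partial i (upd z i ((s *: v + z) 0 i)) *
       graph_partial oj (upd z j ((s *: v + z) 0 j)))).
have aM := @analytic_jetsM R _ [set (1 : R)] I oI.
have aC (c : R) : analytic_jets [set (1 : R)] I (fun=> c) := analytic_jets_cst _ oI c.
have aD : analytic_jets [set (1 : R)] I D.
  apply: (analytic_jetsD oI).
    apply: (aM _ _ (aX i)); apply: (aM _ _ _ (aS i oi)).
    exact: (aM _ _ (aC _) (aS j j)).
  apply: (aM _ _ (aC _)); apply: (aM _ _ (aX j)); apply: (aM _ _ _ (aS j oj)).
  exact: (aM _ _ (aC _) (aS i i)).
have I0 : I 0 by rewrite /I /= scale0r add0r.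
have I1 : I 1 by rewrite /I /= scale1r subrK.
have [D0|/(_ 0 I0) D0] := isolated_zeros oI iI aD.
  have := D0 1 I1; rewrite /D scale1r subrK mulN1r => /eqP.
  by rewrite subr_eq0 => /eqP.
have [e e0 he] := nbhs_cube sep.
have nD : \forall s \near (0 : R), D s = 0.
  have lc : (s *: v + z) @[s --> (0 : R)] --> z.
    have h : (s *: v + z) @[s --> (0 : R)] --> 0 *: v + z.
      by apply: cvgD; [exact: scalel_continuous|exact: cvg_cst].
    by rewrite scale0r add0r in h.
  have h2 : \forall s \near (0 : R), cube z e (s *: v + z) by exact: (lc _ (cube_nbhs z e0)).
  apply: filterS h2 => s hs.
  have hx := he _ hs.
  have hu l : cube z e (upd z l ((s *: v + z) 0 l)).
    move=> f; have [->|fl] := eqVneq f l; first by rewrite updk; exact: hs.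
    by rewrite updN // subrr normr0.
  have hz : cube z e z by move=> f; rewrite subrr normr0.
  rewrite /D (hx i ik) (hx j jk) !(he _ hz) // !(he _ (hu j)) // !(he _ (hu i)) //.
  rewrite !updk !updN //.
  by ring.
have nD' : \forall s \near (0 : R)^', False.
  have : \forall s \near (0 : R), s != 0 -> False.
    by apply: filterS2 nD D0 => s Ds h s0; have := h s0; rewrite Ds eqxx.
  by [].
by have [] := @filter_ex _ _ (Proper_dnbhs_numFieldType (0 : R)) _ nD'.
Qed.

Let rho_gt0 l : l != k -> 0 < rho.
Proof. by move=> lk; apply: le_lt_trans (Bz lk). Qed.

Lemma graph_partial_axis_neq0 j l : l != k ->
  \forall t \near q 0 l, t != q 0 l -> graph_partial j (upd z l t) != 0.
Proof.
move=> lk.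
pose I := [set s : R | B (s *: axis l + upd z l 0)].
have oI : open I := @line_open R d q rho k (upd z l 0) (axis l).
have iI : is_interval I := @line_itv R d q rho k (upd z l 0) (axis l).
have Iz : I (z 0 l) by rewrite /I /= -upd_line upd_id.
have Iq : I (q 0 l).
  move=> e ek; rewrite -upd_line; have [->|el] := eqVneq e l.
    by rewrite updk subrr normr0; exact: rho_gt0 lk.
  by rewrite updN //; exact: Bz.
have [D0|/(_ _ Iq)] := isolated_zeros oI iI (graph_partial_line j (upd z l 0) (axis l)).
  by have := D0 _ Iz; rewrite -upd_line upd_id => /eqP; rewrite (negPf (graph_partial_z j)).
by apply: filterS => t; rewrite -upd_line.
Qed.

(** When there is no third index, j itself is returned: then only one index differs
    from k and the relation web_coefP is trivial. *)
Definition third_index (j : 'I_d) : 'I_d := odflt j [pick e | (e != k) && (e != j)].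

Lemma third_index_neq i j : i != k -> j != k -> i != j -> third_index i != k /\ third_index i != i.
Proof.
move=> ik jk ij; rewrite /third_index; case: pickP => [e /andP[]//|/(_ j)].
by rewrite jk eq_sym ij.
Qed.

(** Near z this is kappa z * phi j t, since the unknown kappa (upd z j t) cancels
    in the quotient. As a quotient of analytic functions it may vanish or have a
    pole at q_j. *)
Definition web_coef j (t : R) : R :=
  graph_partial (third_index j) z * graph_partial j (upd z j t) /
  graph_partial (third_index j) (upd z j t).

Lemma web_coefP x i j : B x -> i != k -> j != k ->
  graph_partial (third_index i) (upd z i (x 0 i)) != 0 ->
  graph_partial (third_index j) (upd z j (x 0 j)) != 0 ->
  graph_partial i x * web_coef j (x 0 j) = graph_partial j x * web_coef i (x 0 i).
Proof.
move=> Bx ik jk oi oj; have [->//|ij] := eqVneq i j.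
have ji : j != i by rewrite eq_sym.
have [h1 h2] := third_index_neq ik jk ij; have [h3 h4] := third_index_neq jk ik ji.
have W := web_identity Bx ik jk ij h1 h3 h2 h4.
rewrite /web_coef; apply: (mulIf oi); apply: (mulIf oj).
transitivity (graph_partial i x *
    (graph_partial (third_index j) z * graph_partial j (upd z j (x 0 j)) *
     graph_partial (third_index i) (upd z i (x 0 i)))).
  by field.
by rewrite W; field.
Qed.

Lemma web_coef_continuous j t : B (upd z j t) -> graph_partial (third_index j) (upd z j t) != 0 ->
  {for t, continuous (web_coef j)}.
Proof.
move=> Bt ot.
have uc : upd z j s @[s --> t] --> upd z j t.
  under eq_fun do rewrite upd_line.
  by rewrite upd_line; apply: cvgD; [exact: scalel_continuous|exact: cvg_cst].
have sc e : graph_partial e (upd z j s) @[s --> t] --> graph_partial e (upd z j t).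
  have cs := graph_partial_continuous aF m_gt0 Fk_ge g_graph (j := e) Bt.
  exact: (@continuous_cvg _ _ _ (nbhs t) (nbhs_filter t) (upd z j) (graph_partial e) _ cs uc).
apply: cvgM; last by apply: cvgV => //; exact: sc.
by apply: cvgM; [exact: cvg_cst|exact: sc].
Qed.

Let pt (sg : 'I_d -> R) (y : 'rV[R]_d) : 'rV[R]_d := \row_j (q 0 j + sg j * y 0 j).

Definition orthant_sign (si : {ffun 'I_d -> bool}) (j : 'I_d) : R := if si j then 1 else -1.

Lemma orthant_sign_norm si j : `|orthant_sign si j| = 1.
Proof. by rewrite /orthant_sign; case: (si j); rewrite ?normrN normr1. Qed.

Lemma orthant_sign_neq0 si j : orthant_sign si j != 0.
Proof. by rewrite -normr_gt0 orthant_sign_norm. Qed.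

(** When k is not in S, this is up to a nonzero factor the derivative of g along the
    diagonal of a face of an orthant with corner q. *)
Definition diag_sum si (S : {set 'I_d}) (t : R) : R :=
  \sum_(j in S) orthant_sign si j * graph_partial j (pt (orthant_sign si) (ray S t)).

Lemma diag_alternative l si S : l != k -> \forall e \near (0 : R)^'+,
  (forall t, 0 < t < e -> diag_sum si S t != 0) \/
  (forall t, 0 <= t < e -> diag_sum si S t = 0).
Proof.
move=> lk; have rho0 := rho_gt0 lk.
pose v : 'rV[R]_d := \row_j (if j \in S then orthant_sign si j else 0).
pose I := [set s : R | B (s *: v + q)].
have oI : open I := @line_open R d q rho k q v.
have iI : is_interval I := @line_itv R d q rho k q v.
have ptE t : pt (orthant_sign si) (ray S t) = t *: v + q.
  apply/rowP => j; rewrite !mxE; case: ifP => _; last by rewrite !mulr0 addr0 add0r.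
  by rewrite addrC mulrC.
have aD : analytic_jets [set (1 : R)] I (diag_sum si S).
  rewrite /diag_sum; apply: (analytic_jets_sum oI) => j.
  apply: (analytic_jetsM oI); first exact: analytic_jets_cst.
  by under eq_fun do rewrite ptE; exact: graph_partial_line.
have I0 : I 0 by move=> j jk; rewrite scale0r add0r subrr normr0.
have Ie e : e < rho -> forall t, 0 <= t < e -> I t.
  move=> er t /andP[t0 te] j jk; rewrite !mxE addrK normrM (ger0_norm t0).
  case: ifP => _; last by rewrite normr0 mulr0.
  by rewrite orthant_sign_norm mulr1; apply: lt_trans er.
have [D0|/(_ 0 I0)] := isolated_zeros oI iI aD.
  near=> e; right=> t ht; apply: D0; apply: Ie ht.
  by near: e; exact: nbhs_right_lt.
move=> /nbhs_ballP [e0 /= e00 he0]; near=> e; left=> t /andP[t0 te].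
apply: he0; last by rewrite gt_eqF.
rewrite /ball /= sub0r normrN gtr0_norm //; apply: lt_trans te _.
by near: e; exact: nbhs_right_lt.
Unshelve. all: by end_near. Qed.

(** Away from the slices x_j = q_j the web relation has nonzero coefficients, so
    one vanishing derivative of g forces all of them to vanish. In coordinates
    adapted to the orthant of x, orthant_critical then gives the value of g. *)
Theorem critical_near : exists2 e : R, 0 < e & forall x i, i != k ->
  (forall j, j != k -> `|x 0 j - q 0 j| < e) -> graph_partial i x = 0 ->
  (exists2 j, j != k & x 0 j = q 0 j) \/ g x = g q.
Proof.
have [[l lk]|H] := pselect (exists l, l != k); last first.
  by exists 1 => // x i ik; case: H; exists i.
have rho0 := rho_gt0 lk.
have h1 : \forall e \near (0 : R)^'+, e < rho by exact: nbhs_right_lt.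
have h2 : \forall e \near (0 : R)^'+, forall jl : 'I_d * 'I_d, jl.2 != k ->
    forall t, 0 < `|t - q 0 jl.2| < e -> graph_partial jl.1 (upd z jl.2 t) != 0.
  apply: filter_forall => -[j f] /=; have [->|fk] := eqVneq f k; first exact: nearW.
  have /nbhs_ballP [e0 /= e00 he0] := graph_partial_axis_neq0 j fk; near=> e => _ t /andP[t0 te].
  apply: he0; last by rewrite -subr_eq0 -normr_gt0.
  rewrite /ball /= distrC; apply: lt_trans te _.
  by near: e; exact: nbhs_right_lt.
have h3 : \forall e \near (0 : R)^'+, forall p : {ffun 'I_d -> bool} * {set 'I_d},
    (forall t, 0 < t < e -> diag_sum p.1 p.2 t != 0) \/
    (forall t, 0 <= t < e -> diag_sum p.1 p.2 t = 0).
  by apply: filter_forall => -[si S] /=; exact: diag_alternative lk.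
have h4 : \forall e \near (0 : R)^'+, 0 < e by exact: nbhs_right_gt.
have [e [[e_rho nz] [alt e0]]] :=
  @filter_ex _ _ (at_right_proper_filter (0 : R)) _ (filterI (filterI h1 h2) (filterI h3 h4)).
exists e => // x i ik xe si0.
have [[j [jk xj]]|Hx] := pselect (exists j, j != k /\ x 0 j = q 0 j); first by left; exists j.
right.
have xq j : j != k -> x 0 j != q 0 j.
  by move=> jk; apply/eqP => E; apply: Hx; exists j.
have Bx : B x by move=> j jk; apply: lt_trans (xe j jk) e_rho.
have xnz j f : f != k -> graph_partial j (upd z f (x 0 f)) != 0.
  move=> fk; apply: (nz (j, f) fk) => /=.
  by rewrite normr_gt0 subr_eq0 xq //=; exact: xe.
have web_coef_neq0 f t : f != k -> 0 < `|t - q 0 f| < e -> web_coef f t != 0.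
  move=> fk ht; rewrite /web_coef !mulf_neq0 ?invr_eq0 //.
    exact: (nz (f, f) fk).
  exact: (nz (third_index f, f) fk).
have sx0 j : j != k -> graph_partial j x = 0.
  move=> jk; have := web_coefP Bx ik jk (xnz _ _ ik) (xnz _ _ jk).
  rewrite si0 mul0r => /esym/eqP; rewrite mulf_eq0 => /orP[/eqP//|].
  by rewrite (negPf (web_coef_neq0 _ _ ik _)) // normr_gt0 subr_eq0 xq //=; exact: xe.
(* Coordinates in the orthant of x: the corner is q, and y0 represents x. *)
pose si := [ffun j => q 0 j < x 0 j].
pose sg := orthant_sign si.
pose y0 : 'rV[R]_d := \row_j (if j == k then 0 else `|x 0 j - q 0 j|).
pose G y := g (pt sg y).
pose u j y := sg j * (- graph_partial j (pt sg y) / graph_partial k (pt sg y)).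
pose a j t := sg j * web_coef j (q 0 j + sg j * t).
pose K := [set~ k]%SET.
have inK j : (j \in K) = (j != k) by rewrite !inE.
have Bpt y : orthant_box e y -> B (pt sg y).
  move=> hy j jk; rewrite mxE addrAC subrr add0r normrM orthant_sign_norm mul1r.
  by have /andP[y0' ye] := hy j; rewrite ger0_norm //; apply: lt_trans ye e_rho.
have dist_e j t : 0 < t < e -> 0 < `|q 0 j + sg j * t - q 0 j| < e.
  by move=> /andP[t0 te]; rewrite addrAC subrr add0r normrM orthant_sign_norm mul1r gtr0_norm // t0.
have pt_cont y : pt sg w @[w --> y] --> pt sg y.
  apply: (@rV_cvg _ _ _ (nbhs y) (nbhs_filter y)) => j; rewrite mxE.
  under eq_fun do rewrite mxE.
  apply: cvgD; first exact: cvg_cst.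
  by apply: cvgMl_tmp; exact: coord_continuous.
have gx : g x = G y0.
  apply: (g_eq g_graph g_unique Bx) => j jk; rewrite !mxE (negPf jk) /sg /orthant_sign ffunE.
  case: (ltP (q 0 j) (x 0 j)) => h; first by rewrite gtr0_norm ?subr_gt0 // mul1r addrC subrK.
  by rewrite ler0_norm ?subr_le0 // mulN1r opprK addrC subrK.
have liftx : graph_pt x = graph_pt (pt sg y0).
  apply: (graph_pt_eq g_graph g_unique Bx) => j jk; rewrite !mxE (negPf jk) /sg /orthant_sign ffunE.
  case: (ltP (q 0 j) (x 0 j)) => h; first by rewrite gtr0_norm ?subr_gt0 // mul1r addrC subrK.
  by rewrite ler0_norm ?subr_le0 // mulN1r opprK addrC subrK.
have gq : g q = G 0.
  by congr g; apply/rowP => j; rewrite !mxE mulr0 addr0.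
rewrite gx gq.
apply: (@orthant_critical _ _ G u a K e) => //.
- move=> c t l' cb dc.
  have dpt j : is_derive t 1 (fun s => pt sg (c s) 0 j) (sg j * l' j).
    rewrite (_ : (fun s => _) = (cst (q 0 j) + sg j \*: (fun s => c s 0 j))); last first.
      by apply/funext => s; rewrite mxE.
    by have := is_deriveD (is_derive_cst (q 0 j) t (1 : R)) (is_deriveZ (sg j) (dc j)); rewrite add0r.
  apply: is_derive_eq (g_derive aF m_gt0 Fk_ge g_graph (Bpt _ cb) dpt) _.
  rewrite -sumrN mulr_suml; apply: eq_big => [j|j jk]; first by rewrite inK.
  by rewrite /u; ring.
- move=> y /Bpt By.
  exact: (@continuous_cvg _ _ _ (nbhs y) (nbhs_filter y) (pt sg) g _ (g_continuous aF m_gt0 Fk_ge g_graph By) (pt_cont y)).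
- move=> j y /Bpt By.
  have sc f := @continuous_cvg _ _ _ (nbhs y) (nbhs_filter y) (pt sg) (graph_partial f) _
    (graph_partial_continuous aF m_gt0 Fk_ge g_graph (j := f) By) (pt_cont y).
  suff H : u j w @[w --> y] --> u j y by exact: H.
  apply: (@cvgMl_tmp _ _ (nbhs y) (nbhs_filter y)).
  apply: (@cvgM _ _ (nbhs y) (nbhs_filter y)).
    by apply: (@cvgN _ _ _ (nbhs y) (nbhs_filter y)); exact: sc.
  apply: (@cvgV _ _ (nbhs y) (nbhs_filter y)); [exact: (graph_partialk_neq0 m_gt0 Fk_ge g_graph By)|exact: sc].
- move=> y j f /[dup] hy /Bpt By; rewrite !inK => jk fk yj yf.
  have /andP[_ yje] := hy j; have /andP[_ yfe] := hy f.
  have := web_coefP By jk fk; rewrite !mxE => /(_ _ _).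
  have n1 : graph_partial (third_index j) (upd z j (q 0 j + sg j * y 0 j)) != 0.
    by apply: (nz (third_index j, j) jk); apply: dist_e; rewrite yj.
  have n2 : graph_partial (third_index f) (upd z f (q 0 f + sg f * y 0 f)) != 0.
    by apply: (nz (third_index f, f) fk); apply: dist_e; rewrite yf.
  move=> /(_ n1 n2) W; rewrite /u /a.
  have s1 : graph_partial k (pt sg y) != 0 := graph_partialk_neq0 m_gt0 Fk_ge g_graph By.
  apply: (mulIf s1); transitivity (- (sg j * sg f) * (graph_partial j (pt sg y) * web_coef f (q 0 f + sg f * y 0 f))).
    by field.
  by rewrite W; field.
- move=> j t; rewrite inK => jk ht; rewrite /a mulf_neq0 ?orthant_sign_neq0 //.
  by apply: web_coef_neq0 => //; exact: dist_e.
- move=> j t; rewrite inK => jk ht.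
  have dt := dist_e j t ht.
  have ac : (fun s : R => q 0 j + sg j * s) s @[s --> t] --> q 0 j + sg j * t.
    by apply: cvgD; [exact: cvg_cst|apply: cvgMl_tmp; exact: cvg_id].
  have Bu : B (upd z j (q 0 j + sg j * t)).
    move=> f fk; have [->|fj] := eqVneq f j; last by rewrite updN //; exact: Bz.
    by rewrite updk; case/andP: dt => _ h; apply: lt_trans h e_rho.
  apply: cvgMl_tmp.
  exact: (@continuous_cvg _ _ _ (nbhs t) (nbhs_filter t) (fun s : R => q 0 j + sg j * s) (web_coef j) _
    (web_coef_continuous Bu (nz (third_index j, j) jk _ dt)) ac).
- move=> S SK.
  have uE t : 0 <= t < e -> \sum_(j in S) u j (ray S t) =
      - (graph_partial k (pt sg (ray S t)))^-1 * diag_sum si S t.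
    move=> ht; rewrite /diag_sum mulr_sumr; apply: eq_bigr => j jS.
    by rewrite /u -/sg; ring.
  have [alt1|alt2] := alt (si, S); [left=> t ht|right=> t ht].
    have /andP[t0 te] := ht; rewrite uE; last by rewrite ltW.
    rewrite mulf_neq0 ?oppr_eq0 ?invr_eq0 //; last exact: alt1.
    apply: (graph_partialk_neq0 m_gt0 Fk_ge g_graph); apply: Bpt => j.
    by rewrite mxE; case: ifP => _; rewrite ?(ltW t0) ?lexx.
  by rewrite uE // (alt2 t ht) mulr0.
- move=> j; rewrite inK !mxE; case: eqVneq => //= jk.
  by rewrite normr_gt0 subr_eq0 xq //=; exact: xe.
- move=> j; rewrite inK => jk; rewrite /u.
  have -> : graph_partial j (pt sg y0) = graph_partial j x by rewrite /graph_partial liftx.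
  by rewrite sx0 // oppr0 mul0r mulr0.
Unshelve. all: by end_near. Qed.

End BasePoint.
End Web.

(** * The critical locus near a point *)

Section Separation.
Context {R : realType} {d : nat} (q : 'rV[R]_d) (r m rho : R) (F g : 'rV[R]_d -> R) (k : 'I_d).
Notation N := (cube q r).
Notation B := (slab q k rho).
Implicit Types (x y : 'rV[R]_d).
Hypotheses (aF : analytic_jets axes N F) (m_gt0 : 0 < m).
Hypothesis Fk_ge : forall x, N x -> m <= 'D_(axis k) F x.
Hypothesis g_graph : forall x, B x -> N (upd x k (g x)) /\ F (upd x k (g x)) = 0.
Notation graph_partial := (graph_partial F g k).
Notation graph_pt := (graph_pt g k).

(** Differentiating sum_i f_i(x_i) = 0 along the curve on the graph over the j-th
    axis gives graph_partial j x / graph_partial k x = f_j'(x_j) / f_k'(g x). *)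
Lemma local_separation z (I : 'I_d -> set R) (J : set R) (f : 'I_d -> R -> R) : B z ->
  (forall i, open (I i)) -> (forall i, I i (graph_pt z 0 i)) ->
  (forall i, analytic_iso (I i) J (f i)) ->
  (forall x, (forall i, I i (x 0 i)) -> F x = 0 -> \sum_(i < d) f i (x 0 i) = 0) ->
  exists (kappa : 'rV[R]_d -> R) (phi : 'I_d -> R -> R),
    \forall x \near z, forall j, j != k -> graph_partial j x = kappa x * phi j (x 0 j).
Proof.
move=> Bz oI Iz iso eqF.
have /choice [phi hphi] : forall i, exists phi : R -> R, forall t, I i t ->
    phi t != 0 /\ is_derive t 1 (f i) (phi t).
  move=> i; suff /choice [phi h] : forall t, exists l : R, I i t -> l != 0 /\ is_derive t 1 (f i) l.
    by exists phi.
  move=> t; have [It|It] := pselect (I i t); last by exists 0.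
  by have [l l0 dl] := analytic_iso_derive (oI i) (iso i) It; exists l.
have graph_pt_cvg x j : B x -> graph_pt y 0 j @[y --> x] --> graph_pt x 0 j.
  move=> Bx; have [->|jk] := eqVneq j k.
    rewrite updk; under eq_fun do rewrite updk.
    exact: (g_continuous aF m_gt0 Fk_ge g_graph Bx).
  rewrite updN //; under eq_fun do rewrite updN //.
  exact: coord_continuous.
(* W is open: its points lie under the box on which the degeneracy is expressed. *)
pose W := [set x | B x /\ forall i, I i (graph_pt x 0 i)].
have W_near x : W x -> \forall y \near x, W y.
  move=> [Bx Ix]; apply: filterI.
    by apply: open_nbhs_nbhs; split=> //; exact: slab_open.
  apply: (@filter_forall _ _ (fun i => [set y | I i (graph_pt y 0 i)]) _ (nbhs_filter x)) => i.
  exact: (graph_pt_cvg x i Bx _ (open_nbhs_nbhs (conj (oI i) (Ix i)))).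
exists (fun x => graph_partial k x / phi k (g x)), phi.
have : \forall x \near z, W x by apply: W_near.
apply: filterS => x [Bx Ix] j jk.
pose c (s : R) := s *: axis j + x.
have c0 : c 0 = x by rewrite /c scale0r add0r.
have dc i : is_derive (0 : R) 1 (fun s => c s 0 i) (i == j)%:R.
  rewrite (_ : (fun s => _) = (fun s => x 0 i + s * (i == j)%:R)); first exact: is_derive_affine.
  by apply/funext => s; rewrite /c axis_shiftE addrC.
have c_cvg : c s @[s --> (0 : R)] --> x.
  by rewrite -[X in _ --> X]c0; apply: rV_cvg => i; exact: is_derive_continuous (dc i).
have nearW : \forall s \near (0 : R), W (c s) by exact: (c_cvg _ (W_near x (conj Bx Ix))).
have Bc : B (c 0) by rewrite c0.
pose sp i : R := if i == k
  then - (\sum_(l | l != k) (l == j)%:R * graph_partial l x) / graph_partial k x else (i == j)%:R.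
have dl i : is_derive (0 : R) 1 (fun s => graph_pt (c s) 0 i) (sp i).
  rewrite /sp; case: eqVneq => [->|ik].
    under eq_fun do rewrite updk.
    by have := g_derive aF m_gt0 Fk_ge g_graph Bc dc; rewrite c0.
  by under eq_fun do rewrite updN //.
have dS : is_derive (0 : R) 1 (fun s => \sum_(i < d) f i (graph_pt (c s) 0 i))
    (\sum_(i < d) phi i (graph_pt x 0 i) * sp i).
  apply: is_derive_bigsum => i _.
  apply: (@is_derive1_comp _ (f i) (fun s => graph_pt (c s) 0 i) 0) => //.
  by rewrite c0; case: (hphi i _ (Ix i)).
have S0 : \forall s \near (0 : R), (fun s => \sum_(i < d) f i (graph_pt (c s) 0 i)) s = cst 0 s.
  apply: filterS nearW => s [Bs Is]; apply: eqF => //.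
  by case: (g_graph Bs).
have [_ e1] := near_eq_is_derive S0 dS.
have [_ e2] := is_derive_cst (0 : R) (0 : R) (1 : R).
have E : \sum_(i < d) phi i (graph_pt x 0 i) * sp i = 0 by rewrite -e1 e2.
have sj : \sum_(l | l != k) (l == j)%:R * graph_partial l x = graph_partial j x.
  rewrite (bigD1 j) //= eqxx mul1r big1 ?addr0 // => l /andP[_ /negPf ->].
  by rewrite mul0r.
move: E; rewrite (bigD1 k) //= (bigD1 j) //= big1 ?addr0; last first.
  by move=> l /andP[lk lj]; rewrite /sp (negPf lk) (negPf lj) mulr0.
rewrite {1}/sp eqxx sj /sp (negPf jk) eqxx mulr1 updk updN // => E.
have [pk _] := hphi k _ (Ix k); rewrite updk in pk.
have sk : graph_partial k x != 0 := graph_partialk_neq0 m_gt0 Fk_ge g_graph Bx.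
have -> : phi j (x 0 j) = phi k (g x) * (graph_partial j x / graph_partial k x).
  by apply/eqP; rewrite -subr_eq0; apply/eqP; rewrite -[RHS]E; ring.
by field; rewrite pk sk.
Qed.

End Separation.

(** Scaling F by its derivative at q makes that derivative positive. The points of
    D provide a base point z in the chart where the web relation can be read off;
    critical_near then speaks of the whole chart. *)
Theorem critical_subset_slices {R : realType} {d : nat} (F : 'rV[R]_d -> R) (Omega D : set 'rV[R]_d)
  (q : 'rV[R]_d) (k : 'I_d) :
  analytic_at F q -> F q = 0 -> partial F k q != 0 -> closure D q ->
  (forall z, D z -> locally_degenerate Omega F z) ->
  forall i, \forall x \near q, F x = 0 -> partial F i x = 0 -> exists j, x 0 j = q 0 j.
Proof.
move=> /analytic_at_jets [r0 r00 aF0] Fq Fkq clD degD i.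
pose C := partial F k q.
pose F1 x := C * F x.
have dF j x : cube q r0 x -> 'D_(axis j) F1 x = C * partial F j x.
  move=> hx; rewrite /F1 -[fun x => C * F x]/(C \*: F) deriveZ //.
  exact: analytic_jets_derivable aF0 (axes_axis j) hx.
have aF1 : analytic_jets axes (cube q r0) F1.
  by apply: (analytic_jetsM (@cube_open _ _ _ _)) => //; apply: analytic_jets_cst; exact: cube_open.
have hq : cube q r0 q by move=> j; rewrite subrr normr0.
have C2 : 0 < C ^+ 2 by rewrite exprn_even_gt0.
pose m := C ^+ 2 / 2.
have m0 : 0 < m by rewrite divr_gt0.
have [r [r_gt0 rr0 Fk_ge]] : exists r, [/\ 0 < r, r <= r0 &
    forall x, cube q r x -> m <= 'D_(axis k) F1 x].
  have ck := analytic_jets_continuous (analytic_jets_derive aF1 (axes_axis k)) hq.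
  have mk : m < 'D_(axis k) F1 q by rewrite dF // -/C /m -expr2; lra.
  have [e e0 he] := nbhs_cube (cvgr_gt _ ck _ mk).
  exists (Num.min e r0); split; first by rewrite lt_min e0.
    by rewrite ge_min lexx orbT.
  by move=> x hx; apply/ltW/he => j; have := hx j; rewrite lt_min => /andP[].
have sub : cube q r `<=` cube q r0 by move=> x hx j; apply: lt_le_trans rr0.
have {}aF1 := analytic_jets_sub sub aF1.
have F1q : F1 q = 0 by rewrite /F1 Fq mulr0.
have [rho [g [rho0 rho_le g_graph g_unique]]] := graph_exists r_gt0 aF1 m0 Fk_ge F1q.
have Bq : slab q k rho q by move=> j _; rewrite subrr normr0.
have graph_pt_id x : cube q rho x -> F x = 0 -> upd x k (g x) = x.
  move=> hx Fx; have Nx : cube q r x by move=> j; apply: lt_le_trans rho_le.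
  have Bx : slab q k rho x by move=> j _; exact: hx.
  have F1x : F1 x = 0 by rewrite /F1 Fx mulr0.
  have E := g_unique x (x 0 k); rewrite !upd_id in E.
  by rewrite -(E Bx Nx F1x) upd_id.
have gq : g q = q 0 k.
  by rewrite -[RHS](congr1 (fun y : 'rV[R]_d => y 0 k) (graph_pt_id q _ Fq)) ?updk // => j; rewrite subrr normr0.
have [z [Dz hz]] := clD _ (cube_nbhs q rho0).
have [[_ Fz] dFz [I [J [f [hI IO [hJ J0] iso eqF]]]]] := degD z Dz.
have Bz : slab q k rho z by move=> j _; exact: hz.
have liftz : graph_pt g k z = z by exact: graph_pt_id.
have graph_partial_z j : graph_partial F1 g k j z != 0.
  by rewrite /graph_partial liftz dF ?mulf_neq0 //; apply: sub => l; apply: lt_le_trans rho_le.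
have [||||kappa [phi sep]] := @local_separation _ _ _ _ _ _ F1 g k aF1 m0 Fk_ge g_graph z I J f Bz.
- by move=> j; case: (hI j) => -[].
- by move=> j; rewrite liftz; case: (hI j).
- exact: iso.
- move=> x Ix /eqP; rewrite /F1 mulf_eq0 (negPf Fkq) /= => /eqP Fx.
  by apply/(eqF x Ix).
have [e e0 he] := critical_near aF1 m0 Fk_ge g_graph g_unique Bz graph_partial_z sep.
have e1 : 0 < Num.min e rho by rewrite lt_min e0.
apply: filterS (cube_nbhs q e1) => x hx Fx Fi.
have hxe j : `|x 0 j - q 0 j| < e by have := hx j; rewrite lt_min => /andP[].
have hxr : cube q rho x by move=> j; have := hx j; rewrite lt_min => /andP[].
have Nx : cube q r x by move=> j; apply: lt_le_trans rho_le.
have liftx : graph_pt g k x = x by exact: graph_pt_id.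
have s0 j : partial F j x = 0 -> graph_partial F1 g k j x = 0.
  by move=> h; rewrite /graph_partial liftx dF ?h ?mulr0 //; exact: sub.
have [ik|ik] := eqVneq i k.
  have := Fk_ge x Nx; rewrite dF; last exact: sub.
  by rewrite -ik Fi mulr0 leNgt m0.
have [[j _ E]|E] := he x i ik (fun j _ => hxe j) (s0 i Fi); first by exists j.
exists k; rewrite -gq -E.
by rewrite -[LHS](congr1 (fun y : 'rV[R]_d => y 0 k) liftx) updk.
Qed.

(** * Irreducible germs and slices *)

Section GermsOfSlices.
Context {R : realType} {d : nat} (q : 'rV[R]_d).
Implicit Types (A : set 'rV[R]_d) (s : seq 'I_d).

Lemma monomial_analytic (be : {ffun 'I_d -> nat}) :
  analytic_at (fun x : 'rV[R]_d => \prod_(i < d) (x 0 i - q 0 i) ^+ be i) q.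
Proof.
exists (fun al => (al == be)%:R); apply: (@nearW _ (nbhs q) _ (nbhs_filter q)) => x; split.
  rewrite /summable (esumID [set be]) // setTI setTI esum_set1 //.
  rewrite [X in (_ + X)%E]esum1 ?adde0 ?ltry // => al /= albe.
  by rewrite (_ : al == be = false) ?mul0r ?normr0 ?abse0 //; apply/eqP.
apply: cvg_near_cst; near=> n.
have ben i : (be i < n)%N.
  have : (\max_(i < d) be i < n)%N by near: n; exact: nbhs_infty_gt.
  by apply: leq_ltn_trans; exact: leq_bigmax.
rewrite (bigD1 [ffun i => Ordinal (ben i)]) //= [X in _ + X]big1 ?addr0; last first.
  move=> al /eqP hal; case: eqP => [/ffunP E|_]; last by rewrite mul0r.
  case: hal; apply/ffunP => i; apply/val_inj.
  by have := E i; rewrite !ffunE.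
set al := [ffun i => _]; have -> : al = be by apply/ffunP => i; rewrite !ffunE.
by rewrite eqxx mul1r.
Unshelve. all: by end_near. Qed.

(** Its zero set is the union of the slices through q whose index occurs in s. *)
Definition slice_monomial s (x : 'rV[R]_d) : R :=
  \prod_(i < d) (x 0 i - q 0 i) ^+ count_mem i s.

Lemma slice_monomial_analytic s : analytic_at (slice_monomial s) q.
Proof.
have := monomial_analytic [ffun i => count_mem i s]; congr (analytic_at _ q).
by apply/funext => x; apply: eq_bigr => i _; rewrite ffunE.
Qed.

Lemma slice_monomial_eq0 s x : slice_monomial s x = 0 <-> exists2 j, j \in s & x 0 j = q 0 j.
Proof.
split=> [/eqP/prodf_eq0 [j _]|[j js xj]].
  rewrite expf_eq0 -has_count subr_eq0 => /andP[/hasP[i si /eqP E] /eqP xj].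
  by exists j; rewrite // -E.
apply/eqP/prodf_eq0; exists j => //.
by rewrite xj subrr expr0n -leqn0 leqNgt -has_count (_ : has _ s) //; apply/hasP; exists j => /=.
Qed.

Lemma analytic_germI A f : analytic_germ q A -> analytic_at f q ->
  analytic_germ q (A `&` [set x | f x = 0]).
Proof.
move=> [n [g [ag Ag]]] af.
exists n.+1, (fun e : 'I_n.+1 => if unlift ord0 e is Some t then g t else f); split.
  by move=> e; case: (unlift ord0 e).
rewrite /germ_eq in Ag *; apply: filterS Ag => x [h1 h2]; split.
  by move=> [Ax fx] e; case: (unlift ord0 e) => [t|//]; exact: h1.
move=> h; split; last by have := h ord0; rewrite unlift_none.
by apply: h2 => t; have := h (lift ord0 t); rewrite liftK.
Qed.

(** Split the union of slices as one slice and the others, which are both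
    analytic; irreducibility puts A into one of the two. *)
Lemma irreducible_in_slice A s : irreducible_germ q A ->
  germ_sub q A [set x | exists2 j, j \in s & x 0 j = q 0 j] ->
  exists j, germ_sub q A [set x | x 0 j = q 0 j].
Proof.
move=> [aA A0 irrA]; rewrite /germ_sub /germ_eq in A0 irrA *.
elim: s => [|j s IH] sA.
  by case: A0; apply: filterS sA => x h; split=> // /h [].
have aB := analytic_germI aA (slice_monomial_analytic [:: j]).
have aC := analytic_germI aA (slice_monomial_analytic s).
have [|h|h] := irrA _ _ aB aC.
- apply: filterS sA => x h; split; last by case=> -[].
  move=> Ax; have [l + xl] := h Ax; rewrite inE => /predU1P[lj|ls].
    by left; split=> //; apply/slice_monomial_eq0; exists j; rewrite ?mem_head -?lj.
  by right; split=> //; apply/slice_monomial_eq0; exists l.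
- exists j; apply: filterS h => x [h _] /h [_ /slice_monomial_eq0 [l]].
  by rewrite mem_seq1 => /eqP ->.
- by apply: IH; apply: filterS h => x [h _] /h [_ /slice_monomial_eq0].
Qed.

End GermsOfSlices.

Theorem proposition2p5 (R : realType) (d : nat) (hd : (2 <= d)%N)
    (Omega : set 'rV[R]_d) (hOmega : open Omega)
    (F : 'rV[R]_d -> R) (hF : analytic_on Omega F)
    (V : set 'rV[R]_d) (hV : V = zero_set Omega F)
    (p : 'rV[R]_d) (hp : V p)
    (U : set 'rV[R]_d) (hU : nbhs p U) (hUOmega : U `<=` Omega)
    (hgrad : forall q, (U `&` V) q -> grad F q != 0)
    (hdense : U `&` V `<=` closure (regular_locus F U V))
    (hdeg : forall q, regular_locus F U V q -> locally_degenerate Omega F q) :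
  forall (i : 'I_d) (q : 'rV[R]_d) (A : set 'rV[R]_d),
    (critical_locus F V i `&` U) q ->
    irreducible_component q A (critical_locus F V i `&` U) ->
    exists (j : 'I_d) (c : R), germ_sub q A (slice V j c).
Proof.
move=> i q A [[Vq _] Uq] [irrA subA _]; rewrite /germ_sub in subA *.
have [Omq Fq] : zero_set Omega F q by rewrite -hV.
have [k Fk] : exists k, partial F k q != 0.
  apply: contrapT => H; have /negP := hgrad q (conj Uq Vq); apply.
  apply/eqP/rowP => k; rewrite !mxE; apply/eqP/negP => /negP h.
  by apply: H; exists k.
have near_slices := critical_subset_slices (hF q Omq) Fq Fk (hdense q (conj Uq Vq)) hdeg i.
have [j hj] : exists j, germ_sub q A [set x | x 0 j = q 0 j].
  rewrite /germ_sub; apply: (irreducible_in_slice (s := enum 'I_d) irrA).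
  apply: filterS2 near_slices subA => x h1 h2 Ax.
  have [[Vx Fix] _] := h2 Ax; move: Vx; rewrite hV => -[_ Fx].
  by have [j xj] := h1 Fx Fix; exists j; rewrite ?mem_enum.
rewrite /germ_sub in hj.
exists j, (q 0 j); apply: filterS2 hj subA => x h1 h2 Ax.
by split; [case: (h2 Ax) => -[]|exact: h1].
Qed.
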